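(* Let $G,H$ be locally convex Lie groups with exponential maps and Lie algebras $\mathfrak g,\mathfrak h$. Let $f:H\to G$ be a morphism of Lie groups and $\pi:G\to U(\mathcal H)$ a continuous unitary representation. Assume that the derived homomorphism $\mathbf L(f):\mathfrak h\hookrightarrow\mathfrak g$ is a topological embedding with dense range. Then: (a) If $G$ is locally exponential and $\pi\circ f$ is smooth, then $\pi$ is smooth. Moreover, the spaces of smooth vectors for $\pi$ and $\pi\circ f$ coincide. (b) If $\pi$ is smooth and $\pi\circ f$ is semibounded, then $\pi$ is semibounded.
   Context: Lie groups are modelled on locally convex spaces. A Lie group is locally exponential if it has an exponential map that is a local diffeomorphism at $0$. Continuity of unitary representations refers to the strong operator topology. A unitary representation $\pi:G\to U(\mathcal H)$ on a complex Hilbert space is smooth if the space of smooth vectors $\mathcal H^\infty=\{v: g\mapsto\pi(g)v \text{ smooth}\}$ is dense. For $x\in\mathfrak g$, $\mathtt{d}\pi(x)v=\frac{d}{dt}|_{t=0}\pi(\exp(tx))v$ on $\mathcal H^\infty$ is essentially skew-adjoint; spectra refer to closures. $s_\pi:\mathfrak g\to\mathbb R\cup\{\infty\}$, $s_\pi(x)=\sup\mathrm{Spec}(i\,\mathtt{d}\pi(x))$ (so $\mathcal H\ne\{0\}$). A smooth $\pi$ is semibounded if $s_\pi$ is bounded on some non-empty open subset of $\mathfrak g$. *)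

(* Defs.v *)
From HB Require Import structures.
From mathcomp Require Import all_boot all_order all_algebra.
From mathcomp Require Import sesquilinear complex.
From mathcomp Require Import interval_inference.
From mathcomp Require Import all_classical all_reals topology normedtype convex ereal.

Set Implicit Arguments.
Unset Strict Implicit.
Unset Printing Implicit Defensive.

Import Order.TTheory GRing.Theory Num.Theory.
Import numFieldTopology.Exports numFieldNormedType.Exports.

Local Open Scope classical_set_scope.
Local Open Scope ring_scope.
Local Open Scope complex_scope.

Definition dir_quotient (R : realType) (E F : tvsType R) (f : E -> F)
    (x v : E) : R -> F :=
  fun t => t^-1 *: (f (x + t *: v) - f x).

(* Continuous differentiability in the sense of Bastiani (Michal, Keller's
   C^k_c). [f] is only looked at on [U], which is meant to be open; the derivative
   [df (x, v)] of [f] at [x] in direction [v] lives on [U `*` setT]. *)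
Fixpoint Ck_on (R : realType) (k : nat) (E F : tvsType R) (U : set E)
    (f : E -> F) : Prop :=
  {in U, continuous f} /\
  if k is k'.+1 then
    exists2 df : E * E -> F,
      (forall x v, U x -> dir_quotient f x v @ 0^' --> df (x, v)) &
      Ck_on k' (U `*` [set: E]) df
  else True.

Definition smooth_on (R : realType) (E F : tvsType R) (U : set E) (f : E -> F) :=
  forall k, Ck_on k U f.

Record chart (R : realType) (E : tvsType R) (M : Type) := Chart {
  chart_dom : set M;
  chart_cod : set E;
  chart_map : M -> E;
  chart_inv : E -> M }.

Definition is_chart (R : realType) (E : tvsType R) (M : topologicalType)
    (c : chart E M) : Prop :=
  [/\ open (chart_dom c), open (chart_cod c),
      set_fun (chart_dom c) (chart_cod c) (chart_map c),
      set_fun (chart_cod c) (chart_dom c) (chart_inv c) &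
      [/\ {in chart_dom c, cancel (chart_map c) (chart_inv c)},
          {in chart_cod c, cancel (chart_inv c) (chart_map c)},
          {in chart_dom c, continuous (chart_map c)} &
          {in chart_cod c, continuous (chart_inv c)}]].

Definition mfd_smooth_on (R : realType) (E F : tvsType R)
    (M N : topologicalType) (A : set (chart E M)) (B : set (chart F N))
    (D : set M) (f : M -> N) : Prop :=
  {in D, continuous f} /\
  forall c d, A c -> B d ->
    smooth_on
      (chart_cod c `&` chart_inv c @^-1` (D `&` f @^-1` chart_dom d))
      (chart_map d \o f \o chart_inv c).

Definition is_atlas (R : realType) (E : tvsType R) (M : topologicalType)
    (A : set (chart E M)) : Prop :=
  [/\ forall c, A c -> is_chart c,
      forall p, exists2 c, A c & chart_dom c p &
      (* for the identity map this is smoothness of all chart changes *)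
      mfd_smooth_on A A [set: M] id].

Definition id_chart (R : realType) (E : tvsType R) : chart E E :=
  Chart [set: E] [set: E] id id.

Definition model_atlas (R : realType) (E : tvsType R) : set (chart E E) :=
  [set id_chart E].

Definition prod_chart (R : realType) (E F : tvsType R) (M N : Type)
    (c : chart E M) (d : chart F N) : chart (E * F)%type (M * N)%type :=
  Chart (chart_dom c `*` chart_dom d) (chart_cod c `*` chart_cod d)
    (fun p => (chart_map c p.1, chart_map d p.2))
    (fun p => (chart_inv c p.1, chart_inv d p.2)).

Definition prod_atlas (R : realType) (E F : tvsType R) (M N : Type)
    (A : set (chart E M)) (B : set (chart F N)) :
    set (chart (E * F)%type (M * N)%type) :=
  [set e | exists c d, [/\ A c, B d & e = prod_chart c d]].

(* [chart1] is a chart around the unit; it is what identifies the tangent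
   space at the unit with the model space. *)
HB.mixin Record isLieGroup (R : realType) (E : tvsType R) G
    & Topological G & Group G := {
  hausdorff_model : hausdorff_space E;
  hausdorff_group : hausdorff_space G;
  atlas : set (chart E G);
  atlasP : is_atlas atlas;
  mulg_smooth : mfd_smooth_on (prod_atlas atlas atlas) atlas
    [set: (G * G)%type] (fun p : G * G => (p.1 * p.2)%g);
  invg_smooth : mfd_smooth_on atlas atlas [set: G] (fun g : G => g^-1%g);
  chart1 : chart E G;
  chart1_atlas : atlas chart1;
  chart1_dom : chart_dom chart1 1%g }.

#[short(type="lieGroupType")]
HB.structure Definition LieGroup (R : realType) (E : tvsType R) :=
  {G of isLieGroup R E G & Topological G & Group G}.

(* The Lie algebra, as a locally convex space: the tangent space at the unit
   read in [chart1]. The bracket plays no role here. *)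
Definition lie_algebra (R : realType) (E : tvsType R) (G : lieGroupType E) :
  tvsType R := E.

Definition lie_morphism (R : realType) (E F : tvsType R)
    (G : lieGroupType E) (K : lieGroupType F) (f : G -> K) : Prop :=
  {morph f : x y / (x * y)%g} /\ mfd_smooth_on atlas atlas [set: G] f.

(* The derived homomorphism, i.e. the tangent map at the unit; the default 0 is
   irrelevant when [f] is smooth. *)
Definition derived (R : realType) (E F : tvsType R)
    (G : lieGroupType E) (K : lieGroupType F) (f : G -> K)
    (x : lie_algebra G) : lie_algebra K :=
  xget 0 [set y : lie_algebra K |
    dir_quotient (chart_map (@chart1 R F K) \o f \o chart_inv (@chart1 R E G))
      (chart_map (@chart1 R E G) 1%g) x @ 0^' --> y].

Definition topological_embedding (S T : topologicalType) (f : S -> T) : Prop :=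
  injective f /\ open = [set f @^-1` V | V in (@open T)].

Definition is_exponential (R : realType) (E : tvsType R) (G : lieGroupType E)
    (e : lie_algebra G -> G) : Prop :=
  [/\ mfd_smooth_on (@model_atlas R (lie_algebra G)) atlas [set: lie_algebra G] e,
      forall (x : lie_algebra G) (s t : R),
        e ((s + t) *: x) = (e (s *: x) * e (t *: x))%g &
      forall x : lie_algebra G,
        dir_quotient (chart_map (@chart1 R E G) \o e) 0 x @ 0^' --> x].

Definition locally_exponential (R : realType) (E : tvsType R)
    (G : lieGroupType E) (e : lie_algebra G -> G) : Prop :=
  exists (U : set (lie_algebra G)) (W : set G) (l : G -> lie_algebra G),
    [/\ open U /\ U 0, open W,
        set_fun U W e /\ set_fun W U l,
        {in U, cancel e l} /\ {in W, cancel l e} &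
        mfd_smooth_on atlas (@model_atlas R (lie_algebra G)) W l].

HB.mixin Record isHilbert (R : realType) V & CompleteNormedModule R[i] V := {
  inner : {dot V for (@Num.conj R[i])};
  inner_norm : forall v : V, inner v v = `|v| ^+ 2 }.

#[short(type="hilbertType")]
HB.structure Definition Hilbert (R : realType) :=
  {V of isHilbert R V & CompleteNormedModule R[i] V}.

(* The real locally convex space underlying a complex normed space: the same
   carrier and topology, with scalars restricted along [x |-> x%:C]. It is the
   target for smoothness of orbit maps. *)
Definition realification (R : realType) (V : normedModType R[i]) : Type := V.

Section Realification.
Context (R : realType) (V : normedModType R[i]).
Local Notation VR := (realification V).

HB.instance Definition _ := Uniform.on VR.
HB.instance Definition _ := TopologicalZmodule.on VR.

Definition real_scale (t : R) (v : VR) : VR := t%:C *: (v : V).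

Let real_scaleA a b v : real_scale a (real_scale b v) = real_scale (a * b) v.
Proof. by rewrite /real_scale scalerA rmorphM. Qed.

Let real_scale1 : left_id 1 real_scale.
Proof. by move=> v; rewrite /real_scale rmorph1 scale1r. Qed.

Let real_scaleDr : right_distributive real_scale +%R.
Proof. by move=> a u v; rewrite /real_scale scalerDr. Qed.

Let real_scaleDl v : {morph real_scale^~ v : a b / a + b}.
Proof. by move=> a b; rewrite /real_scale rmorphD scalerDl. Qed.

HB.instance Definition _ := GRing.Zmodule_isLmodule.Build R VR
  real_scaleA real_scale1 real_scaleDr real_scaleDl.

Let real_complex_continuous : continuous (fun t : R => t%:C : R[i]^o).
Proof.
move=> t; apply/cvgrPdist_lt => e e0.
have [er ei] : 0 < complex.Re e /\ complex.Im e = 0.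
  by move: e0; rewrite ltcE /= => /andP[/eqP-> ->].
near=> s; rewrite -rmorphB normc_def /= expr0n addr0 sqrtr_sqr ltcE /= ei eqxx /=.
by near: s; exact: (@cvgr_dist_lt _ R^o).
Unshelve. all: by end_near. Qed.

Let real_scale_continuous : continuous (fun z : R^o * VR => z.1 *: z.2).
Proof.
move=> [t v]; apply: (@continuous_comp (R^o * VR)%type (R[i]^o * V)%type V
  (fun z => (z.1%:C, z.2)) (fun z => z.1 *: z.2)); last exact: scale_continuous.
apply: (@cvg_pair _ _ _ _ (nbhs (t%:C : R[i]^o)) (nbhs (v : V))); last exact: cvg_snd.
by apply: cvg_comp; [exact: cvg_fst|exact: real_complex_continuous].
Qed.

HB.instance Definition _ :=
  TopologicalNmodule_isTopologicalLmodule.Build R VR real_scale_continuous.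

Let real_locally_convex : exists2 B : set_system VR,
  (forall b, b \in B -> convex_set b) & basis B.
Proof.
exists [set B | exists (x : V) r, B = ball x r].
  move=> _ /[!inE] -[x] [r] -> y z l /[!inE] xy xz.
  have [l0 l1] : 0 <= l%:num /\ 0 <= 1 - l%:num by rewrite subr_ge0; split.
  move: xy xz; rewrite -!ball_normE /= => xy xz.
  have -> : x - (conv l y z : V) =
      (l%:num)%:C *: (x - y) + (1 - l%:num)%:C *: (x - z).
    rewrite !scalerBr addrACA -opprD -scalerDl -rmorphD /=.
    by rewrite [l%:num + _]addrC subrK scale1r.
  apply: le_lt_trans (ler_normD _ _) _.
  rewrite !normrZ !ger0_norm ?ler0c//.
  have -> : r = (l%:num)%:C * r + (1 - l%:num)%:C * r.
    by rewrite -mulrDl -rmorphD /= [l%:num + _]addrC subrK mul1r.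
  move: l0; rewrite le_eqVlt => /predU1P[<-|l0].
    by rewrite subr0 rmorph0 rmorph1 !mul0r !mul1r !add0r.
  apply: ltr_leD; first by rewrite ltr_pM2l// ltcR.
  by apply: ler_wpM2l; [rewrite ler0c|exact: ltW].
split; first by move=> _ [x] [r] ->; exact: ball_open.
move=> x B; rewrite -(@nbhs_ballE _ V) => -[r] r0 Bxr.
by exists (ball (x : V) r) => //; split; [exists x, r|exact: ballxx].
Qed.

HB.instance Definition _ := Uniform_isTvs.Build R VR real_locally_convex.

End Realification.

Definition unitary_representation (R : realType) (E : tvsType R)
    (G : lieGroupType E) (V : hilbertType R) (pi : G -> {linear V -> V}) : Prop :=
  [/\ forall v, pi 1%g v = v,
      forall g h v, pi (g * h)%g v = pi g (pi h v),
      forall g v w, inner (pi g v) (pi g w) = inner v w &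
      forall v, continuous (fun g => pi g v)].

Definition smooth_vectors (R : realType) (E : tvsType R) (G : lieGroupType E)
    (V : hilbertType R) (pi : G -> {linear V -> V}) : set V :=
  [set v | mfd_smooth_on atlas (@model_atlas R (realification V)) [set: G]
             (fun g => pi g v : realification V)].

Definition smooth_representation (R : realType) (E : tvsType R)
    (G : lieGroupType E) (V : hilbertType R) (pi : G -> {linear V -> V}) : Prop :=
  dense (smooth_vectors pi).

Definition derived_operator (R : realType) (E : tvsType R) (G : lieGroupType E)
    (e : lie_algebra G -> G) (V : hilbertType R) (pi : G -> {linear V -> V})
    (x : lie_algebra G) : set (V * V) :=
  [set vw | smooth_vectors pi vw.1 /\
     (fun t : R => t^-1%:C *: (pi (e (t *: x)) vw.1 - vw.1)) @ 0^' --> vw.2].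

Definition scale_operator (R : realType) (V : hilbertType R) (z : R[i])
    (A : set (V * V)) : set (V * V) :=
  [set (vw.1, z *: vw.2) | vw in A].

(* [T] is a bounded everywhere defined inverse of [A - z]. *)
Definition resolvent_set (R : realType) (V : hilbertType R)
    (A : set (V * V)) : set R[i] :=
  [set z | exists T : {linear V -> V},
     [/\ continuous T,
         forall w, A (T w, w + z *: T w) &
         forall v w, A (v, w) -> T (w - z *: v) = v]].

Definition spectrum (R : realType) (V : hilbertType R) (A : set (V * V)) :
  set R[i] := ~` resolvent_set A.

(* The spectrum of the closure of i dpi(x), which is contained in the real
   line whenever dpi(x) is essentially skew-adjoint, and its supremum. *)
Definition support_functional (R : realType) (E : tvsType R)
    (G : lieGroupType E) (e : lie_algebra G -> G) (V : hilbertType R)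
    (pi : G -> {linear V -> V}) (x : lie_algebra G) : \bar R :=
  ereal_sup [set r%:E | r in [set r : R |
    spectrum (closure (scale_operator 'i (derived_operator e pi x))) r%:C]].

(* The two-sided bound excludes the zero space, for which the support functional
   is constantly -oo. *)
Definition semibounded (R : realType) (E : tvsType R) (G : lieGroupType E)
    (e : lie_algebra G -> G) (V : hilbertType R)
    (pi : G -> {linear V -> V}) : Prop :=
  smooth_representation pi /\
  exists U : set (lie_algebra G),
    [/\ open U, U !=set0 &
        exists C : R, forall x, U x -> (`|support_functional e pi x| <= C%:E)%E].

(* Main.v *)
(* (a) Uniqueness of one-parameter groups gives [f (exp y) = exp (L(f) y)]. For a
   smooth vector [v] of [pi o f], the maps [(y_1, .., y_n) |-> dpi(y_n) .. dpi(y_1) v]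
   are continuous and multilinear on the subalgebra, hence extend to its closure one
   variable at a time, and a mean value argument shows that the extensions are still
   iterated derivatives of [v] along one-parameter groups. Since
   [g(t) = g(0) exp (sigma(t))] with [sigma] smooth in the locally exponential group,
   the orbit map [x |-> pi(g x) v] has the derivative
   [pi(g x) dpi(delta(x, w)) v] with [delta] the left logarithmic derivative, an
   expression of the same shape with [v] replaced by the extended derivatives; so it
   is of class [C^k] for all [k].

   (b) On [pi]-smooth vectors, [dpi(f)(y) v = dpi(L(f) y) v], and [x |-> dpi(x) v] is
   continuous. Since [sup Spec (i dpi(x))] is the supremum of the numerical range of
   [i dpi(x)] on smooth vectors, an upper bound [C] for it on an open set
   [U = L(f)^-1 W] of the dense subalgebra carries over to [W]; a lower bound near a
   point comes from a single smooth vector. The spectral theorem is avoided: the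
   resolvent of [i dpi(x)] at a point above the numerical range comes from the
   density of the range, which a geometric sum over the one-parameter group gives
   explicitly, and conversely a half-line of resolvent points bounds the numerical
   range. *)

Require Import Defs.
From HB Require Import structures.
From mathcomp Require Import all_boot all_order all_algebra.
From mathcomp Require Import sesquilinear complex ring lra.
From mathcomp Require Import interval_inference.
From mathcomp Require Import all_classical all_reals topology normedtype.
From mathcomp Require Import convex ereal sequences.

Set Implicit Arguments.
Unset Strict Implicit.
Unset Printing Implicit Defensive.

Import Order.TTheory GRing.Theory Num.Theory.
Import numFieldTopology.Exports numFieldNormedType.Exports.

Local Open Scope classical_set_scope.
Local Open Scope ring_scope.

(** * Bastiani calculus in locally convex spaces *)

(** A vector smooth for [pi \o f] only has derivatives along directions in a dense subalgebra, and
    from these a smooth orbit map on [G] has to be built. Unitarity enters through an estimate: the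
    quotient [(pi (exp (t x)) v - v) / t] is a mean value of the [pi (exp (s t x)) w] with [w] the
    derivative, and these stay near [w] uniformly for nearby data. Hence a continuous candidate for
    the derivative that is correct on a dense set is correct everywhere, even jointly in the
    direction and the step. The joint form is essential, because a curve in [G] is [g exp (t s(t))]
    with a direction [s(t)] that moves. The candidates exist because [V] is complete and because a
    continuous linear map on a subspace with the induced topology is uniformly continuous. Joint
    continuity alone would not extend from a dense set, so linearity in every variable is carried
    through all the inductions. *)

Lemma near_dnbhs0 (R : realType) (P : set R) :
  (\forall t \near 0^', P t) <->
  exists2 d : R, 0 < d & forall t, t != 0 -> `|t| < d -> P t.
Proof.
split.
  move=> /nbhs_ballP[d /= d0 dP]; exists d => // t t0 td.
  by apply: dP => //; rewrite /ball /= sub0r normrN.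
move=> [d d0 dP]; near=> t; apply: dP; first by near: t; exact: nbhs_dnbhs_neq.
by near: t; exact: dnbhs0_lt.
Unshelve. all: by end_near. Qed.

Lemma tvs_convex_nbhs (R : realType) (E : tvsType R) (x : E) (U : set E) :
  nbhs x U -> exists N : set E, [/\ open N, N x, N `<=` U &
    forall y z (l : R), 0 <= l -> l <= 1 -> N y -> N z -> N (l *: y + (1 - l) *: z)].
Proof.
have [B Bc [Bo Bn]] := @locally_convex R E.
move=> /Bn[N [BN Nx] NU]; exists N; split=> //; first exact: Bo.
move=> y z l l0 l1 Ny Nz.
have/(_ y z (Itv01 l0 l1)) := Bc N (mem_set BN).
by move=> /(_ (mem_set Ny) (mem_set Nz)) /set_mem.
Qed.

(** A supremum argument replaces continuous functionals and Hahn-Banach. The slope of [c] over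
    [[0, b]] is a convex combination of the slopes over [[0, a]] and [[a, b]] ([glue]), and since
    [N] is open, slopes from a point [s] to nearby points lie in [N]. So the set of [s] whose slope
    over [[0, s]] is in [N] contains its supremum, which cannot be below 1. *)
Lemma mean_value_convex (R : realType) (E : tvsType R) (c c' : R -> E) (N : set E) :
  open N ->
  (forall y z (l : R), 0 <= l -> l <= 1 -> N y -> N z -> N (l *: y + (1 - l) *: z)) ->
  (forall s, 0 <= s -> s <= 1 -> N (c' s) /\
     (fun r : R => r^-1 *: (c (s + r) - c s)) @ 0^' --> c' s) ->
  N (c 1 - c 0).
Proof.
move=> No Nc dc.
have loc s : 0 <= s -> s <= 1 -> exists2 d : R, 0 < d &
    forall r, r != 0 -> `|r| < d -> N (r^-1 *: (c (s + r) - c s)).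
  move=> s0 s1; have [Ns cs] := dc s s0 s1.
  by apply/near_dnbhs0; apply: cs; exact: open_nbhs_nbhs.
have glue a b : 0 < a -> a < b -> N (a^-1 *: (c a - c 0)) ->
    N ((b - a)^-1 *: (c b - c a)) -> N (b^-1 *: (c b - c 0)).
  move=> a0 ab Na Nb.
  have b0 : 0 < b by exact: lt_trans ab.
  have -> : b^-1 *: (c b - c 0) = (a / b) *: (a^-1 *: (c a - c 0)) +
      (1 - a / b) *: ((b - a)^-1 *: (c b - c a)).
    rewrite !scalerA.
    have -> : a / b * a^-1 = b^-1 by field; rewrite !gt_eqF.
    have -> : (1 - a / b) / (b - a) = b^-1 by field; rewrite !gt_eqF ?subr_gt0.
    by rewrite -scalerDr [c a - _ + _]addrC subrKA.
  apply: Nc => //; first by rewrite divr_ge0// ltW.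
  by rewrite ler_pdivrMr// mul1r ltW.
pose S := [set s : R | [/\ 0 < s, s <= 1 & N (s^-1 *: (c s - c 0))]].
have [d d0 d_N] := loc 0 (lexx _) ler01.
pose s0 := Num.min 1 (d / 2).
have s0_gt0 : 0 < s0 by rewrite lt_min ltr01 divr_gt0.
have Ss0 : S s0.
  split=> //; first by rewrite ge_min lexx.
  have := d_N s0; rewrite add0r; apply; first by rewrite gt_eqF.
  rewrite gtr0_norm// (@le_lt_trans _ _ (d / 2))//; first by rewrite ge_min lexx orbT.
  by rewrite ltr_pdivrMr// ltr_pMr// ltr1n.
have hS : has_sup S by split; [exists s0|exists 1 => s []].
set m := sup S.
have m_ge : s0 <= m by apply: ub_le_sup Ss0; case: hS.
have m0 : 0 < m by exact: lt_le_trans m_ge.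
have m1 : m <= 1 by apply: ge_sup; [exists s0|move=> s []].
have [e e0 e_N] := loc m (ltW m0) m1.
have [s Ss ms] := sup_adherent e0 hS; rewrite -/m in ms.
have sm : s <= m by apply: ub_le_sup Ss; case: hS.
have Sm : N (m^-1 *: (c m - c 0)).
  have [s0' _ Ns] := Ss.
  move: sm; rewrite le_eqVlt => /predU1P[<-//|sm].
  apply: (glue s) => //.
  have := e_N (s - m); rewrite subr_eq0 lt_eqF// => /(_ isT).
  rewrite distrC gtr0_norm ?subr_gt0// ltrBlDr -ltrBlDl => /(_ ms).
  by rewrite [m + _]addrC subrK -(opprB m s) invrN -[c s - c m]opprB scaleNr scalerN opprK.
move: m1; rewrite le_eqVlt => /predU1P[m1|m1].
  by move: Sm; rewrite m1 invr1 scale1r.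
pose b := Num.min 1 (m + e / 2).
have mb : m < b by rewrite lt_min m1 ltrDl divr_gt0.
suff Sb : S b by have := ub_le_sup hS.2 Sb; rewrite leNgt mb.
split; [exact: lt_trans mb|by rewrite ge_min lexx|].
apply: (glue m) => //.
have := e_N (b - m); rewrite subr_eq0 gt_eqF// => /(_ isT).
rewrite gtr0_norm ?subr_gt0// [m + _]addrC subrK; apply.
rewrite ltrBlDl (@le_lt_trans _ _ (m + e / 2))//; first by rewrite ge_min lexx orbT.
by rewrite ltrD2l ltr_pdivrMr// ltr_pMr// ltr1n.
Qed.

Lemma near_eq_lim (S : Type) (X : topologicalType) (H : set_system S)
    {FH : Filter H} (p q : S -> X) (l : X) :
  (\forall t \near H, p t = q t) -> p @ H --> l -> q @ H --> l.
Proof. by move=> pq; apply: cvg_trans; exact: near_eq_cvg. Qed.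

Section TvsLimits.
Context (R : realType) (E : tvsType R) (T : Type) (F : set_system T) {FF : Filter F}.

Lemma tvs_cvgD (f g : T -> E) (a b : E) :
  f @ F --> a -> g @ F --> b -> (fun t => f t + g t) @ F --> a + b.
Proof.
move=> fa gb.
exact: (@cvg_comp2 _ _ _ _ _ _ _ _ _ _ _ f g (fun x y : E => x + y) fa gb
  (@add_continuous E (a, b))).
Qed.

Lemma tvs_cvgZ (s : T -> R) (f : T -> E) (r : R) (a : E) :
  s @ F --> r -> f @ F --> a -> (fun t => s t *: f t) @ F --> r *: a.
Proof.
move=> sr fa.
exact: (@cvg_comp2 _ _ _ _ _ _ _ _ _ _ _ (s : T -> R^o) f
  (fun (x : R^o) (y : E) => x *: y) sr fa (@scale_continuous R E (r, a))).
Qed.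

End TvsLimits.

Lemma dnbhs0_mulr (R : realType) (a : R) : a != 0 ->
  (fun t : R => t * a) @ 0^' --> (0 : R)^'.
Proof.
move=> a0 P /near_dnbhs0[d d0 dP]; apply/near_dnbhs0.
exists (d / `|a|); first by rewrite divr_gt0// normr_gt0.
move=> t t0 td; apply: dP; first by rewrite mulf_neq0.
by rewrite normrM -ltr_pdivlMr// normr_gt0.
Qed.

Lemma dnbhs0_id (R : realType) : (fun t : R => t) @ 0^' --> (0 : R).
Proof. exact: nbhs_dnbhs. Qed.

(** [Ck_on] quantifies existentially over the derivative, with a witness for each order and each
    open set. This canonical choice coincides with all of them when the target is Hausdorff. *)
Definition ddir (R : realType) (E F : tvsType R) (f : E -> F) (z : E * E) : F :=
  xget 0 [set y | dir_quotient f z.1 z.2 @ 0^' --> y].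

Lemma ddir_eq (R : realType) (E F : tvsType R) (f : E -> F) x v y :
  hausdorff_space F -> dir_quotient f x v @ 0^' --> y -> ddir f (x, v) = y.
Proof.
move=> hF fy; rewrite /ddir /=; case: xgetP => [z _ fz|]; last by move=> /(_ y)/(_ fy).
exact: (cvg_unique hF fz fy).
Qed.

Section StrongDifferentiability.
Context (R : realType) (E F : tvsType R) (U : set E) (g : E -> F) (dg : E * E -> F).
Hypotheses (Uo : open U)
  (gdg : forall x v, U x -> dir_quotient g x v @ 0^' --> dg (x, v))
  (dgc : {in U `*` [set: E], continuous dg}).

Lemma dir_quotient_along_line (x v : E) (t s : R) : t != 0 -> U (x + (s * t) *: v) ->
  (fun r : R => r^-1 *: (t^-1 *: g (x + ((s + r) * t) *: v)
     - t^-1 *: g (x + (s * t) *: v))) @ 0^' --> dg (x + (s * t) *: v, v).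
Proof.
move=> t0 Us; have := cvg_comp _ _ (dnbhs0_mulr t0) (@gdg _ v Us).
apply: cvg_trans; apply: near_eq_cvg; near=> r.
rewrite /= /dir_quotient mulrDl scalerDl addrA -scalerBr scalerA invfM//.
Unshelve. all: by end_near. Qed.

(** The quotient at [(y, w, t)] is a mean value of [dg (y + s t w, w)] for [s] in [[0, 1]], and
    joint continuity keeps these values in a convex neighbourhood of [dg (x, v)]. Base point and
    direction may therefore move with [t]. *)
Lemma strong_diff (x v : E) : U x ->
  (fun z : (E * E) * R => dir_quotient g z.1.1 z.1.2 z.2)
    @ filter_prod (nbhs (x, v)) 0^' --> dg (x, v).
Proof.
move=> Ux N0 /tvs_convex_nbhs[N [No Nx NN0 Nc]].
have /dgc : (x, v) \in U `*` [set: E] by rewrite inE.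
move=> /(_ N (open_nbhs_nbhs (conj No Nx)))[[A B] [/= nA nB] ABN].
have nAU : nbhs x (A `&` U) by apply: filterI => //; exact: open_nbhs_nbhs.
have : (fun z : (E * E) * R => z.1.1 + z.2 *: z.1.2) @ nbhs ((x, v), 0) --> x + 0 *: v.
  apply: tvs_cvgD; first by apply: cvg_comp; [exact: cvg_fst|exact: cvg_fst].
  apply: tvs_cvgZ; first exact: cvg_snd.
  by apply: cvg_comp; [exact: cvg_fst|exact: cvg_snd].
rewrite scale0r addr0 => /(_ _ nAU)[[/= P Q] [/= nP nQ] PQ].
move/nbhs_ballP : nQ => [d /= d0 dQ].
exists (P `&` (fun z => B z.2), [set t : R | t != 0 /\ `|t| < d]) => /=.
  split.
    apply: filterI => //; exists (setT, B) => //=; last by move=> [? ?] [].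
    by split => //; exact: filterT.
  by apply/near_dnbhs0; exists d.
move=> [[y w] t] /= [[Pyw Bw] [t0 td]]; apply: NN0.
have AU s : 0 <= s -> s <= 1 -> (A `&` U) (y + (s * t) *: w).
  move=> s0 s1; apply: (PQ ((y, w), s * t)); split => //=; apply: dQ.
  rewrite /ball /= sub0r normrN normrM ger0_norm// (le_lt_trans _ td)//.
  by rewrite ler_piMl.
have := @mean_value_convex R F (fun s => t^-1 *: g (y + (s * t) *: w))
  (fun s => dg (y + (s * t) *: w, w)) N No Nc.
rewrite mul1r mul0r scale0r addr0 -scalerBr; apply=> s s0 s1.
have [As Us] := AU s s0 s1.
split; first by apply: (ABN (_, _)).
exact: dir_quotient_along_line.
Qed.

Lemma strong_diff_cvg (T : Type) (G : set_system T) {FG : Filter G}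
  (y w : T -> E) (s : T -> R) (x v : E) : U x ->
  y @ G --> x -> w @ G --> v -> s @ G --> 0^' ->
  (fun i => (s i)^-1 *: (g (y i + s i *: w i) - g (y i))) @ G --> dg (x, v).
Proof.
move=> Ux yx wv s0.
have h : (fun i => ((y i, w i), s i)) @ G --> filter_prod (nbhs (x, v)) 0^'.
  exact: (cvg_pair (cvg_pair yx wv) s0).
exact: (cvg_comp _ _ h (strong_diff Ux)).
Qed.

Lemma dir_derivative_scale (x v : E) (a : R) : hausdorff_space F -> U x ->
  dg (x, a *: v) = a *: dg (x, v).
Proof.
move=> hF Ux; have [->|a0] := eqVneq a 0.
  rewrite !scale0r; apply: (cvg_unique hF (@gdg _ 0 Ux)) => /=.
  apply: (near_eq_lim (p := fun=> 0)); last exact: cvg_cst.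
  by near=> t; rewrite /dir_quotient scaler0 addr0 subrr scaler0.
apply: (cvg_unique hF (@gdg _ (a *: v) Ux)).
apply: (near_eq_lim (p := fun t => a *: dir_quotient g x v (t * a))); last first.
  apply: tvs_cvgZ; first exact: cvg_cst.
  exact: (cvg_comp _ _ (dnbhs0_mulr a0) (@gdg _ v Ux)).
near=> t; rewrite /= /dir_quotient !scalerA invfM mulrCA divff// mulr1.
Unshelve. all: by end_near. Qed.

(** The step [t (v + w)] is made in two stages. The second starts from the moving point [x + t v],
    which is where strong differentiability is needed. *)
Lemma dir_derivative_add (x v w : E) : hausdorff_space F -> U x ->
  dg (x, v + w) = dg (x, v) + dg (x, w).
Proof.
move=> hF Ux; apply: (cvg_unique hF (@gdg _ (v + w) Ux)).
have xv : (fun t : R => x + t *: v) @ 0^' --> x.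
  rewrite -{2}[x]addr0 -(scale0r v); apply: tvs_cvgD; first exact: cvg_cst.
  by apply: tvs_cvgZ; [exact: dnbhs0_id|exact: cvg_cst].
apply: (near_eq_lim (p := fun t => dir_quotient g x v t +
    t^-1 *: (g (x + t *: v + t *: w) - g (x + t *: v)))); last first.
  apply: tvs_cvgD; first exact: gdg.
  by apply: strong_diff_cvg => //; exact: cvg_cst.
near=> t; rewrite /= /dir_quotient -scalerDr [_ - g x + _]addrC subrKA [t *: (_ + _)]scalerDr addrA.
Unshelve. all: by end_near. Qed.

End StrongDifferentiability.

Lemma near_line_open (R : realType) (E : tvsType R) (U : set E) (x v : E) :
  open U -> U x -> \forall t \near (0 : R)^', U (x + t *: v).
Proof.
move=> Uo Ux.
have : (fun t : R => x + t *: v) @ 0^' --> x.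
  rewrite -[X in _ --> X]addr0 -(scale0r v); apply: tvs_cvgD; first exact: cvg_cst.
  by apply: tvs_cvgZ; [exact: dnbhs0_id|exact: cvg_cst].
by apply; exact: open_nbhs_nbhs.
Qed.

Lemma open_setXT (S T : topologicalType) (U : set S) : open U -> open (U `*` [set: T]).
Proof.
move=> Uo; rewrite openE => -[x y] [/= Ux _]; exists (U, setT) => //=.
by split; [exact: open_nbhs_nbhs|exact: filterT].
Qed.

Section CkOn.
Context (R : realType).
Implicit Types (E F G : tvsType R) (k : nat).

Lemma Ck_on_continuous k E F (U : set E) (f : E -> F) : Ck_on k U f -> {in U, continuous f}.
Proof. by case: k => [|k] []. Qed.

Lemma continuous_in_congr (S T : topologicalType) (U : set S) (f g : S -> T) :
  open U -> {in U, f =1 g} -> {in U, continuous f} -> {in U, continuous g}.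
Proof.
move=> Uo fg fc x xU; rewrite /continuous_at -fg//.
apply: near_eq_lim (fc x xU); have : nbhs x U by apply: open_nbhs_nbhs; split=> //; exact/set_mem.
by apply: filterS => y /mem_set; exact: fg.
Qed.

Lemma Ck_on_congr k E F (U : set E) (f g : E -> F) : open U -> {in U, f =1 g} ->
  Ck_on k U f -> Ck_on k U g.
Proof.
case: k => [|k] Uo fg [fc].
  by move=> _; split=> //; exact: continuous_in_congr fc.
move=> [df fdf dfk]; split; first exact: continuous_in_congr fc.
exists df => // x v Ux; apply: near_eq_lim (fdf x v Ux).
near=> t; rewrite /dir_quotient !fg ?inE//.
by near: t; exact: near_line_open.
Unshelve. all: by end_near. Qed.

Lemma Ck_on_subset k E F (U U' : set E) (f : E -> F) : U' `<=` U -> Ck_on k U f -> Ck_on k U' f.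
Proof.
elim: k E F U U' f => [|k IH] E F U U' f UU' [fc] fk.
  by split=> // x /set_mem/UU'/mem_set; exact: fc.
split; first by move=> x /set_mem/UU'/mem_set; exact: fc.
case: fk => df fdf dfk; exists df; first by move=> x v /UU'; exact: fdf.
by apply: IH dfk => -[x v] [/= /UU'].
Qed.

Lemma Ck_onS k E F (U : set E) (f : E -> F) : Ck_on k.+1 U f -> Ck_on k U f.
Proof.
elim: k E F U f => [|k IH] E F U f [fc [df fdf dfk]]; first by split.
by split=> //; exists df => //; exact: IH.
Qed.

Lemma Ck_on_linear k E F (U : set E) (f : E -> F) : continuous f ->
  (forall a x y, f (a *: x + y) = a *: f x + f y) -> Ck_on k U f.
Proof.
move=> fc fl; elim: k E U f fc fl => [|k IH] E U f fc fl.
  by split=> // x _; exact: fc.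
split; first by move=> x _; exact: fc.
exists (f \o snd).
  move=> x v _; apply: (near_eq_lim (p := fun=> f v)); last exact: cvg_cst.
  near=> t; have t0 : t != 0 by near: t; exact: nbhs_dnbhs_neq.
  by rewrite /dir_quotient [x + _]addrC fl addrK scalerA mulVf// scale1r.
apply: IH => [[x v]|a [x v] [y w]] /=; last exact: fl.
by apply: continuous_comp; [exact: cvg_snd|exact: fc].
Unshelve. all: by end_near. Qed.

Lemma Ck_on_cst k E F (U : set E) (c : F) : Ck_on k U (fun=> c).
Proof.
elim: k E U c => [|k IH] E U c.
  by split=> // x _; exact: cvg_cst.
split; first by move=> x _; exact: cvg_cst.
exists (fun=> 0); last exact: IH.
move=> x v _; apply: (near_eq_lim (p := fun=> 0)); last exact: cvg_cst.
by near=> t; rewrite /dir_quotient subrr scaler0.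
Unshelve. all: by end_near. Qed.

Lemma Ck_on_pair k E F G (U : set E) (f : E -> F) (g : E -> G) :
  Ck_on k U f -> Ck_on k U g -> Ck_on k U (fun x => (f x, g x)).
Proof.
elim: k E F G U f g => [|k IH] E F G U f g [fc fk] [gc gk].
  split=> // x xU; exact: (cvg_pair (fc x xU) (gc x xU)).
split; first by move=> x xU; exact: (cvg_pair (fc x xU) (gc x xU)).
case: fk => df fdf dfk; case: gk => dg gdg dgk.
exists (fun z => (df z, dg z)); last exact: IH.
by move=> x v Ux; exact: (cvg_pair (fdf x v Ux) (gdg x v Ux)).
Qed.

Lemma Ck_on_fst k E F (U : set (E * F)) : Ck_on k U (fun z : E * F => z.1).
Proof. by apply: Ck_on_linear => // x; exact: cvg_fst. Qed.

Lemma Ck_on_snd k E F (U : set (E * F)) : Ck_on k U (fun z : E * F => z.2).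
Proof. by apply: Ck_on_linear => // x; exact: cvg_snd. Qed.

Lemma Ck_on_comp k E F G (U : set E) (V : set F) (f : E -> F) (g : F -> G) :
  open U -> open V -> set_fun U V f -> Ck_on k U f -> Ck_on k V g -> Ck_on k U (g \o f).
Proof.
elim: k E F G U V f g => [|k IH] E F G U V f g Uo Vo UV [fc fk] [gc gk].
  split=> // x xU; apply: continuous_comp; first exact: fc.
  by apply: gc; apply/mem_set/UV/set_mem.
split.
  move=> x xU; apply: continuous_comp; first exact: fc.
  by apply: gc; apply/mem_set/UV/set_mem.
case: fk => df fdf dfk; case: gk => dg gdg dgk.
exists (dg \o (fun z => (f z.1, df z))).
  move=> x v Ux.
  (* The increment of [f] is [t] times its own quotient, so [g] is differentiated along a direction
     that varies with [t] and tends to [df (x, v)]. *)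
  apply: (near_eq_lim (p := fun t : R => t^-1 *: (g (f x + t *: dir_quotient f x v t) - g (f x)))).
    near=> t; have t0 : t != 0 by near: t; exact: nbhs_dnbhs_neq.
    by rewrite /dir_quotient scalerA divff// scale1r [f x + _]addrC subrK.
  apply: (strong_diff_cvg Vo gdg (Ck_on_continuous dgk)).
  - exact: UV.
  - exact: cvg_cst.
  - exact: fdf.
  - exact: cvg_id.
apply: (IH _ _ _ _ (V `*` [set: F])) => //.
- exact: open_setXT.
- exact: open_setXT.
- by move=> [x v] [/= Ux _]; split=> //; exact: UV.
apply: Ck_on_pair => //.
apply: (IH _ _ _ _ U fst) => //; first exact: open_setXT.
- by move=> [x v] [].
- exact: Ck_on_fst.
have : Ck_on k.+1 U f by split=> //; exists df.
exact: Ck_onS.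
Unshelve. all: by end_near. Qed.

End CkOn.

Section SmoothOn.
Context (R : realType).
Implicit Types (E F G : tvsType R) (k : nat).

(** The local witnesses for the derivative all agree with [ddir f], so no choice has to be glued and
    the induction applies to [ddir f]. *)
Lemma Ck_on_local k E F (U : set E) (f : E -> F) : hausdorff_space F -> open U ->
  (forall x, U x -> exists U', [/\ open U', U' x & Ck_on k U' f]) -> Ck_on k U f.
Proof.
move=> hF; elim: k E U f => [|k IH] E U f Uo Uf.
  by split=> // x /set_mem/Uf[U' [_ /mem_set U'x [fc _]]]; exact: fc.
split; first by move=> x /set_mem/Uf[U' [_ /mem_set U'x [fc _]]]; exact: fc.
exists (ddir f).
  move=> x v /Uf[U' [_ U'x [_ [df fdf _]]]].
  by rewrite (ddir_eq hF (fdf x v U'x)); exact: fdf.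
apply: IH => [|[x v] [/= Ux _]]; first exact: open_setXT.
have [U' [U'o U'x [_ [df fdf dfk]]]] := Uf _ Ux.
exists (U' `*` setT); split=> //; first exact: open_setXT.
apply: Ck_on_congr dfk; first exact: open_setXT.
move=> [y w] /set_mem[/= U'y _].
by rewrite (ddir_eq hF (fdf y w U'y)).
Qed.

Lemma Ck_on_add k E F (U : set E) (f g : E -> F) : open U ->
  Ck_on k U f -> Ck_on k U g -> Ck_on k U (fun x => f x + g x).
Proof.
move=> Uo fk gk.
have : Ck_on k [set: (F * F)%type] (fun z : F * F => z.1 + z.2).
  apply: Ck_on_linear; first exact: add_continuous.
  by move=> a [x y] [x' y'] /=; rewrite scalerDr addrACA.
apply: (Ck_on_comp Uo openT _ (Ck_on_pair fk gk)).
by [].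
Qed.

Lemma Ck_on_sum k E F (U : set E) (I : Type) (s : seq I) (f : I -> E -> F) : open U ->
  (forall i, Ck_on k U (f i)) -> Ck_on k U (fun x => \sum_(i <- s) f i x).
Proof.
move=> Uo fk; elim: s => [|i s IH].
  apply: (Ck_on_congr Uo (f := fun=> 0)); last exact: Ck_on_cst.
  by move=> x _; rewrite big_nil.
apply: (Ck_on_congr Uo (f := fun x => f i x + \sum_(j <- s) f j x)).
  by move=> x _; rewrite big_cons.
exact: Ck_on_add.
Qed.

Lemma smooth_on_continuous E F (U : set E) (f : E -> F) : smooth_on U f -> {in U, continuous f}.
Proof. by move=> /(_ 0%N)[]. Qed.

Lemma smooth_on_congr E F (U : set E) (f g : E -> F) : open U -> {in U, f =1 g} ->
  smooth_on U f -> smooth_on U g.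
Proof. by move=> Uo fg fs k; exact: Ck_on_congr (fs k). Qed.

Lemma smooth_on_subset E F (U U' : set E) (f : E -> F) :
  U' `<=` U -> smooth_on U f -> smooth_on U' f.
Proof. by move=> UU' fs k; exact: Ck_on_subset (fs k). Qed.

Lemma smooth_on_linear E F (U : set E) (f : E -> F) : continuous f ->
  (forall a x y, f (a *: x + y) = a *: f x + f y) -> smooth_on U f.
Proof. by move=> fc fl k; exact: Ck_on_linear. Qed.

Lemma smooth_on_id E (U : set E) : smooth_on U (fun x : E => x).
Proof. by apply: smooth_on_linear => // x; exact: cvg_id. Qed.

Lemma smooth_on_cst E F (U : set E) (c : F) : smooth_on U (fun=> c).
Proof. by move=> k; exact: Ck_on_cst. Qed.

Lemma smooth_on_pair E F G (U : set E) (f : E -> F) (g : E -> G) :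
  smooth_on U f -> smooth_on U g -> smooth_on U (fun x => (f x, g x)).
Proof. by move=> fs gs k; exact: Ck_on_pair. Qed.

Lemma smooth_on_comp E F G (U : set E) (V : set F) (f : E -> F) (g : F -> G) :
  open U -> open V -> set_fun U V f -> smooth_on U f -> smooth_on V g -> smooth_on U (g \o f).
Proof. by move=> Uo Vo UV fs gs k; exact: (Ck_on_comp Uo Vo UV (fs k) (gs k)). Qed.

Lemma smooth_on_fst E F (U : set (E * F)) : smooth_on U (fun z : E * F => z.1).
Proof. by move=> k; exact: Ck_on_fst. Qed.

Lemma smooth_on_snd E F (U : set (E * F)) : smooth_on U (fun z : E * F => z.2).
Proof. by move=> k; exact: Ck_on_snd. Qed.

Lemma smooth_on_compfst E F G (U : set E) (f : E -> G) : open U -> smooth_on U f ->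
  smooth_on (U `*` [set: F]) (fun z => f z.1).
Proof.
move=> Uo; apply: smooth_on_comp => //; first exact: open_setXT.
  by move=> [x y] [].
exact: smooth_on_fst.
Qed.

Lemma smooth_on_local E F (U : set E) (f : E -> F) : hausdorff_space F -> open U ->
  (forall x, U x -> exists U', [/\ open U', U' x & smooth_on U' f]) -> smooth_on U f.
Proof.
move=> hF Uo Uf k; apply: Ck_on_local => // x /Uf[U' [U'o U'x fU']].
by exists U'; split.
Qed.

Section Derivative.
Context (E F : tvsType R) (U : set E) (f : E -> F).
Hypotheses (hF : hausdorff_space F) (Uo : open U) (fs : smooth_on U f).

Lemma smooth_on_cvg_ddir x v : U x -> dir_quotient f x v @ 0^' --> ddir f (x, v).
Proof.
by move=> Ux; have [_ [df fdf _]] := fs 1; rewrite (ddir_eq hF (fdf x v Ux)); exact: fdf.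
Qed.

Lemma smooth_on_ddir : smooth_on (U `*` [set: E]) (ddir f).
Proof.
move=> k; have [_ [df fdf dfk]] := fs k.+1.
apply: Ck_on_congr dfk; first exact: open_setXT.
by move=> [x v] /set_mem[/= Ux _]; rewrite (ddir_eq hF (fdf x v Ux)).
Qed.

Lemma smooth_on_strong_diff (T : Type) (H : set_system T) {FH : Filter H}
  (y w : T -> E) (s : T -> R) (x v : E) : U x ->
  y @ H --> x -> w @ H --> v -> s @ H --> 0^' ->
  (fun i => (s i)^-1 *: (f (y i + s i *: w i) - f (y i))) @ H --> ddir f (x, v).
Proof.
apply: strong_diff_cvg => //; first by move=> *; exact: smooth_on_cvg_ddir.
exact: smooth_on_continuous smooth_on_ddir.
Qed.

Lemma smooth_on_cvg_curve (c : R -> E) x v : U x ->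
  (fun t => t^-1 *: (c t - x)) @ 0^' --> v ->
  (fun t => t^-1 *: (f (c t) - f x)) @ 0^' --> ddir f (x, v).
Proof.
move=> Ux cv.
apply: (near_eq_lim (p := fun t : R =>
  t^-1 *: (f (x + t *: (t^-1 *: (c t - x))) - f x))).
  near=> t; have t0 : t != 0 by near: t; exact: nbhs_dnbhs_neq.
  by rewrite scalerA divff// scale1r [x + _]addrC subrK.
by apply: smooth_on_strong_diff => //; exact: cvg_cst.
Unshelve. all: by end_near. Qed.

Lemma ddirD x v w : U x -> ddir f (x, v + w) = ddir f (x, v) + ddir f (x, w).
Proof.
move=> Ux; apply: (dir_derivative_add Uo) Ux => //.
- by move=> *; exact: smooth_on_cvg_ddir.
- exact: smooth_on_continuous smooth_on_ddir.
Qed.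

Lemma ddirZ x a v : U x -> ddir f (x, a *: v) = a *: ddir f (x, v).
Proof.
by move=> Ux; apply: (dir_derivative_scale (U := U)) => // *; exact: smooth_on_cvg_ddir.
Qed.

End Derivative.

End SmoothOn.

(** * Unitary representations, the unit chart and orbit maps *)

Lemma realification_hausdorff (R : realType) (V : normedModType R[i]) :
  hausdorff_space (realification V).
Proof. exact: (@norm_hausdorff _ V). Qed.

Section UnitaryRepresentation.
Context (R : realType) (E : tvsType R) (G : lieGroupType E) (V : hilbertType R)
  (pi : G -> {linear V -> V}) (hpi : unitary_representation pi).

Lemma urep1 v : pi 1%g v = v. Proof. by case: hpi. Qed.

Lemma urepM g h v : pi (g * h)%g v = pi g (pi h v). Proof. by case: hpi. Qed.

Lemma urep_inner g v w : inner (pi g v) (pi g w) = inner v w. Proof. by case: hpi. Qed.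

Lemma urep_norm g v : `|pi g v| = `|v|.
Proof.
apply/eqP; rewrite -(@eqrXn2 _ 2)//; apply/eqP.
by rewrite -!inner_norm urep_inner.
Qed.

(** Strong continuity upgrades to joint continuity of the action because the operators [pi (g t)]
    are isometries, hence equicontinuous. *)
Lemma urep_cvg (T : Type) (F : set_system T) {FF : Filter F} (g : T -> G) (v : T -> V) g0 v0 :
  g @ F --> g0 -> v @ F --> v0 -> (fun t => pi (g t) (v t)) @ F --> pi g0 v0.
Proof.
move=> gg vv; have pc : (fun t => pi (g t) v0) @ F --> pi g0 v0.
  have [_ _ _ c] := hpi.
  exact: (cvg_comp _ _ gg (c v0 g0)).
apply/cvgrPdist_lt => e e0; near=> t.
have -> : pi g0 v0 - pi (g t) (v t) = (pi g0 v0 - pi (g t) v0) + pi (g t) (v0 - v t).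
  by rewrite linearB addrA subrK.
rewrite (le_lt_trans (ler_normD _ _))// urep_norm [e]splitr ltrD//.
  by near: t; move/cvgrPdist_lt: pc; apply; rewrite divr_gt0.
by near: t; move/cvgrPdist_lt: vv; apply; rewrite divr_gt0.
Unshelve. all: by end_near. Qed.

Lemma urep_cont g : continuous (pi g).
Proof. by move=> v; apply: urep_cvg; [exact: cvg_cst|exact: cvg_id]. Qed.

End UnitaryRepresentation.

Lemma open_preimage_in (S T : topologicalType) (U : set S) (W : set T) (g : S -> T) :
  open U -> {in U, continuous g} -> open W -> open (U `&` g @^-1` W).
Proof.
move=> Uo gc Wo; rewrite openE => x [Ux Wgx]; apply: filterI.
  by apply: open_nbhs_nbhs.
by apply: (gc x (mem_set Ux)); exact: open_nbhs_nbhs.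
Qed.

Lemma open_mfd_dom (R : realType) (E F : tvsType R) (M N : topologicalType)
    (c : chart E M) (d : chart F N) (D : set M) (f : M -> N) :
  is_chart c -> is_chart d -> open D -> {in D, continuous f} ->
  open (chart_cod c `&` chart_inv c @^-1` (D `&` f @^-1` chart_dom d)).
Proof.
move=> [_ co _ _ [_ _ _ ic]] [od _ _ _ _] Do fc.
by apply: open_preimage_in => //; exact: open_preimage_in.
Qed.

(** * Coordinates and velocities at the unit *)

Section UnitChart.
Context (R : realType) (E : tvsType R) (G : lieGroupType E).

Definition ucod : set E := chart_cod (@chart1 R E G).

Definition udom : set G := chart_dom (@chart1 R E G).

Definition umap : G -> E := chart_map (@chart1 R E G).

Definition uinv : E -> G := chart_inv (@chart1 R E G).

Lemma atlas_chart (c : chart E G) : atlas c -> is_chart c.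
Proof. by have [+ _ _] := @atlasP R E G; apply. Qed.

Lemma atlas_cover (g : G) : exists2 c : chart E G, atlas c & chart_dom c g.
Proof. by have [_ + _] := @atlasP R E G; apply. Qed.

Lemma unit_is_chart : is_chart (@chart1 R E G).
Proof. exact/atlas_chart/chart1_atlas. Qed.

Lemma udom_open : open udom. Proof. by case: unit_is_chart. Qed.

Lemma ucod_open : open ucod. Proof. by case: unit_is_chart. Qed.

Lemma udom1 : udom 1%g. Proof. exact: chart1_dom. Qed.

Lemma umap_cod g : udom g -> ucod (umap g).
Proof. by have [_ _ + _ _] := unit_is_chart; apply. Qed.

Lemma uinv_dom x : ucod x -> udom (uinv x).
Proof. by have [_ _ _ + _] := unit_is_chart; apply. Qed.

Lemma umapK g : udom g -> uinv (umap g) = g.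
Proof. by move=> gd; have [_ _ _ _ [K _ _ _]] := unit_is_chart; apply: K; rewrite inE. Qed.

Lemma uinvK x : ucod x -> umap (uinv x) = x.
Proof. by move=> xc; have [_ _ _ _ [_ K _ _]] := unit_is_chart; apply: K; rewrite inE. Qed.

Lemma uinv_cont x : ucod x -> {for x, continuous uinv}.
Proof. by move=> xc; have [_ _ _ _ [_ _ _ c]] := unit_is_chart; apply: c; rewrite inE. Qed.

Lemma ucod1 : ucod (umap 1%g). Proof. exact/umap_cod/udom1. Qed.

Lemma uinv1 : uinv (umap 1%g) = 1%g. Proof. exact/umapK/udom1. Qed.

(** The curve [g] has tangent vector [x] at the unit. Convergence in [G] is a separate clause
    because [umap] takes arbitrary values outside [udom], so a limit of coordinates alone does not
    place [g t] in the chart. *)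
Definition velocity1 (g : R -> G) (x : E) :=
  g @ 0^' --> (1%g : G) /\ (fun t => t^-1 *: (umap (g t) - umap 1%g)) @ 0^' --> x.

Lemma velocity1_udom g x : velocity1 g x -> \forall t \near 0^', udom (g t).
Proof. by move=> [+ _]; apply; apply: open_nbhs_nbhs; split; [exact: udom_open|exact: udom1]. Qed.

Lemma exp0 (e : lie_algebra G -> G) : is_exponential e -> e 0 = 1%g.
Proof.
move=> [_ eD _]; have := eD 0 0 0; rewrite !scaler0.
by move=> /(congr1 (fun g => (e 0)^-1 * g)%g); rewrite mulVg mulKg.
Qed.

Lemma exp_cont (e : lie_algebra G -> G) : is_exponential e -> continuous e.
Proof. by move=> [[ec _] _ _] x; apply: ec; rewrite inE. Qed.

Lemma exp_velocity (e : lie_algebra G -> G) x : is_exponential e ->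
  velocity1 (fun t => e (t *: x)) x.
Proof.
move=> he; split.
  rewrite -(exp0 he) -(scale0r x).
  apply: (cvg_comp (fun t : R => t *: x) e); last exact: exp_cont.
  by apply: tvs_cvgZ; [exact: dnbhs0_id|exact: cvg_cst].
have [_ _ /(_ x)] := he; apply: cvg_trans; apply: near_eq_cvg; near=> t.
by rewrite /dir_quotient /= add0r exp0.
Unshelve. all: by end_near. Qed.

End UnitChart.

Section Morphism.
Context (R : realType) (E F : tvsType R) (G : lieGroupType E) (K : lieGroupType F)
  (f : G -> K) (hf : lie_morphism f).

Lemma lie_morphism1 : f 1%g = 1%g.
Proof.
have [fM _] := hf; have := fM 1%g 1%g; rewrite mulg1.
by move=> /(congr1 (fun g => (f 1)^-1 * g)%g); rewrite mulVg mulKg.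
Qed.

Lemma lie_morphism_cont : continuous f.
Proof. by have [_ [fc _]] := hf; move=> x; apply: fc; rewrite inE. Qed.

Let D : set E := ucod G `&` uinv G @^-1` ([set: G] `&` f @^-1` @udom R F K).

Let Do : open D.
Proof.
apply: open_mfd_dom; [exact: unit_is_chart|exact: unit_is_chart|exact: openT|].
by move=> x _; exact: lie_morphism_cont.
Qed.

Let D1 : D (umap (1%g : G)).
Proof.
split; first exact: ucod1.
by split=> //; rewrite /preimage/= uinv1 lie_morphism1; exact: udom1.
Qed.

Let floc : smooth_on D (umap (G := K) \o f \o uinv G).
Proof. by have [_ [_]] := hf; apply; exact: chart1_atlas. Qed.

Lemma derivedE x : derived f x = ddir (umap (G := K) \o f \o uinv G) (umap (1%g : G), x).
Proof. by []. Qed.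

Lemma derivedD x y : derived f (x + y) = derived f x + derived f y.
Proof. by rewrite !derivedE; apply: (ddirD hausdorff_model Do floc). Qed.

Lemma derivedZ a x : derived f (a *: x) = a *: derived f x.
Proof. by rewrite !derivedE; apply: (ddirZ hausdorff_model floc). Qed.

Lemma morphism_velocity (g : R -> G) x : velocity1 g x -> velocity1 (f \o g) (derived f x).
Proof.
move=> gx; have [g1 gv] := gx; split.
  rewrite -lie_morphism1; exact: (cvg_comp _ _ g1 (@lie_morphism_cont 1%g)).
have := smooth_on_cvg_curve (@hausdorff_model R F K) Do floc D1 gv.
apply: near_eq_lim; near=> t.
rewrite /= umapK; last by near: t; exact: velocity1_udom gx.
by rewrite uinv1 lie_morphism1.
Unshelve. all: by end_near. Qed.

End Morphism.

Lemma id_chartP (R : realType) (E : tvsType R) : is_chart (id_chart E).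
Proof.
split=> //=; [exact: openT|exact: openT|].
by split=> // x _; exact: cvg_id.
Qed.

Lemma open_setX (S T : topologicalType) (U : set S) (W : set T) :
  open U -> open W -> open (U `*` W).
Proof.
move=> Uo Wo; rewrite openE => -[x y] [/= Ux Wy]; exists (U, W) => //=.
by split; exact: open_nbhs_nbhs.
Qed.

Lemma prod_chartP (R : realType) (E F : tvsType R) (M N : topologicalType)
  (c : chart E M) (d : chart F N) : is_chart c -> is_chart d -> is_chart (prod_chart c d).
Proof.
move=> [c1 c2 c3 c4 [c5 c6 c7 c8]] [d1 d2 d3 d4 [d5 d6 d7 d8]]; split=> //=.
- exact: open_setX.
- exact: open_setX.
- by move=> [x y] [/= cx dy]; split; [exact: c3|exact: d3].
- by move=> [x y] [/= cx dy]; split; [exact: c4|exact: d4].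
split=> /=.
- by move=> [x y] /set_mem[/= cx dy]; rewrite c5 ?inE// d5 ?inE.
- by move=> [x y] /set_mem[/= cx dy]; rewrite c6 ?inE// d6 ?inE.
- move=> [x y] /set_mem[/= cx dy]; apply: (cvg_pair (f := fun p => _) (g := fun p => _)).
    apply: (@continuous_comp _ _ _ fst (chart_map c) (x, y)); first exact: cvg_fst.
    by apply: c7; rewrite inE.
  apply: (@continuous_comp _ _ _ snd (chart_map d) (x, y)); first exact: cvg_snd.
  by apply: d7; rewrite inE.
- move=> [x y] /set_mem[/= cx dy]; apply: (cvg_pair (f := fun p => _) (g := fun p => _)).
    apply: (@continuous_comp _ _ _ fst (chart_inv c) (x, y)); first exact: cvg_fst.
    by apply: c8; rewrite inE.
  apply: (@continuous_comp _ _ _ snd (chart_inv d) (x, y)); first exact: cvg_snd.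
  by apply: d8; rewrite inE.
Qed.

Section MfdComp.
Context (R : realType) (E F K : tvsType R) (M N P : topologicalType)
  (A : set (chart E M)) (B : set (chart F N)) (C : set (chart K P)).
Hypotheses (Ac : forall c, A c -> is_chart c) (Bc : forall c, B c -> is_chart c)
  (Cc : forall c, C c -> is_chart c) (Bcov : forall p, exists2 c, B c & chart_dom c p)
  (hK : hausdorff_space K).

Lemma mfd_smooth_comp (f : M -> N) (g : N -> P) :
  mfd_smooth_on A B [set: M] f -> mfd_smooth_on B C [set: N] g ->
  mfd_smooth_on A C [set: M] (g \o f).
Proof.
move=> [fc fs] [gc gs].
have fc' x : {for x, continuous f} by apply: fc; rewrite inE.
have gc' x : {for x, continuous g} by apply: gc; rewrite inE.
have gfc : {in [set: M], continuous (g \o f)} by move=> x _; exact: continuous_comp.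
split=> // c d cA dC.
have So : open (chart_cod c `&` chart_inv c @^-1` ([set: M] `&` (g \o f) @^-1` chart_dom d)).
  by apply: open_mfd_dom => //; [exact: Ac|exact: Cc|exact: openT].
apply: smooth_on_local => // x [xc [_ /= xd]].
have [b bB xb] := Bcov (f (chart_inv c x)).
exists ((chart_cod c `&` chart_inv c @^-1` ([set: M] `&` (g \o f) @^-1` chart_dom d)) `&`
  (chart_cod c `&` chart_inv c @^-1` ([set: M] `&` f @^-1` chart_dom b))).
have S'o : open (chart_cod c `&` chart_inv c @^-1` ([set: M] `&` f @^-1` chart_dom b)).
  by apply: open_mfd_dom => //; [exact: Ac|exact: Bc|exact: openT].
split; [exact: openI|by []|].
have [_ _ _ _ [bK _ _ _]] := Bc bB.
apply: (smooth_on_congr (f := (chart_map d \o g \o chart_inv b) \o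
    (chart_map b \o f \o chart_inv c))); first exact: openI.
  by move=> y /set_mem[_ [_ [_ /= yb]]]; rewrite /= bK// inE.
apply: (@smooth_on_comp _ _ _ _ _ (chart_cod b `&`
  chart_inv b @^-1` ([set: N] `&` g @^-1` chart_dom d))).
- exact: openI.
- by apply: open_mfd_dom => //; [exact: Bc|exact: Cc|exact: openT].
- move=> y [[_ [_ /= yd]] [_ [_ /= yb]]].
  have [_ _ bb _ _] := Bc bB; split; first exact: bb.
  by split=> //=; rewrite bK// inE.
- by apply: smooth_on_subset (fs c b cA bB) => y [].
- exact: gs.
Qed.

End MfdComp.

Lemma model_atlasP (R : realType) (E : tvsType R) (c : chart E E) :
  @model_atlas R E c -> is_chart c.
Proof. by move=> ->; exact: id_chartP. Qed.

Section GroupTranslations.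
Context (R : realType) (E : tvsType R) (G : lieGroupType E).

Let prodP c : prod_atlas (@atlas R E G) (@atlas R E G) c -> is_chart c.
Proof. by move=> [a [b [Aa Ab ->]]]; apply: prod_chartP; exact: atlas_chart. Qed.

Let prod_cover (p : G * G) : exists2 c, prod_atlas (@atlas R E G) (@atlas R E G) c & chart_dom c p.
Proof.
have [a Aa ap] := atlas_cover p.1; have [b Ab bp] := atlas_cover p.2.
by exists (prod_chart a b) => //; exists a, b.
Qed.

Let transition (c d : chart E G) : atlas c -> atlas d ->
  smooth_on (chart_cod c `&` chart_inv c @^-1` chart_dom d) (chart_map d \o chart_inv c).
Proof.
move=> Ac Ad; have [_ _ [_ /(_ c d Ac Ad)]] := @atlasP R E G.
by apply: smooth_on_subset => x [].
Qed.

Lemma mulgr_smooth (g : G) : mfd_smooth_on atlas atlas [set: G] (fun h : G => h * g)%g.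
Proof.
suff h : mfd_smooth_on atlas (prod_atlas atlas atlas) [set: G] (fun h : G => (h, g)).
  exact: (mfd_smooth_comp (@atlas_chart R E G) prodP (@atlas_chart R E G)
    prod_cover (@hausdorff_model R E G) h mulg_smooth).
split=> [h _|c _ Ac [a [b [Aa Ab ->]]]].
  exact: (cvg_pair (@cvg_id _ _) (@cvg_cst _ g _ _ _)).
apply: (@smooth_on_pair _ _ _ _ _ (chart_map a \o chart_inv c) (fun=> chart_map b g));
  last exact: smooth_on_cst.
by apply: smooth_on_subset (transition Ac Aa) => x [xc [_ []]].
Qed.

Lemma mulgl_smooth (g : G) : mfd_smooth_on atlas atlas [set: G] (fun h : G => g * h)%g.
Proof.
suff h : mfd_smooth_on atlas (prod_atlas atlas atlas) [set: G] (fun h : G => (g, h)).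
  exact: (mfd_smooth_comp (@atlas_chart R E G) prodP (@atlas_chart R E G)
    prod_cover (@hausdorff_model R E G) h mulg_smooth).
split=> [h _|c _ Ac [a [b [Aa Ab ->]]]].
  exact: (cvg_pair (@cvg_cst _ g _ _ _) (@cvg_id _ _)).
apply: (@smooth_on_pair _ _ _ _ _ (fun=> chart_map a g) (chart_map b \o chart_inv c));
  first exact: smooth_on_cst.
by apply: smooth_on_subset (transition Ac Ab) => x [xc [_ []]].
Qed.

End GroupTranslations.

(** * Smooth vectors and their orbit maps *)

Section SmoothVectors.
Context (R : realType) (E : tvsType R) (G : lieGroupType E) (V : hilbertType R)
  (pi : G -> {linear V -> V}) (hpi : unitary_representation pi).
Local Notation VR := (realification V).

Lemma smooth_on_clinear (F : tvsType R) (U : set F) (f : F -> VR) (T : {linear V -> V}) :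
  open U -> continuous T -> smooth_on U f -> smooth_on U (fun z => T (f z) : VR).
Proof.
move=> Uo Tc fs; apply: (@smooth_on_comp _ _ _ _ _ [set: VR] f (T : VR -> VR)) => //.
  exact: openT.
apply: smooth_on_linear => // a x y.
by rewrite linearD; congr (_ + _); exact: (linearZZ T).
Qed.

Lemma smooth_vectorP v : smooth_vectors pi v <-> forall c, atlas c ->
  smooth_on (chart_cod c) (fun z => pi (chart_inv c z) v : VR).
Proof.
split=> [[_ vs] c Ac|vs].
  by apply: smooth_on_subset (vs c _ Ac erefl) => x xc; split.
split=> [g _|c _ Ac ->]; first by have [_ _ _] := hpi; apply.
by apply: smooth_on_subset (vs c Ac) => x [].
Qed.

Lemma smooth_vector0 : smooth_vectors pi 0.
Proof.
apply/smooth_vectorP => c Ac; apply: (smooth_on_congr (f := fun=> 0)).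
- by have [] := atlas_chart Ac.
- by move=> z _; rewrite linear0.
- exact: smooth_on_cst.
Qed.

Lemma smooth_vectorD v w : smooth_vectors pi v -> smooth_vectors pi w -> smooth_vectors pi (v + w).
Proof.
move=> /smooth_vectorP vs /smooth_vectorP ws; apply/smooth_vectorP => c Ac.
have co : open (chart_cod c) by have [] := atlas_chart Ac.
apply: (smooth_on_congr (f := fun z => (pi (chart_inv c z) v + pi (chart_inv c z) w : VR))) => //.
  by move=> z _; rewrite linearD.
by move=> k; apply: Ck_on_add => //; [exact: vs|exact: ws].
Qed.

Lemma smooth_vectorZ (a : R[i]) v : smooth_vectors pi v -> smooth_vectors pi (a *: v).
Proof.
move=> /smooth_vectorP vs; apply/smooth_vectorP => c Ac.
have co : open (chart_cod c) by have [] := atlas_chart Ac.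
apply: (smooth_on_congr (f := fun z => (a \*: (idfun : {linear V -> V})) (pi (chart_inv c z) v) : VR)) => //.
  by move=> z _; rewrite linearZ.
apply: smooth_on_clinear; [by []| |exact: vs].
by move=> x; apply: cvgZr; exact: cvg_id.
Qed.

(** The orbit map of [pi g v] is that of [v] after right translation by [g]. *)
Lemma smooth_vector_act g v : smooth_vectors pi v -> smooth_vectors pi (pi g v).
Proof.
move=> vs.
have := mfd_smooth_comp (@atlas_chart R E G) (@atlas_chart R E G) (@model_atlasP R VR)
  (@atlas_cover R E G) (@realification_hausdorff R V) (mulgr_smooth g) vs.
by congr mfd_smooth_on; apply/funext => h /=; rewrite (urepM hpi).
Qed.

(** Near [g] the orbit map is [h |-> pi g (pi (g^-1 h) v)]: a left translation to the unit, the
    orbit map there, then a continuous linear operator. *)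
Lemma smooth_vector_local v (U : set E) : open U -> U `<=` ucod G -> U (umap (1%g : G)) ->
  smooth_on U (fun z => pi (uinv G z) v : VR) -> smooth_vectors pi v.
Proof.
move=> Uo Uc U1 vs; apply/smooth_vectorP => c Ac.
have [cdo co c1 c2 [c3 c4 c5 c6]] := atlas_chart Ac.
apply: smooth_on_local => [||z zc]; [exact: realification_hausdorff|by []|].
pose g := chart_inv c z.
have gc : continuous (fun h : G => g^-1 * h)%g.
  by move=> h; have [+ _] := mulgl_smooth (g^-1)%g; apply; rewrite inE.
pose S := chart_cod c `&` chart_inv c @^-1` ([set: G] `&` (fun h => g^-1 * h)%g @^-1` @udom R E G).
have So : open S.
  by apply: open_mfd_dom => //; [exact: unit_is_chart|exact: openT].
have [_ /(_ c _ Ac (@chart1_atlas R E G))] := mulgl_smooth (g^-1)%g; rewrite -/S.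
set m := (_ \o _ \o _) => ms.
exists (S `&` m @^-1` U); split.
- by apply: open_preimage_in => //; exact: smooth_on_continuous ms.
- split; first by split=> //; split=> //; rewrite /preimage/= mulVg; exact: udom1.
  by rewrite /preimage /m /= mulVg.
apply: (smooth_on_congr (f := fun z => pi g (pi (uinv G (m z)) v) : VR)).
- by apply: open_preimage_in => //; exact: smooth_on_continuous ms.
- move=> y /set_mem[[yc [_ yd]] _]; rewrite /m /= -(urepM hpi); congr (pi _ v).
  by rewrite (umapK yd) mulVKg.
apply: smooth_on_clinear; last first.
- apply: (@smooth_on_comp _ _ _ _ _ U m (fun y => pi (uinv G y) v : VR)) => //.
  + by apply: open_preimage_in => //; exact: smooth_on_continuous ms.
  + by move=> y [].
  + by apply: smooth_on_subset ms => y [].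
- exact: (urep_cont hpi).
- by apply: open_preimage_in => //; exact: smooth_on_continuous ms.
Qed.

(** For smooth [v] this is [dpi(x) v]. As a derivative in the unit chart it is visibly continuous in
    [x], which the limit along [exp (t x)] does not show. *)
Definition dorbit (v : V) (x : E) : V :=
  ddir (fun z => pi (uinv G z) v : VR) (umap (1%g : G), x).

Section Orbit.
Context (v : V) (vs : smooth_vectors pi v).

Let os : smooth_on (ucod G) (fun z => pi (uinv G z) v : VR).
Proof. by move/smooth_vectorP : vs; apply; exact: chart1_atlas. Qed.

Lemma dorbit_cont : continuous (dorbit v).
Proof.
move=> x; have c := smooth_on_continuous
  (smooth_on_ddir (@realification_hausdorff R V) (ucod_open G) os).
have h : (fun y : E => (umap (1%g : G), y)) @ x --> (umap (1%g : G), x).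
  exact: (cvg_pair (@cvg_cst _ (umap (1%g : G)) _ _ _) (@cvg_id _ _)).
have hc : (umap (1%g : G), x) \in ucod G `*` [set: E].
  by rewrite inE; split=> //; exact: ucod1.
exact: (cvg_comp _ _ h (c _ hc)).
Qed.

Lemma orbit_velocity (g : R -> G) x : velocity1 g x ->
  (fun t : R => (t^-1)%:C%C *: (pi (g t) v - v)) @ 0^' --> dorbit v x.
Proof.
move=> gx; have [g1 gv] := gx.
have := smooth_on_cvg_curve (@realification_hausdorff R V) (ucod_open G) os (ucod1 G) gv.
apply: near_eq_lim; near=> t.
rewrite /= umapK; last by near: t; exact: velocity1_udom gx.
by rewrite uinv1 (urep1 hpi).
Unshelve. all: by end_near. Qed.

End Orbit.

End SmoothVectors.

Lemma smooth_vectors_comp (R : realType) (E F : tvsType R) (G : lieGroupType E)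
    (H : lieGroupType F) (f : H -> G) (V : hilbertType R) (pi : G -> {linear V -> V}) :
  lie_morphism f -> smooth_vectors pi `<=` smooth_vectors (pi \o f).
Proof.
move=> [_ fs] v vs.
exact: (mfd_smooth_comp (@atlas_chart R F H) (@atlas_chart R E G)
  (@model_atlasP R (realification V)) (@atlas_cover R E G) (@realification_hausdorff R V) fs vs).
Qed.

(** * Spectral bounds for generators of unitary one-parameter groups *)

Section RealInner.
Context (R : realType) (V : hilbertType R).
Implicit Types (u v w : V) (a : R).
Local Open Scope complex_scope.

(** The norm and the inner product take values in [R[i]]; real-valued versions give access to the
    total order, to suprema and to real arithmetic. *)
Definition rnorm v : R := complex.Re `|v|.

Definition rinner v w : R := complex.Re (inner v w).

Lemma rnormE v : `|v| = (rnorm v)%:C.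
Proof.
rewrite /rnorm; have := normr_ge0 v; case: `|v| => x y /=.
by rewrite lecE /= => /andP[/eqP-> _].
Qed.

Lemma rnorm_ge0 v : 0 <= rnorm v.
Proof. by rewrite -ler0c -rnormE. Qed.

Lemma rnormD v w : rnorm (v + w) <= rnorm v + rnorm w.
Proof. by rewrite -lecR rmorphD /= -!rnormE ler_normD. Qed.

Lemma rnormN v : rnorm (- v) = rnorm v.
Proof. by rewrite /rnorm normrN. Qed.

Lemma rnormB v w : rnorm (v - w) <= rnorm v + rnorm w.
Proof. by rewrite -(rnormN w) rnormD. Qed.

Lemma rnormC v w : rnorm (v - w) = rnorm (w - v).
Proof. by rewrite -rnormN opprB. Qed.

Lemma rnormZ (a : R[i]) v : rnorm (a *: v) = complex.Re `|a| * rnorm v.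
Proof. by apply: complexI; rewrite -rnormE normrZ rmorphM /= -rnormE. Qed.

Lemma rnormZr a v : rnorm (a%:C *: v) = `|a| * rnorm v.
Proof. by rewrite rnormZ normc_def /= expr0n addr0 sqrtr_sqr. Qed.

Lemma rnorm0 : rnorm 0 = 0. Proof. by rewrite /rnorm normr0. Qed.

Lemma rnorm0_eq0 v : rnorm v = 0 -> v = 0.
Proof. by move=> v0; apply/eqP; rewrite -normr_eq0 rnormE v0. Qed.

Lemma innerC v w : inner v w = conjc (inner w v).
Proof. by rewrite hermC expr0 mul1r. Qed.

Lemma rinnerC v w : rinner v w = rinner w v.
Proof. by rewrite /rinner innerC; case: (inner w v). Qed.

Lemma rinnerDl u v w : rinner (u + v) w = rinner u w + rinner v w.
Proof. by rewrite /rinner linearDl raddfD. Qed.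

Lemma rinnerNl v w : rinner (- v) w = - rinner v w.
Proof. by rewrite /rinner linearNl raddfN. Qed.

Lemma rinnerBl u v w : rinner (u - v) w = rinner u w - rinner v w.
Proof. by rewrite rinnerDl rinnerNl. Qed.

Lemma rinnerDr u v w : rinner u (v + w) = rinner u v + rinner u w.
Proof. by rewrite rinnerC rinnerDl !(rinnerC u). Qed.

Lemma rinnerBr u v w : rinner u (v - w) = rinner u v - rinner u w.
Proof. by rewrite rinnerC rinnerBl !(rinnerC u). Qed.

Lemma rinnerZl a v w : rinner (a%:C *: v) w = a * rinner v w.
Proof.
by rewrite /rinner linearZl_LR /=; case: (inner v w) => x y /=; rewrite mul0r subr0.
Qed.

Lemma rinnerZr a v w : rinner v (a%:C *: w) = a * rinner v w.
Proof. by rewrite rinnerC rinnerZl rinnerC. Qed.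

Lemma rinner_norm v : rinner v v = rnorm v ^+ 2.
Proof. by apply: complexI; rewrite /rinner inner_norm rnormE -rmorphXn. Qed.

Lemma rinnerZil v w : rinner ('i *: v) w = - rinner v ('i *: w).
Proof.
rewrite /rinner linearZl_LR linearZr_LR /=; case: (inner v w) => x y /=.
by ring.
Qed.

Lemma rinner_cs v w : rinner v w <= rnorm v * rnorm w.
Proof.
have [w0|w0] := eqVneq (rnorm w) 0.
  by rewrite (rnorm0_eq0 w0) rnorm0 mulr0 rinnerC -[0](scale0r 0) (rinnerZl 0) mul0r.
have w2 : 0 < rnorm w by rewrite lt_neqAle eq_sym w0 rnorm_ge0.
have [v0|v0] := eqVneq (rnorm v) 0.
  by rewrite (rnorm0_eq0 v0) rnorm0 mul0r -[0](scale0r 0) (rinnerZl 0) mul0r.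
have v2 : 0 < rnorm v by rewrite lt_neqAle eq_sym v0 rnorm_ge0.
have : 0 <= rnorm ((rnorm w)%:C *: v - (rnorm v)%:C *: w) ^+ 2 by rewrite exprn_ge0 ?rnorm_ge0.
rewrite -rinner_norm !(rinnerBl, rinnerBr) !rinnerZl !rinnerZr !rinner_norm (rinnerC w v).
move=> h; have : 0 <= 2 * (rnorm v * rnorm w) * (rnorm v * rnorm w - rinner v w).
  apply: le_trans h _; rewrite le_eqVlt; apply/orP; left; apply/eqP; ring.
by rewrite pmulr_rge0 ?subr_ge0// mulr_gt0// mulr_gt0.
Qed.

Lemma cvg_rnormP (T : Type) (F : set_system T) {FF : Filter F} (f : T -> V) v :
  f @ F --> v <-> forall e : R, 0 < e -> \forall t \near F, rnorm (v - f t) < e.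
Proof.
split=> [/cvgrPdist_lt h e e0|h].
  have /h : 0 < e%:C by rewrite ltcR.
  by apply: filterS => t; rewrite rnormE ltcR.
apply/cvgrPdist_lt => -[e1 e2]; rewrite ltcE /= => /andP[/eqP -> e0].
apply: filterS (h e1 e0) => t.
by rewrite rnormE -ltcR.
Qed.

Lemma rinner_cvg (T : Type) (F : set_system T) {FF : Filter F} (f g : T -> V) v w :
  f @ F --> v -> g @ F --> w -> (fun t => rinner (f t) (g t)) @ F --> rinner v w.
Proof.
move=> /cvg_rnormP fv /cvg_rnormP gw; apply/cvgrPdist_lt => e e0.
pose K := rnorm v + rnorm w + 1.
have K0 : 0 < K by rewrite ltr_wpDl// addr_ge0 ?rnorm_ge0.
pose d := Num.min 1 (e / (2 * K)).
have d0 : 0 < d by rewrite lt_min ltr01 divr_gt0// mulr_gt0.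
near=> t.
have ft : rnorm (v - f t) < d by near: t; exact: fv.
have gt : rnorm (w - g t) < d by near: t; exact: gw.
have -> : rinner v w - rinner (f t) (g t) = rinner (v - f t) w + rinner (f t) (w - g t).
  by rewrite rinnerBl rinnerBr; ring.
have cs u u' : `|rinner u u'| <= rnorm u * rnorm u'.
  by rewrite ler_norml rinner_cs andbT lerNl -rinnerNl -(rnormN u) rinner_cs.
have fK : rnorm (f t) <= rnorm v + 1.
  rewrite -[f t](subrK v) addrC (le_trans (rnormD _ _))// lerD2l -rnormC.
  by rewrite (le_trans (ltW ft))// ge_min lexx.
apply: le_lt_trans (ler_normD _ _) _.
apply: (@le_lt_trans _ _ (d * rnorm w + (rnorm v + 1) * d)).
  apply: lerD; apply: le_trans (cs _ _) _.
    by rewrite ler_wpM2r ?rnorm_ge0// ltW.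
  by rewrite ler_pM ?rnorm_ge0// ltW.
have -> : d * rnorm w + (rnorm v + 1) * d = d * K by rewrite /K; ring.
have : d * K <= e / 2.
  rewrite -ler_pdivlMr// /d ge_min; apply/orP; right.
  by rewrite invfM mulrA.
by move=> /le_lt_trans; apply; rewrite ltr_pdivrMr// ltr_pMr// ltr1n.
Unshelve. all: by end_near. Qed.

Lemma rnorm_cvg (T : Type) (F : set_system T) {FF : Filter F} (f : T -> V) v :
  f @ F --> v -> (fun t => rnorm (f t)) @ F --> rnorm v.
Proof.
move=> /cvg_rnormP fv; apply/cvgrPdist_lt => e e0; near=> t.
have : rnorm (v - f t) < e by near: t; exact: fv.
apply: le_lt_trans; rewrite ler_norml; apply/andP; split.
  rewrite lerBrDr addrC -lerBrDr opprK addrC.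
  by rewrite -[X in rnorm X <= _](subrK v) (le_trans (rnormD _ _))// rnormC.
by rewrite lerBlDr -{1}[v](subrK (f t)) rnormD.
Unshelve. all: by end_near. Qed.

Lemma clinear_bounded (T : {linear V -> V}) : continuous T ->
  exists2 K : R, 0 < K & forall v, rnorm (T v) <= K * rnorm v.
Proof.
move=> Tc; have := Tc 0; rewrite /continuous_at linear0 => /(@cvg_rnormP _ (nbhs (0 : V)) _) /(_ 1 ltr01).
move=> /nbhs_ballP[d /= d0].
have [e e0 ->] : exists2 e : R, 0 < e & d = e%:C.
  by move: d0; case: d => d1 d2; rewrite ltcE /= => /andP[/eqP-> d0]; exists d1.
move=> dT; exists (2 / e); first by rewrite divr_gt0.
move=> v; have [->|v0] := eqVneq v 0; first by rewrite linear0 rnorm0 mulr0.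
have nv0 : 0 < rnorm v.
  by rewrite lt_neqAle rnorm_ge0 andbT eq_sym; apply: contraNneq v0 => /rnorm0_eq0 ->.
pose s := e / (2 * rnorm v).
have s0 : 0 < s by rewrite divr_gt0// mulr_gt0.
have := dT (s%:C *: v); rewrite -ball_normE /= sub0r normrN rnormE rnormZr ltcR gtr0_norm//.
have -> : s * rnorm v = e / 2 by rewrite /s; field; rewrite gt_eqF.
rewrite ltr_pdivrMr// ltr_pMr// ltr1n => /(_ isT).
rewrite sub0r rnormN linearZ rnormZr gtr0_norm// => h.
have -> : 2 / e * rnorm v = 1 / s by rewrite /s; field; rewrite !gt_eqF.
by rewrite ler_pdivlMr// mulrC ltW.
Qed.

End RealInner.

(** * From resolvent points to a bound on the numerical range *)

Lemma closure_le (R : realType) (T : topologicalType) (A : set T) (h1 h2 : T -> R) :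
  continuous h1 -> continuous h2 -> (forall p, A p -> h1 p <= h2 p) ->
  forall p, closure A p -> h1 p <= h2 p.
Proof.
move=> c1 c2 A12 p Ap; rewrite -subr_ge0.
have hc : continuous (fun p => h2 p - h1 p) by move=> q; apply: cvgB; [exact: c2|exact: c1].
have cl : closed ((fun p => h2 p - h1 p) @^-1` [set x | 0 <= x]).
  by apply: closed_comp => [x _|]; [exact: hc|exact: closed_ge].
suff : ((fun p => h2 p - h1 p) @^-1` [set x | 0 <= x]) p by [].
rewrite ((closure_id _).1 cl); apply: closure_subset Ap => q Aq /=.
by rewrite subr_ge0 A12.
Qed.

Lemma closure_eqr (R : realType) (T : topologicalType) (A : set T) (h1 h2 : T -> R) :
  continuous h1 -> continuous h2 -> (forall p, A p -> h1 p = h2 p) ->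
  forall p, closure A p -> h1 p = h2 p.
Proof.
move=> c1 c2 A12 p Ap; apply/eqP; rewrite eq_le; apply/andP; split.
  by apply: (closure_le c1 c2 _ Ap) => q /A12 ->.
by apply: (closure_le c2 c1 _ Ap) => q /A12 ->.
Qed.

(** This is [S^2 <= L S] for a positive symmetric [S] of norm at most [L], obtained without a square
    root: positivity is tested on [u - L^-1 S u], and the quadratic term is at most
    [L^-1 |S u|^2]. *)
Lemma positive_operator_bound (R : realType) (V : hilbertType R) (S : V -> V) (L : R) (u : V) :
  0 < L -> (forall v, 0 <= rinner (S v) v) ->
  (forall v w, rinner (S v) w = rinner v (S w)) ->
  (forall v, rnorm (S v) <= L * rnorm v) ->
  (forall (a : R) v w, S (v - a%:C%C *: w) = S v - a%:C%C *: S w) ->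
  rnorm (S u) ^+ 2 <= L * rinner (S u) u.
Proof.
move=> L0 Spos Ssym SL Slin.
have := Spos (u - (L^-1)%:C%C *: S u).
rewrite Slin !(rinnerBl, rinnerBr) !(rinnerZl, rinnerZr).
rewrite (Ssym (S u) u) rinner_norm => h.
have h2 : rinner (S (S u)) (S u) <= L * rnorm (S u) ^+ 2.
  apply: le_trans (rinner_cs _ _) _.
  by rewrite expr2 mulrA ler_wpM2r ?rnorm_ge0.
have h3 : L^-1 * (L^-1 * rinner (S (S u)) (S u)) <= L^-1 * rnorm (S u) ^+ 2.
  by rewrite ler_pM2l ?invr_gt0// mulrC ler_pdivrMr// mulrC.
have : L^-1 * rnorm (S u) ^+ 2 <= rinner (S u) u by move: h h3; lra.
by rewrite mulrC ler_pdivrMr// mulrC.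
Qed.

Section SymmetricRelations.
Context (R : realType) (V : hilbertType R) (A : set (V * V)).
Local Open Scope complex_scope.

Let rinner_continuous_in (T : topologicalType) (f g : T -> V) :
  continuous f -> continuous g -> continuous (fun t => rinner (f t) (g t)).
Proof. by move=> fc gc t; apply: rinner_cvg; [exact: fc|exact: gc]. Qed.

Let fst_cont : continuous (fun p : V * V => p.1). Proof. by move=> p; exact: cvg_fst. Qed.

Let snd_cont : continuous (fun p : V * V => p.2). Proof. by move=> p; exact: cvg_snd. Qed.

Hypothesis Asym : forall p q, A p -> A q -> rinner p.2 q.1 = rinner p.1 q.2.

Lemma closure_rel_symmetric p q : closure A p -> closure A q -> rinner p.2 q.1 = rinner p.1 q.2.
Proof.
have c1 (v : V) : continuous (fun p : V * V => rinner p.2 v).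
  by apply: rinner_continuous_in => // x; exact: cvg_cst.
have c2 (v : V) : continuous (fun p : V * V => rinner p.1 v).
  by apply: rinner_continuous_in => // x; exact: cvg_cst.
have c3 (v : V) : continuous (fun p : V * V => rinner v p.2).
  by apply: rinner_continuous_in => // x; exact: cvg_cst.
have c4 (v : V) : continuous (fun p : V * V => rinner v p.1).
  by apply: rinner_continuous_in => // x; exact: cvg_cst.
have h p' : A p' -> forall q, closure A q -> rinner p'.2 q.1 = rinner p'.1 q.2.
  by move=> Ap'; apply: closure_eqr => // q' Aq'; exact: Asym.
move=> Ap Aq; move: p Ap.
by apply: closure_eqr => // p Ap; exact: h.
Qed.

(* With [T = (A - r)^-1], the point [1/m] outside the spectrum of [A - r] makes
   [m - T] bounded below on the range of [T]: the numerical range of [T] cannot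
   accumulate at [m > 0]. *)
Lemma resolvent_numerical_range (C : R) :
  (forall r : R, C < r -> resolvent_set (closure A) r%:C) ->
  forall p, A p -> rinner p.2 p.1 <= C * rnorm p.1 ^+ 2.
Proof.
move=> res p Ap.
suff h r : C < r -> rinner p.2 p.1 <= r * rnorm p.1 ^+ 2.
  have [p0|p0] := eqVneq (rnorm p.1) 0.
    by have := h (C + 1); rewrite p0 expr0n !mulr0; apply; rewrite ltrDl.
  have n0 : 0 < rnorm p.1 ^+ 2 by rewrite exprn_gt0// lt_neqAle eq_sym p0 rnorm_ge0.
  rewrite -ler_pdivrMr//; apply/ler_addgt0Pr => e e0.
  by rewrite ler_pdivrMr// h// ltrDl.
move=> Cr; have [T [Tc TA AT]] := res r Cr.
have Tsym w w' : rinner (T w) w' = rinner w (T w').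
  have := closure_rel_symmetric (TA w) (TA w'); rewrite /= rinnerDl rinnerDr.
  rewrite rinnerZl rinnerZr => h.
  by apply: (@addIr _ (r * rinner (T w) (T w'))); rewrite -h.
(* At [w = (A - r) p] one has [T w = p], and the inequality becomes [<p, (A - r) p> <= 0]. *)
suff Tneg w : rinner (T w) w <= 0.
  have := Tneg (p.2 - r%:C *: p.1).
  rewrite AT; last by rewrite -surjective_pairing; exact: subset_closure.
  by rewrite rinnerBr rinnerZr rinner_norm rinnerC subr_le0.
have [K K0 TK] := clinear_bounded Tc.
pose P (m : R) := forall w, rinner (T w) w <= m * rnorm w ^+ 2.
have PK : P K.
  move=> u; apply: le_trans (rinner_cs _ _) _.
  by rewrite expr2 mulrA ler_wpM2r ?rnorm_ge0.
(* Every positive upper bound of the numerical range of [T] can be lowered, because [r + 1/m] is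
   again a resolvent point. *)
have better m : 0 < m -> P m -> exists2 m', m' < m & P m' /\ 0 < m'.
  move=> m0 Pm; pose S u := m%:C *: u - T u.
  have Spos u : 0 <= rinner (S u) u.
    by rewrite /S rinnerBl rinnerZl rinner_norm subr_ge0.
  have Ssym u u' : rinner (S u) u' = rinner u (S u').
    by rewrite /S rinnerBl rinnerBr rinnerZl rinnerZr Tsym.
  pose L := m + K; have L0 : 0 < L by rewrite addr_gt0.
  have SL u : rnorm (S u) <= L * rnorm u.
    by rewrite (le_trans (rnormB _ _))// rnormZr gtr0_norm// mulrDl lerD2l.
  have Scs u : rnorm (S u) ^+ 2 <= L * rinner (S u) u.
    apply: positive_operator_bound => // a u1 u2.
    rewrite /S (linearB T) (linearZZ T) !scalerBr !scalerA [a%:C * _]mulrC.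
    by rewrite !opprB addrACA [RHS]addrACA [- (_ *: u2) - _]addrC.
  have Cm : C < r + m^-1 by rewrite (lt_trans Cr)// ltrDl invr_gt0.
  have [T' [T'c _ AT']] := res _ Cm.
  have [K' K'0 T'K'] := clinear_bounded T'c.
  pose B := K' / m; have B0 : 0 < B by rewrite divr_gt0.
  (* The pair [(T u, u + r T u)] lies in the closure of [A], so the inverse [T'] at [r + 1/m] sends
     [u - T u / m = S u / m] back to [T u]. *)
  have TS u : rnorm (T u) <= B * rnorm (S u).
    have := AT' _ _ (TA u).
    have -> : u + r%:C *: T u - (r + m^-1)%:C *: T u = (m^-1)%:C *: S u.
      rewrite /S rmorphD /= scalerDl opprD addrA addrK scalerBr scalerA -rmorphM /=.
      by rewrite mulVf ?gt_eqF// scale1r.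
    move=> <-; rewrite linearZ rnormZr gtr0_norm ?invr_gt0//.
    rewrite /B mulrAC [K' * _ / _]mulrC ler_pM2l ?invr_gt0//.
  pose c := B ^+ 2 * L; have c0 : 0 < c by rewrite mulr_gt0// exprn_gt0.
  have main u : rnorm (T u) ^+ 2 <= c * rinner (S u) u.
    apply: (@le_trans _ _ ((B * rnorm (S u)) ^+ 2)).
      by rewrite ler_pXn2r ?nnegrE ?rnorm_ge0// mulr_ge0 ?rnorm_ge0// ltW.
    by rewrite exprMn /c -mulrA ler_pM2l ?exprn_gt0.
  (* Suppose [t = <T u, u>] exceeds [m' n] with [n = |u|^2]. By Cauchy-Schwarz and [main],
     [t^2 <= |T u|^2 n <= c (m n - t) n]. The half [m / 2] bounds [t^2] below by [m^2 n^2 / 4], so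
     [t < m n - m^2 n / (4 c)], against the other half of the maximum. *)
  pose m' := Num.max (m / 2) (m - m ^+ 2 / (4 * c)).
  have m'm : m' < m.
    rewrite gt_max; apply/andP; split; first by rewrite ltr_pdivrMr// ltr_pMr// ltr1n.
    by rewrite ltrBlDr ltrDl divr_gt0// ?exprn_gt0// mulr_gt0.
  have m'0 : 0 < m' by rewrite lt_max divr_gt0.
  exists m' => //; split=> // u; rewrite leNgt; apply/negP => hu.
  set n := rnorm u ^+ 2 in hu *; set t := rinner (T u) u in hu *.
  have n0 : 0 <= n by rewrite exprn_ge0// rnorm_ge0.
  have mt : m / 2 * n < t by apply: le_lt_trans hu; rewrite ler_wpM2r// le_max lexx.
  have mt' : (m - m ^+ 2 / (4 * c)) * n < t.
    by apply: le_lt_trans hu; rewrite ler_wpM2r// le_max lexx orbT.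
  have t2 : t ^+ 2 <= c * (m * n - t) * n.
    apply: (@le_trans _ _ ((rnorm (T u) * rnorm u) ^+ 2)).
      rewrite ler_pXn2r ?nnegrE ?rinner_cs// ?mulr_ge0 ?rnorm_ge0//.
      by apply: le_trans (ltW mt); rewrite mulr_ge0// divr_ge0// ltW.
    rewrite exprMn ler_wpM2r//; apply: le_trans (main u) _.
    by rewrite ler_pM2l// /S rinnerBl rinnerZl rinner_norm.
  have t3 : (m / 2 * n) ^+ 2 < t ^+ 2.
    have h0 : 0 <= m / 2 * n by rewrite mulr_ge0// divr_ge0// ltW.
    by rewrite ltr_pXn2r// ?nnegrE//; apply: le_trans (ltW mt).
  have n1 : 0 < n.
    rewrite lt_neqAle n0 andbT; apply/negP => /eqP n00.
    by move: t2 t3; rewrite -n00 !mulr0 expr0n /= => /le_lt_trans h /h; rewrite ltxx.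
  have : m ^+ 2 / (4 * c) * n < m * n - t.
    have : (m / 2) ^+ 2 * n * n < c * (m * n - t) * n.
      by apply: le_lt_trans (lt_le_trans t3 t2); rewrite exprMn expr2; lra.
    rewrite ltr_pM2r// => h.
    have -> : m ^+ 2 / (4 * c) * n = ((m / 2) ^+ 2 * n) / c by field; rewrite gt_eqF.
    by rewrite ltr_pdivrMr// [_ * c]mulrC.
  by move: mt'; rewrite mulrBl ltrBlDr -ltrBlDl => /lt_trans h /h; rewrite ltxx.
(* The infimum of the positive bounds is itself a bound. If it were positive, [better] would produce
   a smaller element of [I]; so it is 0. *)
pose I := [set m : R | 0 < m /\ P m].
have I_inf : has_inf I by split; [exists K|exists 0 => m [/ltW]].
pose m := inf I.
have m_le x : I x -> m <= x by move=> Ix; apply: ge_inf => //; case: I_inf.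
have m_ge0 : 0 <= m by apply: lb_le_inf; [case: I_inf|move=> x [/ltW]].
have Pm : P m.
  move=> u; have [u0|u0] := eqVneq (rnorm u) 0.
    by rewrite (rnorm0_eq0 u0) linear0 (rinner_norm 0) rnorm0 expr0n mulr0.
  have n0 : 0 < rnorm u ^+ 2 by rewrite exprn_gt0// lt_neqAle eq_sym u0 rnorm_ge0.
  rewrite -ler_pdivrMr//; apply: lb_le_inf; first by case: I_inf.
  by move=> x [_ Px]; rewrite ler_pdivrMr.
move: m_ge0; rewrite le_eqVlt => /predU1P[m0|m0].
  by have := Pm w; rewrite -m0 mul0r.
have [m' m'm [Pm' m'0]] := better m m0 Pm.
by have := m_le m' (conj m'0 Pm'); rewrite leNgt m'm.
Qed.

End SymmetricRelations.

(** * From a lower bound and a dense range to a resolvent *)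

Lemma rnorm_cauchy_cvg (R : realType) (V : hilbertType R) (T : Type) (F : set_system T)
    {FF : ProperFilter F} (f : T -> V) :
  (forall e : R, 0 < e -> exists c, \forall t \near F, rnorm (f t - c) < e) ->
  exists l : V, f @ F --> l.
Proof.
move=> fc; suff h : cvg (f @ F) by exists (lim (f @ F)).
apply: cauchy_cvg; apply: cauchy_exP => -[e1 e2]; rewrite ltcE /= => /andP[/eqP -> e0].
have [c fce] := fc e1 e0; exists c.
apply: filterS fce => t; rewrite rnormC -ball_normE /= rnormE => h.
by rewrite ltcR.
Qed.

Section Resolvent.
Context (R : realType) (V : hilbertType R) (A : set (V * V)).
Local Open Scope complex_scope.

Lemma closure_relP p : closure A p <-> forall e : R, 0 < e ->
  exists2 q, A q & rnorm (p.1 - q.1) < e /\ rnorm (p.2 - q.2) < e.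
Proof.
split=> [Ap e e0|Ap B [[B1 B2] [/= n1 n2] B12]].
  have nb (v : V) : nbhs v [set w | rnorm (v - w) < e].
    by have /(@cvg_rnormP _ _ _ (nbhs v) _) := @cvg_id _ (nbhs v); apply.
  have /Ap[q [Aq [q1 q2]]] : nbhs p ([set w | rnorm (p.1 - w) < e] `*` [set w | rnorm (p.2 - w) < e]).
    by exists ([set w | rnorm (p.1 - w) < e], [set w | rnorm (p.2 - w) < e]).
  by exists q.
have nb (v : V) C : nbhs v C -> exists2 e : R, 0 < e & forall w, rnorm (v - w) < e -> C w.
  move=> /nbhs_ballP[[e1 e2] /=]; rewrite ltcE /= => /andP[/eqP -> e0] vC.
  exists e1 => // w vw; apply: vC; rewrite -ball_normE /= rnormE.
  by rewrite ltcR.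
have [e e0 eB1] := nb _ _ n1; have [d d0 dB2] := nb _ _ n2.
have [|q Aq [q1 q2]] := Ap (Num.min e d); first by rewrite lt_min e0.
exists q; split=> //; apply: B12; split=> /=.
  by apply: eB1; apply: lt_le_trans q1 _; rewrite ge_min lexx.
by apply: dB2; apply: lt_le_trans q2 _; rewrite ge_min lexx orbT.
Qed.

Context (r c : R).
Hypotheses (c0 : 0 < c)
  (Alin : forall (a : R[i]) p q, A p -> A q -> A (a *: p.1 + q.1, a *: p.2 + q.2))
  (Abelow : forall p, A p -> c * rnorm p.1 <= rnorm (p.2 - r%:C *: p.1))
  (Adense : forall u (e : R), 0 < e -> exists2 p, A p & rnorm (p.2 - r%:C *: p.1 - u) < e).

Let clos_lin (a : R[i]) p q : closure A p -> closure A q ->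
  closure A (a *: p.1 + q.1, a *: p.2 + q.2).
Proof.
move=> /closure_relP Ap /closure_relP Aq; apply/closure_relP => e e0.
pose K := complex.Re `|a| + 1.
have a0 : 0 <= complex.Re `|a| by rewrite normc_def /= sqrtr_ge0.
have K0 : 0 < K by rewrite ltr_wpDl.
have d0 : 0 < e / K by rewrite divr_gt0.
have [p' Ap' [p1 p2]] := Ap _ d0; have [q' Aq' [q1 q2]] := Aq _ d0.
exists (a *: p'.1 + q'.1, a *: p'.2 + q'.2); first exact: Alin.
have est (x x' y y' : V) : rnorm (x - x') < e / K -> rnorm (y - y') < e / K ->
    rnorm (a *: x + y - (a *: x' + y')) < e.
  move=> xx yy; rewrite opprD addrACA -scalerBr.
  apply: le_lt_trans (rnormD _ _) _; rewrite rnormZ.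
  have -> : e = complex.Re `|a| * (e / K) + e / K.
    by rewrite -{2}[e / K]mul1r -mulrDl -/K mulrC divfK// gt_eqF.
  by apply: ler_ltD => //; rewrite ler_wpM2l// ltW.
by split=> /=; exact: est.
Qed.

Let clos_below p : closure A p -> c * rnorm p.1 <= rnorm (p.2 - r%:C *: p.1).
Proof.
have lim1 : continuous (fun p : V * V => p.1) by move=> q; exact: cvg_fst.
have lim2 : continuous (fun p : V * V => p.2) by move=> q; exact: cvg_snd.
apply: (@closure_le R _ A (fun p => c * rnorm p.1)
  (fun p => rnorm (p.2 - r%:C *: p.1))) => // q.
- apply: cvgMr; apply: rnorm_cvg; exact: lim1.
- apply: rnorm_cvg; apply: cvgB; first exact: lim2.
  by apply: cvgZr; exact: lim1.
Qed.

(** Approximate solutions [p n] have images under [A - r] converging to [u]. The lower bound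
    [Abelow], applied to differences, makes their first components Cauchy, and completeness gives a
    solution in the closure. *)
Let solve u : exists v, closure A (v, u + r%:C *: v).
Proof.
have /choice[p pP] (n : nat) : exists p, A p /\ rnorm (p.2 - r%:C *: p.1 - u) < n.+1%:R^-1.
  by have [|q] := @Adense u (n.+1%:R^-1); [rewrite invr_gt0|exists q].
have small (e : R) : 0 < e -> \forall n \near \oo, rnorm ((p n).2 - r%:C *: (p n).1 - u) < e.
  move=> e0; near=> n; apply: lt_trans (pP n).2 _.
  by near: n; exact: (near_infty_natSinv_lt (PosNum e0)).
have [v pv] : exists l : V, (fun n => (p n).1) @ \oo --> l.
  apply: rnorm_cauchy_cvg => e e0.
  have d0 : 0 < c * e / 2 by rewrite divr_gt0// mulr_gt0.
  have [N _ Nsmall] := small _ d0.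
  exists (p N).1; exists N => // n /= Nn.
  rewrite -(ltr_pM2l c0).
  have Apq : A ((-1) *: (p N).1 + (p n).1, (-1) *: (p N).2 + (p n).2).
    by apply: Alin; exact: (pP _).1.
  have := Abelow Apq; rewrite /= !scaleN1r ![- _ + _]addrC.
  move=> /le_lt_trans; apply.
  have -> : (p n).2 - (p N).2 - r%:C *: ((p n).1 - (p N).1) =
      ((p n).2 - r%:C *: (p n).1 - u) - ((p N).2 - r%:C *: (p N).1 - u).
    rewrite scalerBr !opprB [RHS]addrA subrK addrACA [RHS]addrACA.
    by congr (_ + _); exact: addrC.
  apply: le_lt_trans (rnormB _ _) _.
  rewrite [c * e]splitr; apply: ltrD; apply: Nsmall => //=.
exists v; apply/closure_relP => e e0.
have p2 : (fun n => (p n).2) @ \oo --> u + r%:C *: v.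
  have h : (fun n => (p n).2 - r%:C *: (p n).1 - u) @ \oo --> (0 : V).
    apply/cvg_rnormP => d d0; apply: filterS (small d d0) => n.
    by rewrite sub0r rnormN.
  have : (fun n => ((p n).2 - r%:C *: (p n).1 - u) + (u + r%:C *: (p n).1)) @ \oo --> 0 + (u + r%:C *: v).
    apply: cvgD => //; apply: cvgD; first exact: cvg_cst.
    by apply: cvgZr.
  rewrite add0r; apply: near_eq_lim; near=> n.
  by rewrite addrA subrK subrK.
near \oo => n.
exists (p n); first exact: (pP n).1.
split=> /=.
  by near: n; move/cvg_rnormP: pv; exact.
by near: n; move/cvg_rnormP: p2; exact.
Unshelve. all: by end_near. Qed.

(** The closure of [A - r] is onto by [solve] and injective by the lower bound. Uniqueness makes the
    chosen inverse linear, and the lower bound makes it continuous. *)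
Lemma dense_range_resolvent : resolvent_set (closure A) r%:C.
Proof.
have [T0 T0A] := choice solve.
have uniq v w : closure A (v, w) -> T0 (w - r%:C *: v) = v.
  move=> Avw; have := @clos_lin (-1) _ _ Avw (T0A (w - r%:C *: v)).
  move=> /clos_below /=; rewrite !scaleN1r.
  have -> : - w + (w - r%:C *: v + r%:C *: T0 (w - r%:C *: v)) -
      r%:C *: (- v + T0 (w - r%:C *: v)) = 0.
    by rewrite addrA addKr scalerDr scalerN subrr.
  rewrite rnorm0 pmulr_rle0// => h.
  apply/eqP; rewrite -subr_eq0 addrC; apply/eqP/rnorm0_eq0/eqP.
  by rewrite eq_le h rnorm_ge0.
have lin : linear T0.
  move=> a u v; have := uniq _ _ (@clos_lin a _ _ (T0A u) (T0A v)).
  rewrite /= scalerDr scalerDr !scalerA addrACA [a * _]mulrC addrK.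
  by [].
pose T : {linear V -> V} := HB.pack T0 (GRing.isLinear.Build _ _ _ _ T0 lin).
exists T; split=> //.
move=> u; apply/cvg_rnormP => e e0.
have /(@cvg_rnormP _ _ _ (nbhs u) _) h := @cvg_id _ (nbhs u).
near=> u'; rewrite -linearB /=.
rewrite -(ltr_pM2l c0); apply: le_lt_trans (clos_below (T0A _)) _ => /=.
rewrite addrK.
by near: u'; apply: h; rewrite mulr_gt0.
Unshelve. all: by end_near. Qed.

End Resolvent.

(** * Dense range of the shifted generator of a one-parameter group *)

Section OneParameterGroup.
Context (R : realType) (V : hilbertType R) (S : R -> {linear V -> V}) (D : set (V * V)).
Local Open Scope complex_scope.
Hypotheses (Siso : forall t v, rnorm (S t v) = rnorm v)
  (Dlin : forall (a : R[i]) p q, D p -> D q -> D (a *: p.1 + q.1, a *: p.2 + q.2))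
  (Dinv : forall t p, D p -> D (S t p.1, S t p.2))
  (Dder : forall p, D p -> (fun t : R => t^-1%:C *: (S t p.1 - p.1)) @ 0^' --> p.2)
  (Ddense : forall u (e : R), 0 < e -> exists2 p, D p & rnorm (p.1 - u) < e).

(** The real part of [1 - lam h] is [1 + d h > 1]. The shift by [- d] is what turns the isometry
    [S h] into a strict contraction [q S h]. *)
Let resolvent_factor (d r h : R) : 0 < d -> 0 < h ->
  1 - (- d +i* r) * h%:C != 0 /\
  complex.Re `|(1 - (- d +i* r) * h%:C)^-1| <= (1 + d * h)^-1.
Proof.
move=> d0 h0.
have dh : 0 < 1 + d * h by rewrite addr_gt0// mulr_gt0.
have N1 : (1 + d * h)%:C <= `|1 - (- d +i* r) * h%:C|.
  apply: le_trans (normc_ge_Re _); rewrite lecR /=.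
  by rewrite mulr0 subr0 mulNr opprK ler_norm.
have N0 : 0 < `|1 - (- d +i* r) * h%:C| by apply: lt_le_trans N1; rewrite ltcR.
split; first by rewrite -normr_gt0.
rewrite normfV; have : `|1 - (- d +i* r) * h%:C|^-1 <= ((1 + d * h)^-1)%:C.
  by rewrite fmorphV /= lef_pV2// posrE ltcR.
by rewrite lecE => /andP[].
Qed.

(** One Horner step for the geometric sum: [p' = q (S h p - h v)], with remainder [y' = q S h y].
    The error picks up the discretisation error [h eta], and the bound [eta / d] reproduces itself
    because [(eta / d + h eta) / (1 + d h) = eta / d]. *)
Let telescope (q lam : R[i]) (h k eta d : R) p v :
  q * (1 - lam * h%:C) = 1 -> 0 < h -> 0 < d -> k = (1 + d * h)^-1 ->
  complex.Re `|q| <= k -> D p -> D v ->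
  rnorm (S h v.1 - v.1 - h%:C *: v.2) <= h * eta ->
  forall y er, p.2 + lam *: p.1 = v.1 - y + er -> rnorm er <= eta / d ->
  exists p' er', [/\ D p', p'.2 + lam *: p'.1 = v.1 - q *: S h y + er' & rnorm er' <= eta / d].
Proof.
move=> qE h0 d0 kE qk Dp Dv vh y er E ere.
exists (q *: (S h p.1 - h%:C *: v.1), q *: (S h p.2 - h%:C *: v.2)).
exists (q *: (S h er + (S h v.1 - v.1 - h%:C *: v.2))).
split=> /=.
- have D1 : D (- h%:C *: v.1 + S h p.1, - h%:C *: v.2 + S h p.2).
    exact: (Dlin _ Dv (Dinv h Dp)).
  have D0 : D (0, 0) by have := Dlin (-1) Dv Dv; rewrite !scaleN1r !addNr.
  have := Dlin q D1 D0; rewrite /= !addr0 !scaleNr.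
  by rewrite ![- _ + _]addrC.
- rewrite scalerA [lam * q]mulrC -scalerA -scalerDr.
  have vE : v.1 = q *: (v.1 - (lam * h%:C) *: v.1).
    by rewrite -{2}[v.1]scale1r -scalerBl scalerA qE scale1r.
  rewrite {2}vE -[- (q *: _)]scalerN -!scalerDr; congr (_ *: _).
  have SE : S h p.2 + lam *: S h p.1 = S h v.1 - S h y + S h er.
    by rewrite -linearZ -linearD E !linearD linearN.
  rewrite scalerBr addrACA SE scalerA -opprD.
  by rewrite [RHS](AC (3*(1*3)) ((5*3*4)*(7*2)*(1*6)))/= subrr addr0 opprD.
- rewrite rnormZ.
  have eta0 : 0 <= eta by rewrite -(pmulr_rge0 _ h0); apply: le_trans vh; exact: rnorm_ge0.
  have k0 : 0 <= k by rewrite kE invr_ge0 addr_ge0// mulr_ge0// ltW.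
  apply: (@le_trans _ _ (k * (eta / d + h * eta))).
    apply: ler_pM => //; [by rewrite normc_def /= sqrtr_ge0|exact: rnorm_ge0|].
    by apply: le_trans (rnormD _ _) _; rewrite Siso lerD.
  rewrite le_eqVlt; apply/orP; left; apply/eqP; rewrite kE; field.
  by rewrite !gt_eqF// addr_gt0// mulr_gt0.
Qed.

(* [(D + lam)^-1 u] is approximated by [- sum_(j < N) h q X^j u] with
   [q = (1 - lam h)^-1] and the contraction [X = q S_h]: up to [o(h)],
   [h q (D + lam) u] is [(X - 1) u], so that the sum telescopes. *)
Lemma generator_range_dense (d r : R) (u : V) (e : R) : 0 < d -> 0 < e ->
  exists2 p, D p & rnorm (p.2 + (- d +i* r) *: p.1 - u) < e.
Proof.
move=> d0 e0; set lam := - d +i* r.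
have e2 : 0 < e / 2 by rewrite divr_gt0.
have [v Dv vu] := Ddense u e2.
suff [p Dp pv] : exists2 p, D p & rnorm (p.2 + lam *: p.1 - v.1) < e / 2.
  exists p => //.
  have -> : p.2 + lam *: p.1 - u = (p.2 + lam *: p.1 - v.1) + (v.1 - u).
    by rewrite addrA subrK.
  by rewrite (le_lt_trans (rnormD _ _))// [e]splitr ltrD.
(* The accumulated error [eta / d] is then [e / 4]. Another [e / 4] is left for the remainder [y],
   and [e / 2] for replacing [u] by [v]. The step [h] is fixed before the number of terms grows. *)
pose eta := e / 4 * d.
have eta0 : 0 < eta by rewrite mulr_gt0// divr_gt0.
have /cvg_rnormP/(_ _ eta0)/near_dnbhs0[h1 h10 h1P] := Dder Dv.
pose h := h1 / 2.
have h0 : 0 < h by rewrite divr_gt0.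
have hv : rnorm (S h v.1 - v.1 - h%:C *: v.2) <= h * eta.
  have := h1P h; rewrite gt_eqF// gtr0_norm// ltr_pdivrMr// ltr_pMr// ltr1n => /(_ isT isT).
  rewrite rnormC => /ltW; rewrite -(ler_pM2l h0) -{1}(gtr0_norm h0) -rnormZr scalerBr.
  by rewrite scalerA -rmorphM /= divff ?gt_eqF// scale1r.
have [N0 qk] := resolvent_factor r d0 h0; rewrite -/lam in N0 qk.
set q := (1 - lam * h%:C)^-1 in qk; set k := (1 + d * h)^-1 in qk.
have k0 : 0 <= k by rewrite invr_ge0 addr_ge0// mulr_ge0// ltW.
have k1 : k < 1 by rewrite invf_lt1 ?ltrDl ?mulr_gt0// addr_gt0// mulr_gt0.
have step N : exists p y er, [/\ D p, p.2 + lam *: p.1 = v.1 - y + er,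
    rnorm y <= k ^+ N * rnorm v.1 & rnorm er <= eta / d].
  elim: N => [|N [p [y [er [Dp E yk ere]]]]].
    have D0 : D (0, 0) by have := Dlin (-1) Dv Dv; rewrite !scaleN1r !addNr.
    exists (0, 0), v.1, 0; split=> //=; first by rewrite scaler0 subrr !addr0.
      by rewrite expr0 mul1r.
    by rewrite rnorm0 divr_ge0// ltW.
  have [p' [er' [Dp' E' ere']]] := telescope (mulVf N0) h0 d0 erefl qk Dp Dv hv E ere.
  exists p', (q *: S h y), er'; split=> //.
  rewrite rnormZ Siso exprS -mulrA ler_pM ?rnorm_ge0//.
  by rewrite normc_def /= sqrtr_ge0.
have : (fun N => k ^+ N * rnorm v.1) @ \oo --> 0 * rnorm v.1.
  by apply: cvgMl; apply: cvg_expr; rewrite ger0_norm.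
rewrite mul0r => /cvgrPdist_lt/(_ (e / 4)) []; first by rewrite divr_gt0.
move=> N _ /(_ N (leqnn N)) /=; rewrite sub0r normrN => kN.
have [p [y [er [Dp E yk ere]]]] := step N.
exists p => //; rewrite E addrC !addrA addNr add0r.
apply: le_lt_trans (rnormD _ _) _; rewrite rnormN.
have ere4 : rnorm er <= e / 4 by move: ere; rewrite /eta mulfK// gt_eqF.
have y4 : rnorm y < e / 4 by apply: le_lt_trans yk (le_lt_trans (ler_norm _) kN).
by have -> : e / 2 = e / 4 + e / 4; [lra|exact: ltr_leD].
Qed.

End OneParameterGroup.

(** * Supremum of the spectrum and numerical range *)

Section SupportFunctional.
Context (R : realType) (V : hilbertType R) (S : R -> {linear V -> V}) (D : set (V * V)).
Local Open Scope complex_scope.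
Hypotheses (Sinner : forall t v w, inner (S t v) (S t w) = inner v w)
  (Dlin : forall (a : R[i]) p q, D p -> D q -> D (a *: p.1 + q.1, a *: p.2 + q.2))
  (D0 : D (0, 0))
  (Dinv : forall t p, D p -> D (S t p.1, S t p.2))
  (Dder : forall p, D p -> (fun t : R => t^-1%:C *: (S t p.1 - p.1)) @ 0^' --> p.2)
  (Ddense : forall u (e : R), 0 < e -> exists2 p, D p & rnorm (p.1 - u) < e).

Let Srinner t v w : rinner (S t v) (S t w) = rinner v w.
Proof. by rewrite /rinner Sinner. Qed.

Let Siso t v : rnorm (S t v) = rnorm v.
Proof.
by apply/eqP; rewrite -(@eqrXn2 _ 2) ?rnorm_ge0// -!rinner_norm Srinner.
Qed.

(** Product rule at 0 for the constant function [t |-> <S t p, S t q>]. Continuity of [S t q.1] at 0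
    comes from its differentiability. *)
Lemma generator_skew p q : D p -> D q -> rinner p.2 q.1 = - rinner p.1 q.2.
Proof.
move=> Dp Dq; have S0 : (fun t : R => S t q.1) @ 0^' --> q.1.
  have tz : (fun t : R => rnorm (t%:C *: (t^-1%:C *: (S t q.1 - q.1)))) @ 0^' --> (0 : R).
    have : (fun t : R => `|t| * rnorm (t^-1%:C *: (S t q.1 - q.1))) @ 0^' --> `|0 : R| * rnorm q.2.
      apply: cvgM; last by apply: rnorm_cvg; exact: Dder.
      by apply: cvg_norm; exact: dnbhs0_id.
    rewrite normr0 mul0r; apply: near_eq_lim; near=> t.
    by rewrite [in RHS]rnormZr.
  apply/cvg_rnormP => e e0; move/cvgrPdist_lt/(_ _ e0): tz; apply: filter_app; near=> t.
  have t0 : t != 0 by near: t; exact: nbhs_dnbhs_neq.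
  rewrite sub0r normrN ger0_norm ?rnorm_ge0// scalerA -rmorphM/= divff// scale1r.
  by rewrite rnormC.
have : (fun t : R => rinner (t^-1%:C *: (S t p.1 - p.1)) (S t q.1) +
    rinner p.1 (t^-1%:C *: (S t q.1 - q.1))) @ 0^' --> rinner p.2 q.1 + rinner p.1 q.2.
  apply: cvgD; first by apply: rinner_cvg => //; exact: Dder.
  by apply: rinner_cvg; [exact: cvg_cst|exact: Dder].
move=> h; apply/eqP; rewrite -addr_eq0; apply/eqP.
apply: (cvg_unique (@Rhausdorff R) h).
apply: (near_eq_lim (p := fun=> 0)); last exact: cvg_cst.
near=> t; rewrite rinnerZl rinnerZr -mulrDr rinnerBl rinnerBr Srinner.
by rewrite addrA subrK subrr mulr0.
Unshelve. all: by end_near. Qed.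

Let iD := scale_operator 'i D.

Let iD_sym p q : iD p -> iD q -> rinner p.2 q.1 = rinner p.1 q.2.
Proof.
move=> [p' Dp' <-] [q' Dq' <-] /=; rewrite rinnerZil.
have := generator_skew Dp' (Dlin 'i Dq' D0); rewrite /= !addr0 => ->.
by rewrite opprK.
Qed.

Let rnorm_i (v : V) : rnorm ('i *: v) = rnorm v.
Proof. by rewrite rnormZ normc_def /= expr0n expr1n add0r sqrtr1 mul1r. Qed.

Let i2 : 'i * 'i = -1 :> R[i]. Proof. by rewrite -expr2 sqr_i. Qed.

(** Cauchy-Schwarz turns the bound on the numerical range into a lower bound [r - C] for [i D - r].
    [generator_range_dense] gives dense range only after a shift by [d > 0]; the lower bound keeps
    the approximate solutions bounded, so that [d] can be made small enough to drop. *)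
Lemma semibounded_resolvent (C r : R) : C < r ->
  (forall p, D p -> rinner ('i *: p.2) p.1 <= C * rnorm p.1 ^+ 2) ->
  resolvent_set (closure (scale_operator 'i D)) r%:C.
Proof.
move=> Cr DC; pose c := r - C; have c0 : 0 < c by rewrite subr_gt0.
have below p : iD p -> c * rnorm p.1 <= rnorm (p.2 - r%:C *: p.1).
  move=> [p' Dp' <-] /=; have [n0|n0] := eqVneq (rnorm p'.1) 0.
    by rewrite n0 mulr0 rnorm_ge0.
  have n1 : 0 < rnorm p'.1 by rewrite lt_neqAle eq_sym n0 rnorm_ge0.
  rewrite -(ler_pM2r n1) rnormC; apply: le_trans (rinner_cs _ _).
  rewrite rinnerBl rinnerZl rinner_norm /c mulrBl mulrBl -!mulrA -expr2.
  by rewrite lerD2l lerN2 DC.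
apply: (dense_range_resolvent c0) => //.
  move=> a p q [p' Dp' <-] [q' Dq' <-] /=.
  exists (a *: p'.1 + q'.1, a *: p'.2 + q'.2); first exact: Dlin.
  by rewrite /= scalerDr !scalerA mulrC.
move=> u e e0; pose n := rnorm u + e.
have n0 : 0 < n by rewrite ltr_wpDl ?rnorm_ge0.
(* With [d <= c / 2] the term [d |p|] is absorbed into [c |p|], which gives [|p| <= 2 n / c]. The
   second bound on [d] then makes [d |p| <= e / 4]. *)
pose d := Num.min (c / 2) (c * e / (8 * n)).
have d0 : 0 < d by rewrite lt_min !divr_gt0// ?mulr_gt0.
have e2 : 0 < e / 2 by rewrite divr_gt0.
have [p Dp pu] := generator_range_dense Siso Dlin Dinv Dder Ddense r (- 'i *: u) d0 e2.
exists (p.1, 'i *: p.2); first by exists p.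
have dec : 'i *: p.2 - r%:C *: p.1 - u =
    'i *: ((p.2 + (- d +i* r) *: p.1 - - 'i *: u) + d%:C *: p.1).
  have -> : p.2 + (- d +i* r) *: p.1 - - 'i *: u + d%:C *: p.1 =
      p.2 + ('i * r%:C) *: p.1 + 'i *: u.
    rewrite scaleNr opprK (ACl ((1*(2*4))*3))/= -scalerDl.
    have -> // : (- d +i* r) + d%:C = 'i * r%:C :> R[i].
    by apply/eqP; rewrite eq_complex /=; apply/andP; split; apply/eqP; ring.
  by rewrite !scalerDr !scalerA mulrA i2 !mulN1r scaleN1r scaleNr.
have est1 : rnorm ('i *: p.2 - r%:C *: p.1 - u) <= e / 2 + d * rnorm p.1.
  rewrite dec rnorm_i (le_trans (rnormD _ _))// rnormZr gtr0_norm// lerD2r.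
  exact: ltW.
have est2 : c * rnorm p.1 <= rnorm u + e / 2 + d * rnorm p.1.
  have /below := (ex_intro2 _ _ p Dp erefl : iD (p.1, 'i *: p.2)).
  move=> /le_trans; apply => /=.
  rewrite -[_ - _](subrK u) (le_trans (rnormD _ _))//.
  by move: est1; lra.
rewrite /=; apply: le_lt_trans est1 _.
have dc2 : d <= c / 2 by rewrite ge_min lexx.
have dc8 : d * (8 * n) <= c * e.
  by rewrite -ler_pdivlMr ?mulr_gt0// ge_min lexx orbT.
set x := rnorm p.1 in est2 *; have x0 : 0 <= x by exact: rnorm_ge0.
have h1 : d * x <= c / 2 * x by rewrite ler_wpM2r.
have h2 : c * x <= 2 * n by rewrite /n; lra.
have h3 : d * x * (8 * n) <= 2 * n * e.
  rewrite mulrAC; apply: (@le_trans _ _ (c * e * x)); first by rewrite ler_wpM2r.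
  by rewrite mulrAC ler_wpM2r// ltW.
have h4 : d * x <= e / 4.
  have -> : e / 4 = (2 * n * e) / (8 * n) by field; rewrite gt_eqF.
  by rewrite ler_pdivlMr// mulr_gt0.
lra.
Qed.

Let s : \bar R := ereal_sup [set r%:E | r in [set r : R |
  spectrum (closure (scale_operator 'i D)) r%:C]].

Lemma support_ub_numerical_range (C : R) : (s <= C%:E)%E ->
  forall p, D p -> rinner ('i *: p.2) p.1 <= C * rnorm p.1 ^+ 2.
Proof.
move=> sC p Dp.
apply: (resolvent_numerical_range iD_sym (C := C) _ (p := (p.1, 'i *: p.2))) => [r Cr|].
  apply: contrapT => nr; have : (r%:E <= s)%E by apply: ereal_sup_ubound; exists r.
  by move=> /le_trans/(_ sC); rewrite lee_fin leNgt Cr.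
by exists p.
Qed.

Lemma numerical_range_support_ub (C : R) :
  (forall p, D p -> rinner ('i *: p.2) p.1 <= C * rnorm p.1 ^+ 2) -> (s <= C%:E)%E.
Proof.
move=> DC; apply: ge_ereal_sup => _ [r /= nr <-]; rewrite lee_fin leNgt; apply/negP => Cr.
by apply: nr; exact: semibounded_resolvent DC.
Qed.

Lemma numerical_range_support_lb (m : R) p : D p -> 0 < rnorm p.1 ->
  m * rnorm p.1 ^+ 2 <= rinner ('i *: p.2) p.1 -> (m%:E <= s)%E.
Proof.
move=> Dp p0 pm; rewrite leNgt; apply/negP => sm.
have [C sC Cm] : exists2 C : R, (s <= C%:E)%E & C < m.
  case: (s) sm => [x| |] //=; first by exists x => //; rewrite -lte_fin.
  by move=> _; exists (m - 1); rewrite ?leNye// ltrBlDr ltrDl.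
have := le_trans pm (support_ub_numerical_range sC Dp).
by rewrite ler_pM2r ?exprn_gt0// leNgt Cm.
Qed.

(** On the zero space every point is a resolvent point, so the spectrum is empty and its supremum is
    [-oo]. *)
Lemma support_nontrivial : s != -oo%E -> exists v : V, v != 0.
Proof.
move=> sN; apply: contrapT => V0.
have v0 (v : V) : v = 0 by apply: contrapT => /eqP v0; apply: V0; exists v.
move/negP : sN; apply; rewrite -leeNy_eq; apply: ge_ereal_sup => _ [r nr <-].
exfalso; apply: nr => /=; apply: (@semibounded_resolvent (r - 1)).
  by rewrite ltrBlDr ltrDl.
by move=> p _; rewrite (v0 p.1) (v0 ('i *: p.2)) rnorm0 expr0n mulr0 (rinner_norm 0) rnorm0 expr0n.
Qed.

End SupportFunctional.

(** * Support functionals of derived representations *)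

Lemma unitary_representation_comp (R : realType) (E F : tvsType R) (G : lieGroupType E)
    (H : lieGroupType F) (f : H -> G) (V : hilbertType R) (pi : G -> {linear V -> V}) :
  lie_morphism f -> unitary_representation pi -> unitary_representation (pi \o f).
Proof.
move=> hf hpi; split=> [v|g h v|g v w|v g] /=.
- by rewrite (lie_morphism1 hf) (urep1 hpi).
- by have [fM _] := hf; rewrite fM (urepM hpi).
- exact: urep_inner.
- have [_ _ _ c] := hpi.
  exact: (@continuous_comp _ _ _ f (fun g => pi g v) g (lie_morphism_cont hf (x:=g)) (c v _)).
Qed.

Section DerivedOperator.
Context (R : realType) (E : tvsType R) (G : lieGroupType E) (V : hilbertType R)
  (pi : G -> {linear V -> V}) (hpi : unitary_representation pi)
  (e : lie_algebra G -> G) (he : is_exponential e).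

Lemma expD x s t : e ((s + t) *: x) = (e (s *: x) * e (t *: x))%g.
Proof. by case: he. Qed.

Section Fixed.
Context (x : lie_algebra G).
Local Notation D := (derived_operator e pi x).

Lemma derived_operatorE p : D p <-> smooth_vectors pi p.1 /\ p.2 = dorbit pi p.1 x.
Proof.
have lim v : smooth_vectors pi v ->
    (fun t : R => (t^-1)%:C%C *: (pi (e (t *: x)) v - v)) @ 0^' --> dorbit pi v x.
  by move=> vs; apply: orbit_velocity vs _ _ _ => //; exact: exp_velocity.
case: p => v w /=; split=> [[vs pl]|[vs ->]]; last by split=> //; exact: lim.
by split=> //; exact: (cvg_unique (@norm_hausdorff _ V) pl (lim _ vs)).
Qed.

Lemma derived_operator_dorbit v : smooth_vectors pi v -> D (v, dorbit pi v x).
Proof. by move=> vs; apply/derived_operatorE. Qed.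

Lemma derived_operator_lin (a : R[i]) p q : D p -> D q ->
  D (a *: p.1 + q.1, a *: p.2 + q.2).
Proof.
move=> [ps pl] [qs ql]; split=> /=.
  by apply: smooth_vectorD => //; exact: smooth_vectorZ.
have : (fun t : R => a *: ((t^-1)%:C%C *: (pi (e (t *: x)) p.1 - p.1)) +
    (t^-1)%:C%C *: (pi (e (t *: x)) q.1 - q.1)) @ 0^' --> a *: p.2 + q.2.
  by apply: cvgD => //; exact: cvgZr.
apply: near_eq_lim; near=> t.
rewrite scalerA mulrC -scalerA -scalerDr; congr (_ *: _).
by rewrite (linearP (pi _)) scalerBr opprD addrACA.
Unshelve. all: by end_near. Qed.

Lemma derived_operator0 : D (0, 0).
Proof.
split=> /=; first exact: smooth_vector0.
apply: (near_eq_lim (p := fun=> 0)); last exact: cvg_cst.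
by near=> t; rewrite linear0 subrr scaler0.
Unshelve. all: by end_near. Qed.

Lemma derived_operator_act t p : D p -> D (pi (e (t *: x)) p.1, pi (e (t *: x)) p.2).
Proof.
move=> [ps pl]; split=> /=; first exact: smooth_vector_act.
have := cvg_comp _ _ pl (urep_cont hpi (g := e (t *: x)) (x := p.2)).
apply: near_eq_lim; near=> s.
by rewrite /= linearZ linearB /= -!(urepM hpi) -!expD [s + t]addrC.
Unshelve. all: by end_near. Qed.

End Fixed.

Hypothesis hs : smooth_representation pi.

Lemma smooth_rep_approx u (d : R) : 0 < d ->
  exists2 v, smooth_vectors pi v & rnorm (v - u) < d.
Proof.
move=> d0; have hd : dense (smooth_vectors pi) := hs.
have O0 : [set v | rnorm (v - u) < d] !=set0 by exists u => /=; rewrite subrr rnorm0.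
have Oo : open [set v | rnorm (v - u) < d].
  have -> : [set v | rnorm (v - u) < d] = ball u (d%:C%C).
    by apply/seteqP; split=> v /=; rewrite -ball_normE /= rnormC rnormE ltcR.
  by apply: ball_open; rewrite ltcR.
by have [v [/= vu vs]] := hd _ O0 Oo; exists v.
Qed.

Let dense_dom x u (d : R) : 0 < d ->
  exists2 p, derived_operator e pi x p & rnorm (p.1 - u) < d.
Proof.
move=> /(smooth_rep_approx u)[v vs vu]; exists (v, dorbit pi v x) => //.
exact: derived_operator_dorbit.
Qed.

(** The form [<i dpi(x) v, v>] with [v] fixed and the direction varying. Divided by [|v|^2], its
    supremum over nonzero smooth [v] is the support functional, while each single form is continuous
    in [x] and so passes through dense sets. *)
Definition dform v x : R := rinner ('i%C *: dorbit pi v x) v.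

Lemma dform_cont v : smooth_vectors pi v -> continuous (dform v).
Proof.
move=> vs x; apply: rinner_cvg; last exact: cvg_cst.
by apply: cvgZr; exact: dorbit_cont.
Qed.

Let Sin x (t : R) v w : inner (pi (e (t *: x)) v) (pi (e (t *: x)) w) = inner v w.
Proof. exact: urep_inner. Qed.

Let Dder x p : derived_operator e pi x p ->
  (fun t : R => (t^-1)%:C%C *: (pi (e (t *: x)) p.1 - p.1)) @ 0^' --> p.2.
Proof. by case. Qed.

Lemma dform_support_ub (C : R) x v : (support_functional e pi x <= C%:E)%E ->
  smooth_vectors pi v -> dform v x <= C * rnorm v ^+ 2.
Proof.
move=> sC vs.
exact: (support_ub_numerical_range (Sin x) (@derived_operator_lin x)
  (derived_operator0 x) (@Dder x) sC (derived_operator_dorbit x vs)).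
Qed.

Lemma support_dform_ub (C : R) x :
  (forall v, smooth_vectors pi v -> dform v x <= C * rnorm v ^+ 2) ->
  (support_functional e pi x <= C%:E)%E.
Proof.
move=> vC; apply: (numerical_range_support_ub (Sin x) (@derived_operator_lin x)
  (@derived_operator_act x) (@Dder x) (@dense_dom x)).
by move=> [v w] /derived_operatorE[/= vs ->]; exact: vC.
Qed.

Lemma support_dform_lb (m : R) x v : smooth_vectors pi v -> v != 0 ->
  m * rnorm v ^+ 2 <= dform v x -> (m%:E <= support_functional e pi x)%E.
Proof.
move=> vs v0 vm.
have n0 : 0 < rnorm v.
  by rewrite lt_neqAle rnorm_ge0 andbT eq_sym; apply: contraNneq v0 => /rnorm0_eq0 ->.
exact: (numerical_range_support_lb (Sin x) (@derived_operator_lin x)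
  (derived_operator0 x) (@Dder x) (derived_operator_dorbit x vs) n0 vm).
Qed.

Lemma support_fin_nontrivial x : support_functional e pi x != -oo%E -> exists v : V, v != 0.
Proof.
exact: (support_nontrivial (Sin x) (@derived_operator_lin x)
  (@derived_operator_act x) (@Dder x) (@dense_dom x)).
Qed.

End DerivedOperator.

Lemma dorbit_comp (R : realType) (E F : tvsType R) (G : lieGroupType E)
    (H : lieGroupType F) (f : H -> G) (e : lie_algebra H -> H) (V : hilbertType R)
    (pi : G -> {linear V -> V}) (v : V) (y : lie_algebra H) :
  lie_morphism f -> unitary_representation pi -> is_exponential e -> smooth_vectors pi v ->
  dorbit (pi \o f) v y = dorbit pi v (derived f y).
Proof.
move=> hf hpi he vs.
have ev := exp_velocity y he.
have l1 := orbit_velocity (unitary_representation_comp hf hpi) (smooth_vectors_comp hf vs) ev.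
have l2 := orbit_velocity hpi vs (morphism_velocity hf ev).
exact: (cvg_unique (@norm_hausdorff _ V) l1 l2).
Qed.

Lemma semibounded_of_dense (R : realType) (E F : tvsType R) (G : lieGroupType E)
    (H : lieGroupType F) (eG : lie_algebra G -> G) (eH : lie_algebra H -> H)
    (f : H -> G) (V : hilbertType R) (pi : G -> {linear V -> V}) :
  is_exponential eG -> is_exponential eH -> lie_morphism f -> unitary_representation pi ->
  topological_embedding (derived f) -> dense (range (derived f)) ->
  smooth_representation pi -> semibounded eH (pi \o f) -> semibounded eG pi.
Proof.
move=> heG heH hf hpi [_ Lopen] Ldense hs [hsf [U [Uo [y0 Uy0] [C UC]]]].
split=> //.
have hpif := unitary_representation_comp hf hpi.
have [W Wo WU] : [set derived f @^-1` V | V in open] U by rewrite -Lopen.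
(* Directions in [W] violating the bound form an open set. If nonempty, it would meet the range of
   [derived f], where the bound is known from [U]. *)
have ub x v : W x -> smooth_vectors pi v -> dform pi v x <= C * rnorm v ^+ 2.
  move=> Wx vs; rewrite leNgt; apply/negP => Cx.
  have [||z [[Wy /= Cy] [y _ yE]]] := Ldense (W `&` dform pi v @^-1` [set r | C * rnorm v ^+ 2 < r]).
  - by exists x.
  - apply: openI => //; apply: open_comp => [z _|]; first exact: dform_cont.
    exact: open_gt.
  move: Wy Cy; rewrite -yE => Wy; apply/negP; rewrite -leNgt.
  have Uy : U y by rewrite -WU.
  have sC : (support_functional eH (pi \o f) y <= C%:E)%E.
    by apply: le_trans (UC y Uy); rewrite lee_abs.
  have := dform_support_ub hpif heH sC (smooth_vectors_comp hf vs).
  by rewrite /dform (dorbit_comp y hf hpi heH vs).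
(* A support functional bounded on both sides is not [-oo], so [V] is not the zero space. *)
have [v v0] : exists v : V, v != 0.
  apply: (support_fin_nontrivial hpif heH hsf (x := y0)); apply/eqP => sN.
  by have := UC y0 Uy0; rewrite sN.
have nv : 0 < rnorm v.
  by rewrite lt_neqAle rnorm_ge0 andbT eq_sym; apply: contraNneq v0 => /rnorm0_eq0 ->.
(* A smooth vector closer to [v] than [|v|] cannot vanish. *)
have [w ws wv] := smooth_rep_approx hs v nv.
have w0 : w != 0 by apply: contraTneq wv => ->; rewrite sub0r rnormN ltxx.
have nw : 0 < rnorm w.
  by rewrite lt_neqAle rnorm_ge0 andbT eq_sym; apply: contraNneq w0 => /rnorm0_eq0 ->.
(* Subtracting 1 makes [d < dform pi w x] an open condition that holds at [x0]; where it holds,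
   [d / |w|^2] is a lower bound for the support functional. *)
pose x0 := derived f y0; pose d := dform pi w x0 - 1.
exists (W `&` dform pi w @^-1` [set r | d < r]); split.
- apply: openI => //; apply: open_comp => [z _|]; first exact: dform_cont.
  exact: open_gt.
- exists x0; split; first by have : U y0 by []; rewrite -WU.
  by rewrite /preimage /= /d ltrBlDr ltrDl.
exists (`|C| + `|d / rnorm w ^+ 2|) => x [Wx /= dx].
have sub : (support_functional eG pi x <= C%:E)%E.
  by apply: support_dform_ub => // u us; exact: ub.
have slb : ((d / rnorm w ^+ 2)%:E <= support_functional eG pi x)%E.
  apply: (support_dform_lb hpi heG ws w0).
  by rewrite divfK ?gt_eqF ?exprn_gt0// ltW.
case: (support_functional eG pi x) sub slb => [s| |] //=.
rewrite !lee_fin => sC ds; rewrite ler_norml; apply/andP; split.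
  rewrite lerNl; apply: (@le_trans _ _ `|d / rnorm w ^+ 2|); last by rewrite lerDr.
  by rewrite -normrN (le_trans _ (ler_norm _))// lerN2.
by apply: le_trans sC _; rewrite (le_trans (ler_norm _))// lerDl.
Qed.

(** * Locally exponential groups *)

Section Logarithm.
Context (R : realType) (E : tvsType R) (G : lieGroupType E) (e : lie_algebra G -> G)
  (he : is_exponential e) (U : set (lie_algebra G)) (W : set G) (l : G -> lie_algebra G).
Hypotheses (Uo : open U) (U0 : U 0) (Wo : open W) (UW : set_fun U W e)
  (eK : {in U, cancel e l}) (lK : {in W, cancel l e})
  (ls : mfd_smooth_on atlas (@model_atlas R (lie_algebra G)) W l).

Lemma log1 : l 1%g = 0.
Proof. by rewrite -(exp0 he) eK// inE. Qed.

Lemma log_dom1 : W 1%g.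
Proof. by rewrite -(exp0 he); exact: UW. Qed.

Lemma log_smooth : smooth_on (ucod G `&` uinv G @^-1` W) (l \o uinv G).
Proof.
have [_ /(_ _ _ (@chart1_atlas R E G) erefl)] := ls.
by apply: smooth_on_subset => x [].
Qed.

Let Lo : open (ucod G `&` uinv G @^-1` W).
Proof.
apply: open_preimage_in => //; first exact: ucod_open.
by move=> x /set_mem; exact: uinv_cont.
Qed.

Let L1 : (ucod G `&` uinv G @^-1` W) (umap (1%g : G)).
Proof.
split; first exact: ucod1.
by rewrite /preimage /= uinv1; exact: log_dom1.
Qed.

Let log_curve (g : R -> G) x : velocity1 g x ->
  (fun t => t^-1 *: l (g t)) @ 0^' --> ddir (l \o uinv G) (umap (1%g : G), x).
Proof.
move=> gx; have := smooth_on_cvg_curve (@hausdorff_model R E G) Lo log_smooth L1 gx.2.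
apply: near_eq_lim; near=> t.
rewrite /= umapK; last by near: t; exact: velocity1_udom gx.
by rewrite uinv1 log1 subr0.
Unshelve. all: by end_near. Qed.

(** Evaluated on the curve [exp (t x)], whose logarithm is [t x] for small [t]. *)
Lemma log_ddir1 x : ddir (l \o uinv G) (umap (1%g : G), x) = x.
Proof.
apply: (cvg_unique (@hausdorff_model R E G) (log_curve (exp_velocity x he))).
apply: (near_eq_lim (p := fun=> x)); last exact: cvg_cst.
near=> t; have t0 : t != 0 by near: t; exact: nbhs_dnbhs_neq.
rewrite eK ?scalerA ?mulVf ?scale1r// inE.
rewrite -[t *: x]add0r; near: t; exact: near_line_open.
Unshelve. all: by end_near. Qed.

Lemma log_velocity (g : R -> G) x : velocity1 g x -> (fun t => t^-1 *: l (g t)) @ 0^' --> x.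
Proof. by move=> /log_curve; rewrite log_ddir1. Qed.

(* [g 1 = g (1/n)^n = exp (n log (g (1/n)))], and [n log (g (1/n))] tends to [x]. *)
Lemma one_parameter_exp (g : R -> G) x : {morph g : s t / s + t >-> (s * t)%g} ->
  velocity1 g x -> g 1 = e x.
Proof.
move=> gD gx.
have g0 : g 0 = 1%g.
  have := gD 0 0; rewrite addr0 => /(congr1 (fun h => (g 0)^-1 * h)%g).
  by rewrite mulVg mulKg.
have powers s z n : g s = e z -> g (n%:R * s) = e (n%:R *: z).
  move=> gs; elim: n => [|n IH]; first by rewrite mul0r scale0r g0 (exp0 he).
  by rewrite -addn1 natrD mulrDl mul1r gD IH gs (expD he) scale1r.
have n0 : (fun n : nat => n.+1%:R^-1 : R) @ \oo --> (0 : R)^'.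
  move=> P /near_dnbhs0[d d0 dP].
  have := near_infty_natSinv_lt (PosNum d0); apply: filterS => n /= nd.
  by apply: dP; rewrite ?invr_eq0 ?pnatr_eq0// ger0_norm.
have lim : (fun n : nat => e (n.+1%:R *: l (g n.+1%:R^-1))) @ \oo --> e x.
  apply: (cvg_comp (fun n : nat => n.+1%:R *: l (g n.+1%:R^-1)) e); last exact: exp_cont.
  have := cvg_comp _ _ n0 (log_velocity gx).
  by apply: near_eq_lim; near=> n; rewrite /= invrK.
apply: (cvg_unique (@hausdorff_group R E G) _ lim).
apply: (near_eq_lim (p := fun=> g 1)); last exact: cvg_cst.
have Wn : \forall n \near \oo, W (g n.+1%:R^-1).
  apply: (cvg_comp _ _ n0 gx.1); apply: open_nbhs_nbhs; split=> //; exact: log_dom1.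
apply: filterS Wn => n Wn.
rewrite -(powers (n.+1%:R^-1)); first by rewrite divff// pnatr_eq0.
by rewrite lK// inE.
Unshelve. all: by end_near. Qed.

End Logarithm.

(** * Derivatives along one-parameter groups and dense directions *)

Lemma rnorm_ball_open (R : realType) (V : hilbertType R) (c : V) (e : R) :
  open [set w | rnorm (c - w) < e].
Proof.
have -> : [set w | rnorm (c - w) < e] = (fun w => rnorm (c - w)) @^-1` [set r | r < e] by [].
apply: open_comp => [w _|]; last exact: open_lt.
apply: rnorm_cvg; apply: cvgB; [exact: cvg_cst|exact: cvg_id].
Qed.

Lemma rnorm_ball_convex (R : realType) (V : hilbertType R) (c y z : realification V) (e l : R) :
  0 <= l -> l <= 1 -> rnorm (c - y : V) < e -> rnorm (c - z : V) < e ->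
  rnorm (c - (l *: y + (1 - l) *: z) : V) < e.
Proof.
move=> l0 l1 cy cz.
have -> : c - (l *: y + (1 - l) *: z) = l *: (c - y) + (1 - l) *: (c - z).
  by rewrite !scalerBr addrACA -scalerDl [l + _]addrC subrK scale1r opprD.
apply: le_lt_trans (rnormD _ _) _.
have -> : rnorm (l *: (c - y) : V) = l * rnorm (c - y : V).
  by rewrite -[in RHS](ger0_norm l0); exact: rnormZr.
have -> : rnorm ((1 - l) *: (c - z) : V) = (1 - l) * rnorm (c - z : V).
  have l2 : 0 <= 1 - l by rewrite subr_ge0.
  by rewrite -[in RHS](ger0_norm l2); exact: rnormZr.
move: l0; rewrite le_eqVlt => /predU1P[<-|l0].
  by rewrite mul0r add0r subr0 mul1r.
have -> : e = l * e + (1 - l) * e by ring.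
by apply: ltr_leD; [rewrite ltr_pM2l|rewrite ler_wpM2l ?subr_ge0// ltW].
Qed.

Section OneParameterDerivative.
Context (R : realType) (E : tvsType R) (G : lieGroupType E) (V : hilbertType R)
  (pi : G -> {linear V -> V}) (hpi : unitary_representation pi)
  (e : lie_algebra G -> G) (he : is_exponential e).

Definition gquot (x : E) (v : V) (t : R) : V :=
  (t^-1)%:C%C *: (pi (e (t *: x)) v - v).

Let act_cvg (T : Type) (F : set_system T) {FF : Filter F} (s : T -> R) (x : T -> E)
    (v : T -> V) (s0 : R) (x0 : E) (v0 : V) : s @ F --> s0 -> x @ F --> x0 -> v @ F --> v0 ->
  (fun t => pi (e (s t *: x t)) (v t)) @ F --> pi (e (s0 *: x0)) v0.
Proof.
move=> ss xx vv; apply: (urep_cvg hpi) => //.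
by apply: (cvg_comp _ _ (tvs_cvgZ ss xx)); exact: exp_cont.
Qed.

(** Mean value estimate for [s |-> t^-1 pi (exp (s t x)) a]. The group law carries the derivative at
    0 to every [s], where it is [pi (exp (s t x)) b]. *)
Lemma gquot_ball (x : E) (a b c : V) (t d : R) : t != 0 ->
  gquot x a @ 0^' --> b ->
  (forall s, 0 <= s -> s <= 1 -> rnorm (c - pi (e ((s * t) *: x)) b) < d) ->
  rnorm (c - gquot x a t) < d.
Proof.
move=> t0 ab Hs.
have := @mean_value_convex R (realification V)
  (fun s => (t^-1 *: (pi (e ((s * t) *: x)) a : realification V)))
  (fun s => pi (e ((s * t) *: x)) b) [set w : V | rnorm (c - w) < d].
rewrite mul1r mul0r scale0r (exp0 he) (urep1 hpi) -scalerBr; apply.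
- exact: rnorm_ball_open.
- by move=> y z l l0 l1; exact: rnorm_ball_convex.
move=> s s0 s1; split; first exact: Hs.
have := cvg_comp _ _ (cvg_comp _ _ (dnbhs0_mulr t0) ab)
  (urep_cont hpi (g := e ((s * t) *: x)) (x := b)).
apply: near_eq_lim; near=> r.
rewrite /= /gquot linearZ linearB /= -(urepM hpi) -(expD he) addrC -mulrDl.
rewrite -scalerBr scalerA -invfM mulrC addrC.
by rewrite [s + r]addrC.
Unshelve. all: by end_near. Qed.

(** For [q] in [D] near [q0] and small [t], the mean value estimate puts the quotient near [b q0]
    with a bound independent of [q]. For fixed [t] the quotient is continuous in [q], so the bound
    holds off [D] as well. *)
Lemma gquot_cvg_dense (T : topologicalType) (x : T -> E) (a b : T -> V) (D : set T) (q0 : T) :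
  continuous x -> continuous a -> continuous b -> dense D ->
  (forall q, D q -> gquot (x q) (a q) @ 0^' --> b q) ->
  (fun z : T * R => gquot (x z.1) (a z.1) z.2) @ filter_prod (nbhs q0) 0^' --> b q0.
Proof.
move=> xc ac bc Dd Dab; apply/cvg_rnormP => d d0.
have d2 : 0 < d / 2 by rewrite divr_gt0.
have : (fun z : T * R => pi (e (z.2 *: x z.1)) (b z.1)) @ filter_prod (nbhs q0) (nbhs (0 : R))
    --> pi (e (0 *: x q0)) (b q0).
  apply: act_cvg; first exact: cvg_snd.
    by apply: cvg_comp; [exact: cvg_fst|exact: xc].
  by apply: cvg_comp; [exact: cvg_fst|exact: bc].
rewrite scale0r (exp0 he) (urep1 hpi) => /cvg_rnormP/(_ _ d2)[[A B] [/= nA nB] AB].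
move: nA; rewrite {1}nbhsE => -[A' [A'o A'q0] A'A].
move/nbhs_ballP : nB => [r /= r0 rB].
exists (A', [set t : R | t != 0 /\ `|t| < r]) => /=.
  split; first exact: open_nbhs_nbhs.
  by apply/near_dnbhs0; exists r.
move=> [q t] [/= A'q [t0 tr]].
have inD q' : A' q' -> D q' -> rnorm (b q0 - gquot (x q') (a q') t) < d / 2.
  move=> A'q' Dq'; apply: gquot_ball (Dab q' Dq') _ => // s s0 s1.
  apply: (AB (q', s * t)); split; first exact: A'A.
  apply: rB; rewrite /ball /= sub0r normrN normrM ger0_norm// (le_lt_trans _ tr)//.
  by rewrite ler_piMl.
(* Only the non-strict inequality survives the passage from [D] to its closure; starting from
   [d / 2] leaves the room. *)
suff : rnorm (b q0 - gquot (x q) (a q) t) <= d / 2.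
  by move=> /le_lt_trans; apply; rewrite ltr_pdivrMr// ltr_pMr// ltr1n.
rewrite leNgt; apply/negP => dq.
have gc : continuous (fun q => rnorm (b q0 - gquot (x q) (a q) t)).
  move=> q'; apply: rnorm_cvg; apply: cvgB; first exact: cvg_cst.
  apply: cvgZr; apply: cvgB; last exact: ac.
  by apply: act_cvg; [exact: cvg_cst|exact: xc|exact: ac].
have [||q' [[A'q' /= dq'] Dq']] := Dd (A' `&`
    (fun q => rnorm (b q0 - gquot (x q) (a q) t)) @^-1` [set u | d / 2 < u]).
- by exists q.
- by apply: openI => //; apply: open_comp => [q' _|]; [exact: gc|exact: open_gt].
by have := lt_trans dq' (inD q' A'q' Dq'); rewrite ltxx.
Qed.

Lemma gquot_cvg_closure (T : topologicalType) (x : T -> E) (a b : T -> V) (D : set T) (q0 : T) :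
  continuous x -> continuous a -> continuous b -> dense D ->
  (forall q, D q -> gquot (x q) (a q) @ 0^' --> b q) ->
  gquot (x q0) (a q0) @ 0^' --> b q0.
Proof.
move=> xc ac bc Dd Dab; have h := gquot_cvg_dense (q0 := q0) xc ac bc Dd Dab.
have : (fun t : R => (q0, t)) @ 0^' --> filter_prod (nbhs q0) 0^'.
  exact: (cvg_pair (@cvg_cst _ q0 _ _ _) (@cvg_id _ _)).
by move=> h2; exact: (cvg_comp _ _ h2 h).
Qed.

(* [Kdiff L k A]: the iterated derivatives
   [dpi (L x_1) A, dpi (L x_2) (dpi (L x_1) A), ...] exist up to order [k] and are
   jointly continuous in the [x_i] and in the parameter of [A]. *)
Fixpoint Kdiff (X : tvsType R) (L : X -> E) k (P : topologicalType) (A : P -> V) : Prop :=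
  continuous A /\
  if k is k'.+1 then
    exists B : X * P -> V,
      [/\ forall x p, gquot (L x) (A p) @ 0^' --> B (x, p),
          forall p a x y, B (a *: x + y, p) = a%:C%C *: B (x, p) + B (y, p) &
          Kdiff L k' B]
  else True.

Lemma Kdiff_continuous (X : tvsType R) (L : X -> E) k (P : topologicalType) (A : P -> V) :
  Kdiff L k A -> continuous A.
Proof. by case: k => [|k] []. Qed.

Lemma KdiffS (X : tvsType R) (L : X -> E) k (P : topologicalType) (A : P -> V) :
  Kdiff L k.+1 A -> Kdiff L k A.
Proof.
elim: k P A => [|k IH] P A [Ac [B [BA Bl BK]]]; first by split.
by split=> //; exists B; split=> //; exact: IH.
Qed.

Lemma Kdiff_reparam (X : tvsType R) (L : X -> E) k (P Q : topologicalType) (s : Q -> P)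
  (A : P -> V) : continuous s -> Kdiff L k A -> Kdiff L k (A \o s).
Proof.
elim: k P Q s A => [|k IH] P Q s A sc.
  by move=> [Ac _]; split=> // q; apply: continuous_comp; [exact: sc|exact: Ac].
move=> [Ac [B [BA Bl BK]]]; split.
  by move=> q; apply: continuous_comp; [exact: sc|exact: Ac].
exists (B \o (fun z => (z.1, s z.2))); split=> [x q|q a x y|] /=; [exact: BA|exact: Bl|].
apply: IH => // -[x q]; apply: (cvg_pair (f := fun z => _) (g := fun z => _)).
  exact: cvg_fst.
by apply: (@cvg_comp _ _ _ snd s); [exact: cvg_snd|exact: sc].
Qed.

End OneParameterDerivative.

(** The hypothesis says that [F] is Cauchy along the traces of the neighbourhoods of every [t];
    completeness of [V] supplies the limits. It also covers points [t = J s], where it forces the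
    limit to be [F s]. *)
Lemma continuous_extension (R : realType) (V : hilbertType R) (S T : topologicalType)
    (J : S -> T) (F : S -> V) : dense (range J) ->
  (forall (t : T) (e : R), 0 < e -> exists c, exists2 O : set T, nbhs t O &
     forall s, O (J s) -> rnorm (F s - c) < e) ->
  exists2 F' : T -> V, continuous F' & F' \o J = F.
Proof.
move=> Jd Fc.
have lim (t : T) : exists l : V, forall e : R, 0 < e ->
    exists2 O : set T, nbhs t O & forall s, O (J s) -> rnorm (F s - l) < e.
  pose Ft := filter_from (nbhs t) (fun O => J @^-1` O).
  have FF : ProperFilter Ft.
    apply: filter_from_proper.
      apply: filter_from_filter; first by exists setT; exact: filterT.
      move=> O O' nO nO'; exists (O `&` O'); first exact: filterI.
      by move=> s [].
    move=> O; rewrite nbhsE => -[O' [O'o O't] O'O].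
    have [z [/= Os [s _ sE]]] := Jd O' (ex_intro _ t O't) O'o.
    by exists s; apply: O'O; rewrite sE.
  have [e e0|l Fl] := @rnorm_cauchy_cvg R V S Ft FF F.
    have [c [O nO Oc]] := Fc t e e0; exists c.
    by exists O => // s Os; exact: Oc.
  exists l => e e0; move/cvg_rnormP/(_ _ e0) : Fl => [O nO OF].
  by exists O => // s Os; rewrite rnormC; exact: OF.
have [F' F'P] := choice lim.
exists F'.
  move=> t; apply/cvg_rnormP => e e0.
  have e2 : 0 < e / 2 by rewrite divr_gt0.
  have [O nO Oe] := F'P t _ e2.
  move: nO; rewrite nbhsE => -[O' [O'o O't] O'O].
  apply: (@filterS _ _ _ O'); last exact: open_nbhs_nbhs.
  move=> t' O't'.
  have [P nP Pe] := F'P t' _ e2.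
  have : nbhs t' (P `&` O') by apply: filterI => //; exact: open_nbhs_nbhs.
  rewrite nbhsE => -[Q [Qo Qt'] QP].
  have [z [/= Qs [s _ sE]]] := Jd Q (ex_intro _ t' Qt') Qo.
  have [Ps O's] : (P `&` O') (J s) by apply: QP; rewrite sE.
  have h1 := Pe s Ps; have h2 := Oe s (O'O _ O's).
  have -> : F' t - F' t' = (F s - F' t') - (F s - F' t) by rewrite opprB [RHS]addrC subrKA.
  by apply: le_lt_trans (rnormB _ _) _; rewrite [e]splitr ltrD.
apply/funext => s /=; apply/eqP; rewrite -subr_eq0; apply/eqP/rnorm0_eq0/eqP.
rewrite eq_le rnorm_ge0 andbT; apply/ler_addgt0Pr => e e0; rewrite add0r.
have [O nO Oe] := F'P (J s) e e0; rewrite rnormC ltW// Oe//.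
exact: nbhs_singleton.
Qed.

Lemma dense_eq_continuous (T : topologicalType) (W : topologicalType) (D : set T)
    (f g : T -> W) : hausdorff_space W -> dense D -> continuous f -> continuous g ->
  (forall t, D t -> f t = g t) -> f = g.
Proof.
move=> hW Dd fc gc fg; apply/funext => t; apply: hW => A B nA nB.
have : nbhs t (f @^-1` A `&` g @^-1` B) by apply: filterI; [exact: fc|exact: gc].
rewrite nbhsE => -[O [Oo Ot] OAB].
have [s [/= Os Ds]] := Dd O (ex_intro _ t Ot) Oo.
have [/= As Bs] := OAB s Os.
by exists (f s); split=> //; rewrite fg.
Qed.

Lemma dense_prod_range (X T P : topologicalType) (L : X -> T) : dense (range L) ->
  dense (range (fun z : X * P => (L z.1, z.2))).
Proof.
move=> Ld O [[t p] Otp] /(_ _ Otp) [[A B] [/= nA nB] AB].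
move: nA; rewrite nbhsE => -[A' [A'o A't] A'A].
have [z [/= A's [s _ sE]]] := Ld A' (ex_intro _ t A't) A'o.
exists (L s, p); split; last by exists (s, p).
apply: AB; split=> /=; last exact: nbhs_singleton.
by apply: A'A; rewrite sE.
Qed.

Section LinearExtension.
Context (R : realType) (V : hilbertType R) (X E : tvsType R) (P : topologicalType)
  (L : X -> E) (LD : forall x y, L (x + y) = L x + L y)
  (LZ : forall a x, L (a *: x) = a *: L x)
  (Lemb : topological_embedding L) (Ld : dense (range L)).

Let LB x y : L (x - y) = L x - L y.
Proof. by rewrite LD -scaleN1r LZ scaleN1r. Qed.

(** The embedding hypothesis in the form used: closeness of [L y] and [L y0] forces [y - y0] to be
    small in [X]. *)
Let Lnbhs (N : set X) : nbhs 0 N -> exists2 O : set E, nbhs 0 O & L @^-1` O `<=` N.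
Proof.
rewrite nbhsE => -[N' [N'o N'0] N'N].
have [_ Lo] := Lemb.
have [O Oo ON] : [set L @^-1` V | V in open] N' by rewrite -Lo.
exists O; last by rewrite ON.
apply: open_nbhs_nbhs; split=> //.
have L0 : L 0 = 0 by rewrite -(scale0r 0) LZ scale0r.
by move: N'0; rewrite -ON /preimage /= L0.
Qed.

(* Linearity in the first variable makes [F] uniformly continuous there, locally
   uniformly in the parameter. *)
Lemma linear_extension (F : X * P -> V) : continuous F ->
  (forall p a x y, F (a *: x + y, p) = a%:C%C *: F (x, p) + F (y, p)) ->
  exists F' : E * P -> V, [/\ continuous F', forall x p, F' (L x, p) = F (x, p) &
    forall p a x y, F' (a *: x + y, p) = a%:C%C *: F' (x, p) + F' (y, p)].
Proof.
move=> Fc Fl.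
have F0 p : F (0, p) = 0.
  by have := Fl p (-1) 0 0; rewrite scaler0 addr0 rmorphN1 scaleN1r addNr.
have FB p x y : F (x, p) = F (x - y, p) + F (y, p).
  by have := Fl p 1 (x - y) y; rewrite !scale1r subrK.
have [|F' F'c F'J] := @continuous_extension R V _ _ (fun z : X * P => (L z.1, z.2)) F
    (dense_prod_range Ld).
  move=> [x0 p0] d d0.
  have d2 : 0 < d / 2 by rewrite divr_gt0.
  have /cvg_rnormP/(_ _ d2)[[N P0] [/= nN nP0] NP] := Fc (0, p0).
  have [O nO ON] := Lnbhs nN.
  have [[O1 O2] [/= nO1 nO2] O12] : nbhs (x0, x0) (fun z : E * E => O (z.1 - z.2)).
    have := @sub_continuous E (x0, x0); rewrite /continuous_at subrr.
    by apply.
  have : nbhs x0 (O1 `&` O2) by exact: filterI.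
  rewrite nbhsE => -[Q [Qo Qx0] QO].
  have [z [/= Qy [y0 _ y0E]]] := Ld (ex_intro _ x0 Qx0) Qo.
  have Fyc : continuous (fun p => F (y0, p)).
    move=> p; apply: (@continuous_comp _ _ _ (fun p => (y0, p)) F); last exact: Fc.
    exact: (cvg_pair (@cvg_cst _ y0 _ _ _) (@cvg_id _ _)).
  have /cvg_rnormP/(_ _ d2) nP1 := Fyc p0.
  (* The centre is taken at a point [y0] with [L y0] near [x0]. By linearity,
     [F (y, p) - F (y0, p0)] splits into [F (y - y0, p)], small by continuity at [(0, p0)], and the
     variation of [F (y0, p)] in [p]. *)
  exists (F (y0, p0)); exists (Q `*` (P0 `&` [set p | rnorm (F (y0, p0) - F (y0, p)) < d / 2])).
    exists (Q, P0 `&` [set p | rnorm (F (y0, p0) - F (y0, p)) < d / 2]) => //=.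
    by split; [exact: open_nbhs_nbhs|exact: filterI].
  move=> [y p] [/= Qy' [P0p pd]].
  have -> : F (y, p) - F (y0, p0) = F (y - y0, p) - (F (y0, p0) - F (y0, p)).
    by rewrite (FB p y y0) opprB addrA.
  apply: le_lt_trans (rnormB _ _) _; rewrite [d]splitr ltrD//.
  have /NP : (N `*` P0) (y - y0, p).
    split=> //=; apply: ON; rewrite /preimage /= LB; apply: (O12 (L y, L y0)); split=> /=.
      by have [] := QO _ Qy'.
    by have [] := QO (L y0); rewrite ?y0E.
  by rewrite /= F0 sub0r rnormN.
have F'E x p : F' (L x, p) = F (x, p) by rewrite -F'J.
exists F'; split=> // p a.
suff h : (fun z : E * E => F' (a *: z.1 + z.2, p)) =
    (fun z : E * E => a%:C%C *: F' (z.1, p) + F' (z.2, p)).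
  by move=> x y; have := congr1 (fun f => f (x, y)) h.
have F'p : continuous (fun x => F' (x, p)).
  move=> x; apply: (@continuous_comp _ _ _ (fun x => (x, p)) F'); last exact: F'c.
  exact: (cvg_pair (@cvg_id _ _) (@cvg_cst _ p _ _ _)).
apply: (dense_eq_continuous (D := range (fun z : X * X => (L z.1, L z.2)))).
- exact: (@norm_hausdorff _ V).
- move=> O [[t s] Ots] Oo; have [[A B] [/= nA nB] AB] := Oo _ Ots.
  move: nA nB; rewrite !nbhsE => -[A' [A'o A't] A'A] [B' [B'o B't] B'B].
  have [z [/= Ax [x _ xE]]] := Ld (ex_intro _ t A't) A'o.
  have [z' [/= By [y _ yE]]] := Ld (ex_intro _ s B't) B'o.
  exists (L x, L y); split; last by exists (x, y).
  by apply: AB; split=> /=; [apply: A'A; rewrite xE|apply: B'B; rewrite yE].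
- move=> z; apply: (@continuous_comp _ _ _ (fun z : E * E => a *: z.1 + z.2)
    (fun x => F' (x, p))); last exact: F'p.
  by apply: tvs_cvgD; [apply: tvs_cvgZ; [exact: cvg_cst|exact: cvg_fst]|exact: cvg_snd].
- move=> z; apply: cvgD.
    apply: cvgZr; apply: (@continuous_comp _ _ _ fst (fun x => F' (x, p))); last exact: F'p.
    exact: cvg_fst.
  apply: (@continuous_comp _ _ _ snd (fun x => F' (x, p))); last exact: F'p.
  exact: cvg_snd.
- move=> _ [[x y] _ <-] /=; rewrite -LZ -LD !F'E; exact: Fl.
Qed.

End LinearExtension.

Lemma continuous_pair (S T W : topologicalType) (f : S -> T) (g : S -> W) :
  continuous f -> continuous g -> continuous (fun z => (f z, g z)).
Proof. by move=> fc gc z; exact: (cvg_pair (fc z) (gc z)). Qed.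

Lemma continuous_swap12 (S T W : topologicalType) :
  continuous (fun z : S * (T * W) => (z.2.1, (z.1, z.2.2))).
Proof.
have c1 : continuous (fun z : S * (T * W) => z.1) by move=> z; exact: cvg_fst.
have c2 : continuous (fun z : S * (T * W) => z.2) by move=> z; exact: cvg_snd.
have c21 : continuous (fun z : S * (T * W) => z.2.1).
  by move=> z; apply: (continuous_comp (c2 z)); exact: cvg_fst.
have c22 : continuous (fun z : S * (T * W) => z.2.2).
  by move=> z; apply: (continuous_comp (c2 z)); exact: cvg_snd.
exact: (continuous_pair c21 (continuous_pair c1 c22)).
Qed.

Lemma cvg_slice2 (S T : topologicalType) (W : topologicalType) (f : S * T -> W) (y : T) :
  continuous f -> continuous (fun x => f (x, y)).
Proof.
move=> fc x; apply: (@continuous_comp _ _ _ (fun x => (x, y)) f); last exact: fc.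
exact: (cvg_pair (@cvg_id _ _) (@cvg_cst _ y _ _ _)).
Qed.

Section DenseDirections.
Context (R : realType) (E : tvsType R) (G : lieGroupType E) (V : hilbertType R)
  (pi : G -> {linear V -> V}) (hpi : unitary_representation pi)
  (e : lie_algebra G -> G) (he : is_exponential e) (X : tvsType R) (L : X -> E)
  (LD : forall x y, L (x + y) = L x + L y) (LZ : forall a x, L (a *: x) = a *: L x)
  (Lemb : topological_embedding L) (Ld : dense (range L)).

Lemma gquot_linear (x : E) (a : R) (v w v' w' : V) :
  gquot pi e x v @ 0^' --> v' -> gquot pi e x w @ 0^' --> w' ->
  gquot pi e x (a%:C%C *: v + w) @ 0^' --> a%:C%C *: v' + w'.
Proof.
move=> vl wl.
have : (fun t => a%:C%C *: gquot pi e x v t + gquot pi e x w t) @ 0^' --> a%:C%C *: v' + w'.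
  by apply: cvgD => //; exact: cvgZr.
apply: near_eq_lim; near=> t.
rewrite /gquot scalerA mulrC -scalerA -scalerDr; congr (_ *: _).
by rewrite (linearP (pi _)) scalerBr opprD addrACA.
Unshelve. all: by end_near. Qed.

Lemma gquot_unique (x : E) (v w w' : V) :
  gquot pi e x v @ 0^' --> w -> gquot pi e x v @ 0^' --> w' -> w = w'.
Proof. exact: (cvg_unique (@norm_hausdorff _ V)). Qed.

(** Differentiating [A] puts the new direction [w] in front of [x], whereas [linear_extension] works
    in the first variable. The swap [s] brings [x] forward; linearity of [B] in [x] is inherited
    from [A] by uniqueness of limits. Swapping back, density shows that the extension is the
    derivative of [A'] along [L w]. *)
Lemma Kdiff_extension k (P : topologicalType) (A : X * P -> V) (A' : E * P -> V) :
  Kdiff pi e L k A ->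
  (forall p a x y, A (a *: x + y, p) = a%:C%C *: A (x, p) + A (y, p)) ->
  continuous A' -> (forall x p, A' (L x, p) = A (x, p)) -> Kdiff pi e L k A'.
Proof.
elim: k P A A' => [|k IH] P A A' AK Al A'c A'A; first by split.
have [Ac [B [BA Bl BK]]] := AK.
pose s (z : X * (X * P)) : X * (X * P) := (z.2.1, (z.1, z.2.2)).
have sc : continuous s by exact: continuous_swap12.
have sK := Kdiff_reparam sc BK.
have sl (p : X * P) a x y : (B \o s) (a *: x + y, p) = a%:C%C *: (B \o s) (x, p) + (B \o s) (y, p).
  rewrite /= /s /=; apply: (gquot_unique (BA p.1 (a *: x + y, p.2))).
  by rewrite Al; apply: gquot_linear; exact: BA.
have [C [Cc CB Cl]] := linear_extension LD LZ Lemb Ld (Kdiff_continuous sK) sl.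
have CK := IH _ _ _ sK sl Cc CB.
pose s' (z : X * (E * P)) : E * (X * P) := (z.2.1, (z.1, z.2.2)).
have s'c : continuous s' by exact: continuous_swap12.
split=> //; exists (C \o s'); split; last exact: Kdiff_reparam.
- move=> w [x p]; rewrite /= /s' /=.
  apply: (gquot_cvg_closure hpi he (x := fun=> L w) (a := fun x => A' (x, p))
    (b := fun x => C (x, (w, p))) (D := range L) (q0 := x)) => //.
  + by move=> q; exact: cvg_cst.
  + exact: cvg_slice2.
  + exact: cvg_slice2.
  + by move=> _ [y _ <-]; rewrite A'A CB; exact: BA.
- move=> [x p] a w w'; rewrite /= /s' /=.
  suff h : (fun x => C (x, (a *: w + w', p))) =
      (fun x => a%:C%C *: C (x, (w, p)) + C (x, (w', p))).
    exact: (congr1 (fun f => f x) h).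
  apply: (dense_eq_continuous (@norm_hausdorff _ V) Ld).
  + exact: cvg_slice2.
  + move=> y; apply: cvgD; first apply: cvgZr; exact: cvg_slice2.
  + by move=> _ [y _ <-]; rewrite !CB; exact: Bl.
Qed.

(** Extending the first direction to [E] gives [C], whose own iterated derivatives are still taken
    along [L] by [Kdiff_extension]; the induction then frees those directions too. *)
Lemma Kdiff_dense k (P : topologicalType) (A : P -> V) :
  Kdiff pi e L k A -> Kdiff pi e (fun x : E => x) k A.
Proof.
elim: k P A => [|k IH] P A; first by move=> [Ac _]; split.
move=> [Ac [B [BA Bl BK]]]; split=> //.
have [C [Cc CB Cl]] := linear_extension LD LZ Lemb Ld (Kdiff_continuous BK) Bl.
exists C; split=> //; last by apply: IH; exact: Kdiff_extension BK Bl Cc CB.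
move=> x p.
apply: (gquot_cvg_closure hpi he (x := fun x => x) (a := fun=> A p)
  (b := fun x => C (x, p)) (D := range L) (q0 := x)) => //.
- by move=> y; exact: cvg_id.
- by move=> y; exact: cvg_cst.
- exact: cvg_slice2.
- by move=> _ [y _ <-]; rewrite CB; exact: BA.
Qed.

End DenseDirections.

(** * Iterated derivatives of a smooth vector *)

Lemma cvg_pair_nbhs (T : Type) (F : set_system T) {FF : Filter F} (S W : topologicalType)
    (f : T -> S) (g : T -> W) (a : S) (b : W) :
  f @ F --> a -> g @ F --> b -> (fun t => (f t, g t)) @ F --> (a, b).
Proof. exact: cvg_pair. Qed.

Lemma velocity_pair (R : realType) (E F : tvsType R) (f : R -> E) (g : R -> F)
    (a v : E) (b w : F) :
  (fun t => t^-1 *: (f t - a)) @ 0^' --> v -> (fun t => t^-1 *: (g t - b)) @ 0^' --> w ->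
  (fun t => t^-1 *: ((f t, g t) - (a, b))) @ 0^' --> (v, w).
Proof. by move=> fv gw; exact: (cvg_pair_nbhs fv gw). Qed.

Lemma velocity_cst (R : realType) (E : tvsType R) (a : E) :
  (fun t : R => t^-1 *: (a - a)) @ 0^' --> (0 : E).
Proof.
apply: (near_eq_lim (p := fun=> 0)); last exact: cvg_cst.
by near=> t; rewrite subrr scaler0.
Unshelve. all: by end_near. Qed.

Section UnitChartProduct.
Context (R : realType) (E : tvsType R) (G : lieGroupType E).

Definition umul (z : E * E) : E := umap (uinv G z.1 * uinv G z.2)%g.

Definition umul_dom : set (E * E) :=
  (ucod G `*` ucod G) `&` [set z | udom (uinv G z.1 * uinv G z.2)%g].

Lemma mulg_cont : continuous (fun p : G * G => (p.1 * p.2)%g).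
Proof. by have [mc _] := @mulg_smooth R E G; move=> p; apply: mc; rewrite inE. Qed.

Lemma umul_dom_open : open umul_dom.
Proof.
have := @open_mfd_dom R (E * E)%type E (G * G)%type G _ _ [set: G * G]
  (fun p : G * G => (p.1 * p.2)%g) (prod_chartP (unit_is_chart G) (unit_is_chart G))
  (unit_is_chart G) openT (fun x _ => @mulg_cont x).
congr open; apply/seteqP; split=> [z [zc [_ zd]]|z [zc zd]]; first by split.
by split=> //; split.
Qed.

Lemma umul_smooth : smooth_on umul_dom umul.
Proof.
have [_ /(_ (prod_chart (@chart1 R E G) (@chart1 R E G)) (@chart1 R E G))] := @mulg_smooth R E G.
move=> /(_ _ (@chart1_atlas R E G)) h.
have h1 : prod_atlas atlas atlas (prod_chart (@chart1 R E G) (@chart1 R E G)).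
  by exists chart1, chart1; split=> //; exact: chart1_atlas.
by apply: smooth_on_subset (h h1) => z [zc zd]; split=> //; split.
Qed.

Lemma umul_dom1 y : ucod G y -> umul_dom (y, umap (1%g : G)).
Proof.
move=> yc; split; first by split=> //; exact: ucod1.
by rewrite /= uinv1 mulg1; exact: uinv_dom.
Qed.

Lemma umul1 y : ucod G y -> umul (y, umap (1%g : G)) = y.
Proof. by move=> yc; rewrite /umul /= uinv1 mulg1 uinvK. Qed.

(* The left-invariant vector field with value [w] at the unit, in the unit chart. *)
Definition uleft (z : E * E) : E := ddir umul ((z.1, umap (1%g : G)), (0, z.2)).

Lemma uleft_smooth : smooth_on (ucod G `*` [set: E]) uleft.
Proof.
have uo : open (ucod G `*` [set: E]) by apply: open_setXT; exact: ucod_open.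
apply: (@smooth_on_comp _ _ _ _ _ (umul_dom `*` [set: E * E])
  (fun z : E * E => ((z.1, umap (1%g : G)), (0, z.2)))) => //.
- by apply: open_setXT; exact: umul_dom_open.
- by move=> [y w] [/= yc _]; split=> //; exact: umul_dom1.
- apply: smooth_on_pair; apply: smooth_on_pair.
  + exact: smooth_on_fst.
  + exact: smooth_on_cst.
  + exact: smooth_on_cst.
  + exact: smooth_on_snd.
- by apply: smooth_on_ddir; [exact: (@hausdorff_model R E G)|exact: umul_dom_open|exact: umul_smooth].
Qed.

Lemma uleft_velocity (g : R -> G) y w : ucod G y -> velocity1 g w ->
  (fun t => t^-1 *: (umap (uinv G y * g t)%g - y)) @ 0^' --> uleft (y, w).
Proof.
move=> yc gw; have [g1 gv] := gw.
have cv := velocity_pair (velocity_cst y) gv.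
have := smooth_on_cvg_curve (@hausdorff_model R E G) umul_dom_open umul_smooth (umul_dom1 yc) cv.
apply: near_eq_lim; near=> t.
rewrite umul1// /umul /= umapK//.
by near: t; exact: velocity1_udom gw.
Unshelve. all: by end_near. Qed.

Lemma near_mulg_udom (g : R -> G) y w : ucod G y -> velocity1 g w ->
  \forall t \near 0^', udom (uinv G y * g t)%g.
Proof.
move=> yc [g1 _].
have : (fun t => (uinv G y * g t)%g) @ 0^' --> (uinv G y * 1)%g.
  have h : (fun t => (uinv G y, g t)) @ 0^' --> (uinv G y, 1%g : G).
    by apply: cvg_pair_nbhs => //; exact: cvg_cst.
  exact: (cvg_comp _ _ h (@mulg_cont (uinv G y, 1%g))).
by rewrite mulg1; apply; apply: open_nbhs_nbhs; split; [exact: udom_open|exact: uinv_dom].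
Qed.

End UnitChartProduct.

Section SmoothFamilies.
Context (R : realType) (E : tvsType R) (G : lieGroupType E) (V : hilbertType R)
  (pi : G -> {linear V -> V}) (hpi : unitary_representation pi)
  (e : lie_algebra G -> G) (he : is_exponential e).
Local Notation VR := (realification V).

(** The form of smoothness that reproduces itself: the derivative along one-parameter groups of a
    smooth family is a smooth family with one more parameter, the direction. *)
Definition smooth_family (Q : tvsType R) (A : Q -> V) :=
  smooth_on (ucod G `*` [set: Q]) (fun z => pi (uinv G z.1) (A z.2) : VR).

Section Step.
Context (Q : tvsType R) (A : Q -> V) (As : smooth_family A).

Let F (z : E * Q) : VR := pi (uinv G z.1) (A z.2).

Let Do : open (ucod G `*` [set: Q]). Proof. by apply: open_setXT; exact: ucod_open. Qed.

Let hV := @realification_hausdorff R V.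

Lemma smooth_family_cont : continuous A.
Proof.
move=> q.
have h : (umap (1%g : G), q) \in ucod G `*` [set: Q].
  by rewrite inE; split=> //; exact: ucod1.
have := smooth_on_continuous As h.
move=> c; have := continuous_comp (f := fun q => (umap (1%g : G), q)) _ c.
have -> : (fun z => pi (uinv G z.1) (A z.2)) \o (fun q => (umap (1%g : G), q)) = A.
  by apply/funext => q' /=; rewrite uinv1 (urep1 hpi).
apply; exact: (cvg_pair_nbhs (@cvg_cst _ (umap (1%g : G)) _ (nbhs q) _) (@cvg_id _ _)).
Qed.

Definition family_deriv (z : E * Q) : V :=
  ddir F ((umap (1%g : G), z.2), (z.1, 0)).

Let curve (g : R -> G) y w q : ucod G y -> velocity1 g w ->
  (fun t => (t^-1)%:C%C *: (pi (uinv G y * g t)%g (A q) - pi (uinv G y) (A q)) : V) @ 0^' -->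
  ddir F ((y, q), (uleft G (y, w), 0)).
Proof.
move=> yc gw.
have cv := velocity_pair (uleft_velocity yc gw) (velocity_cst q).
have yq : (ucod G `*` [set: Q]) (y, q) by [].
have := smooth_on_cvg_curve hV Do As yq cv.
apply: near_eq_lim; near=> t.
rewrite /= umapK//; near: t; exact: near_mulg_udom yc gw.
Unshelve. all: by end_near. Qed.

Let uleft1 w : uleft G (umap (1%g : G), w) = w.
Proof.
have h := uleft_velocity (ucod1 G) (exp_velocity w he).
apply: (cvg_unique (@hausdorff_model R E G) h).
have [_ ] := exp_velocity w he; apply: near_eq_lim; near=> t.
by rewrite uinv1 mul1g.
Unshelve. all: by end_near. Qed.

Lemma gquot_family_deriv w q : gquot pi e w (A q) @ 0^' --> family_deriv (w, q).
Proof.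
have := @curve _ _ _ q (ucod1 G) (exp_velocity w he); rewrite uleft1.
by apply: near_eq_lim; near=> t; rewrite uinv1 mul1g (urep1 hpi).
Unshelve. all: by end_near. Qed.

Lemma family_deriv_linear q (a : R) x y :
  family_deriv (a *: x + y, q) = a%:C%C *: family_deriv (x, q) + family_deriv (y, q).
Proof.
have h : (ucod G `*` [set: Q]) (umap (1%g : G), q) by split=> //; exact: ucod1.
rewrite /family_deriv /=.
have -> : (a *: x + y, 0) = a *: (x, 0) + (y, 0) :> E * Q.
  by rewrite -[RHS]/(a *: x + y, a *: 0 + 0) scaler0 addr0.
have hZ := ddirZ hV As a ((x, 0) : E * Q) h.
have hD := ddirD hV Do As (a *: ((x, 0) : E * Q)) ((y, 0) : E * Q) h.
exact: (etrans hD (congr1 (fun u : VR => u + ddir F ((umap (1%g : G), q), (y, 0))) hZ)).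
Qed.

(** The vector [pi g (family_deriv (w, q))] is the derivative of [F] at [(g, q)] along the
    left-invariant field [uleft], hence [ddir F] composed with a smooth map. *)
Lemma family_deriv_smooth : smooth_family family_deriv.
Proof.
have c1 : continuous (fun z : E * (E * Q) => z.1) by move=> z; exact: cvg_fst.
have c2 : continuous (fun z : E * (E * Q) => z.2) by move=> z; exact: cvg_snd.
have c21 : continuous (fun z : E * (E * Q) => z.2.1).
  by move=> z; apply: (continuous_comp (c2 z)); exact: cvg_fst.
have c22 : continuous (fun z : E * (E * Q) => z.2.2).
  by move=> z; apply: (continuous_comp (c2 z)); exact: cvg_snd.
have D'o : open (ucod G `*` [set: E * Q]) by apply: open_setXT; exact: ucod_open.
pose m (z : E * (E * Q)) := ((z.1, z.2.2), (uleft G (z.1, z.2.1), 0) : E * Q).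
have ms : smooth_on (ucod G `*` [set: E * Q]) m.
  apply: smooth_on_pair; apply: smooth_on_pair.
  - exact: smooth_on_linear.
  - exact: smooth_on_linear.
  - apply: (@smooth_on_comp _ _ _ _ _ (ucod G `*` [set: E]) (fun z => (z.1, z.2.1))) => //.
    + by apply: open_setXT; exact: ucod_open.
    + by apply: smooth_on_pair; exact: smooth_on_linear.
    + exact: uleft_smooth.
  - exact: smooth_on_cst.
apply: (smooth_on_congr (f := ddir F \o m)) => //; last first.
  apply: (smooth_on_comp _ _ _ ms (smooth_on_ddir hV Do As)) => //.
  exact: open_setXT.
move=> [y [w q]] /set_mem[/= yc _].
have l1 := @curve _ _ _ q yc (exp_velocity w he).
have l2 := cvg_comp _ _ (@gquot_family_deriv w q)
  (urep_cont hpi (g := uinv G y) (x := family_deriv (w, q))).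
apply: (cvg_unique hV l1); move: l2; apply: near_eq_lim; near=> t.
by rewrite /= linearZ linearB /= (urepM hpi).
Unshelve. all: by end_near. Qed.

End Step.

Lemma smooth_family_Kdiff k (Q : tvsType R) (A : Q -> V) :
  smooth_family A -> Kdiff pi e (fun x : E => x) k A.
Proof.
elim: k Q A => [|k IH] Q A As; first by split=> //; exact: smooth_family_cont.
split; first exact: smooth_family_cont.
exists (family_deriv A); split.
- by move=> x q; exact: gquot_family_deriv.
- by move=> q a x y; exact: family_deriv_linear.
- by apply: IH; exact: family_deriv_smooth.
Qed.

Lemma smooth_vector_Kdiff k (Q : tvsType R) v :
  smooth_vectors pi v -> Kdiff pi e (fun x : E => x) k (fun _ : Q => v).
Proof.
move=> vs; apply: smooth_family_Kdiff.
apply: (@smooth_on_compfst _ _ _ _ (ucod G) (fun z => pi (uinv G z) v : VR)).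
  exact: ucod_open.
by move/(smooth_vectorP hpi) : vs; apply; exact: chart1_atlas.
Qed.

End SmoothFamilies.

(** * Smoothness of orbit maps *)

Lemma hausdorff_prod (S T : topologicalType) :
  hausdorff_space S -> hausdorff_space T -> hausdorff_space (S * T)%type.
Proof.
move=> hS hT [x y] [x' y'] h; congr (_, _).
  apply: hS => A B nA nB.
  have [||[a b] [[/= Aa _] [Ba _]]] := h (A `*` setT) (B `*` setT).
  - by exists (A, setT) => //; split=> //; exact: filterT.
  - by exists (B, setT) => //; split=> //; exact: filterT.
  by exists a.
apply: hT => A B nA nB.
have [||[a b] [[/= _ Aa] [_ Ba]]] := h (setT `*` A) (setT `*` B).
- by exists (setT, A) => //; split=> //; exact: filterT.
- by exists (setT, B) => //; split=> //; exact: filterT.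
by exists b.
Qed.

Lemma scaled_split (R : fieldType) (W : lmodType R) (a b c : W) (t : R) : t != 0 ->
  a + t^-1 *: (b - c) = t^-1 *: (t *: a + b - c).
Proof. by move=> t0; rewrite -addrA [in RHS]scalerDr scalerA mulVf// scale1r. Qed.

Section Multilinear.
Context (R : realType) (E : tvsType R) (V : hilbertType R).
Local Notation VR := (realification V).

(* [E ^ n] with one dummy factor at the end, on which the maps below do not depend. *)
Fixpoint tpow n : tvsType R := if n is n'.+1 then (E * tpow n')%type : tvsType R else E.

Fixpoint multilinear n : (tpow n -> V) -> Prop :=
  if n is n'.+1 return (tpow n -> V) -> Prop then
    fun A => (forall p a x y, A (a *: x + y, p) = a%:C%C *: A (x, p) + A (y, p)) /\
      forall x, multilinear (fun p : tpow n' => A (x, p))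
  else fun A => forall p q, A p = A q.

Fixpoint replace_factor n (i : nat) : tpow n * tpow n -> tpow n :=
  if n is n'.+1 return tpow n * tpow n -> tpow n then
    if i is i'.+1 then
      fun z : (E * tpow n') * (E * tpow n') => (z.1.1, replace_factor i' (z.1.2, z.2.2))
    else fun z : (E * tpow n') * (E * tpow n') => (z.2.1, z.1.2)
  else fun z => z.1.

Lemma replace_factor_smooth n i (U : set (tpow n * tpow n)) : smooth_on U (@replace_factor n i).
Proof.
apply: smooth_on_linear; last first.
  elim: n i {U} => [|n IH] [|i] // a [[x p] [x' p']] [[y q] [y' q']] //=.
  by have := IH i a (p, p') (q, q'); rewrite /= => ->.
elim: n i {U} => [|n IH] [|i] /=; try by move=> z; exact: cvg_fst.
  have c1 : continuous (fun z : (E * tpow n) * (E * tpow n) => z.1) by move=> z; exact: cvg_fst.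
  have c2 : continuous (fun z : (E * tpow n) * (E * tpow n) => z.2) by move=> z; exact: cvg_snd.
  apply: continuous_pair => z.
    by apply: (continuous_comp (c2 z)); exact: cvg_fst.
  by apply: (continuous_comp (c1 z)); exact: cvg_snd.
have c1 : continuous (fun z : (E * tpow n) * (E * tpow n) => z.1) by move=> z; exact: cvg_fst.
have c2 : continuous (fun z : (E * tpow n) * (E * tpow n) => z.2) by move=> z; exact: cvg_snd.
apply: continuous_pair => z.
  by apply: (continuous_comp (c1 z)); exact: cvg_fst.
apply: (@continuous_comp _ _ _ (fun z : (E * tpow n) * (E * tpow n) => (z.1.2, z.2.2))); last exact: IH.
by apply: continuous_pair => {}z; [apply: (continuous_comp (c1 z))|apply: (continuous_comp (c2 z))];
  exact: cvg_snd.
Qed.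

(** The first factor is peeled off: the increment is [t A (v, p + t q)] plus the increment of
    [A (u, -)], to which the induction applies. *)
Lemma multilinear_derivative n (A : tpow n -> V) : continuous A -> multilinear A ->
  forall p q, dir_quotient (A : tpow n -> VR) p q @ 0^' -->
    (\sum_(i < n) A (replace_factor i (p, q)) : VR).
Proof.
elim: n A => [|n IH] A Ac.
  move=> A0 p q; rewrite big_ord0; apply: (near_eq_lim (p := fun=> 0)); last exact: cvg_cst.
  by near=> t; rewrite /dir_quotient (A0 _ p) subrr scaler0.
move=> [Al A1] [u p] [v q].
have Acu : continuous (fun p => A (u, p)).
  move=> p'; apply: (@continuous_comp _ _ _ (fun p => (u, p)) A); last exact: Ac.
  exact: (cvg_pair_nbhs (@cvg_cst _ u _ _ _) (@cvg_id _ _)).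
rewrite big_ord_recl.
apply: (near_eq_lim (p := fun t : R => (A (v, p + t *: q) : VR) +
   dir_quotient (fun p => A (u, p) : VR) p q t)); last first.
  apply: tvs_cvgD; last exact: (IH _ Acu (A1 u) p q).
  have c : (fun t : R => (v, p + t *: q)) @ 0^' --> (v, p).
    apply: cvg_pair_nbhs; first exact: cvg_cst.
    rewrite -[X in _ --> X]addr0 -(scale0r q); apply: tvs_cvgD; first exact: cvg_cst.
    by apply: tvs_cvgZ; [exact: dnbhs0_id|exact: cvg_cst].
  exact: (cvg_comp _ _ c (Ac (v, p))).
near=> t; have t0 : t != 0 by near: t; exact: nbhs_dnbhs_neq.
rewrite /dir_quotient.
have -> : A ((u, p) + t *: (v, q)) = t%:C%C *: A (v, p + t *: q) + A (u, p + t *: q).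
  by rewrite -Al [_ + u]addrC.
exact: (scaled_split _ _ _ t0).
Unshelve. all: by end_near. Qed.

End Multilinear.

(** * The left logarithmic derivative in the unit chart *)

Section LeftLogarithmicDerivative.
Context (R : realType) (E : tvsType R) (G : lieGroupType E) (e : lie_algebra G -> G)
  (he : is_exponential e) (U : set (lie_algebra G)) (W : set G) (l : G -> lie_algebra G).
Hypotheses (U0 : U 0) (Wo : open W) (UW : set_fun U W e)
  (eK : {in U, cancel e l}) (lK : {in W, cancel l e})
  (ls : mfd_smooth_on atlas (@model_atlas R (lie_algebra G)) W l).

Lemma invg_cont : continuous (fun g : G => g^-1%g).
Proof. by have [ic _] := @invg_smooth R E G; move=> p; apply: ic; rewrite inE. Qed.

(** Both [g] and [g^-1] lie in the unit chart, so that [g^-1 h] can be computed entirely in that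
    chart. *)
Definition ucod_inv : set E := ucod G `&` uinv G @^-1` [set g | udom (g^-1)%g].

Local Notation O := ucod_inv.

Lemma ucod_inv_open : open O.
Proof.
apply: open_preimage_in; first exact: ucod_open.
  by move=> x /set_mem; exact: uinv_cont.
by apply: open_comp => [x _|]; [exact: invg_cont|exact: udom_open].
Qed.

Lemma ucod_inv1 : O (umap (1%g : G)).
Proof. by split; [exact: ucod1|rewrite /preimage /= uinv1 invg1; exact: udom1]. Qed.

Let iota (z : E) : E := umap ((uinv G z)^-1)%g.

Let iota_smooth : smooth_on O iota.
Proof.
have [_ /(_ _ _ (@chart1_atlas R E G) (@chart1_atlas R E G))] := @invg_smooth R E G.
by apply: smooth_on_subset => z [zc zd]; split.
Qed.

Let pairing (z : E * E) : E * E := (iota z.1, z.2).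

Let pairing_smooth : smooth_on (O `*` ucod G) pairing.
Proof.
apply: smooth_on_pair; last exact: smooth_on_snd.
apply: (@smooth_on_comp _ _ _ _ _ O fst) => //.
- by apply: open_setX; [exact: ucod_inv_open|exact: ucod_open].
- exact: ucod_inv_open.
- by move=> z [].
- exact: smooth_on_fst.
Qed.

Let D1 : set (E * E) := (O `*` ucod G) `&` pairing @^-1` @umul_dom R E G.

Let D1o : open D1.
Proof.
apply: open_preimage_in; last exact: umul_dom_open.
  by apply: open_setX; [exact: ucod_inv_open|exact: ucod_open].
exact: smooth_on_continuous pairing_smooth.
Qed.

Let quot : E * E -> E := @umul R E G \o pairing.

Let quot_smooth : smooth_on D1 quot.
Proof.
apply: (@smooth_on_comp _ _ _ _ _ (@umul_dom R E G) pairing) => //.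
- exact: umul_dom_open.
- by move=> z [].
- by apply: smooth_on_subset pairing_smooth => z [].
- exact: umul_smooth.
Qed.

Let Wl : set E := ucod G `&` uinv G @^-1` W.

Let Wlo : open Wl.
Proof.
apply: open_preimage_in => //; first exact: ucod_open.
by move=> x /set_mem; exact: uinv_cont.
Qed.

Let D2 : set (E * E) := D1 `&` quot @^-1` Wl.

Let D2o : open D2.
Proof. by apply: open_preimage_in => //; exact: smooth_on_continuous quot_smooth. Qed.

(** In group terms [M (z, y) = log (g(z)^-1 g(y))] with [g = uinv G], on a neighbourhood of the
    diagonal. *)
Let M : E * E -> E := (l \o uinv G) \o quot.

Let M_smooth : smooth_on D2 M.
Proof.
apply: (@smooth_on_comp _ _ _ _ _ Wl quot) => //.
- by move=> z [].
- by apply: smooth_on_subset quot_smooth => z [].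
- exact: log_smooth ls.
Qed.

Let quotE z : D1 z -> uinv G (quot z) = ((uinv G z.1)^-1 * uinv G z.2)%g.
Proof.
move=> [[[zc zd] z2c] [_ zd2]]; rewrite /quot /= /umul umapK; last exact: zd2.
by rewrite /pairing /= umapK.
Qed.

Let D2diag z : O z -> D2 (z, z).
Proof.
move=> Oz; have [zc zd] := Oz.
have h : D1 (z, z).
  split; first by split.
  split; first by split=> //=; exact: umap_cod.
  by rewrite /= /iota umapK// mulVg; exact: udom1.
split=> //; split.
  by apply: umap_cod; case: h => _ [].
by rewrite /preimage /= quotE//= mulVg; exact: (log_dom1 he U0 UW).
Qed.

(** Since [M] vanishes on the diagonal, this is the derivative at [t = 0] of
    [log (g(z)^-1 g(z + t w))]. *)
Definition left_log_deriv (z : E * E) : E := ddir M ((z.1, z.1), (0, z.2)).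

Lemma left_log_deriv_smooth : smooth_on (O `*` [set: E]) left_log_deriv.
Proof.
have uo : open (O `*` [set: E]) by apply: open_setXT; exact: ucod_inv_open.
apply: (@smooth_on_comp _ _ _ _ _ (D2 `*` [set: E * E])
  (fun z : E * E => ((z.1, z.1), (0, z.2)))) => //.
- exact: open_setXT.
- by move=> [y w] [/= yc _]; split=> //; exact: D2diag.
- apply: smooth_on_pair; apply: smooth_on_pair.
  + exact: smooth_on_fst.
  + exact: smooth_on_fst.
  + exact: smooth_on_cst.
  + exact: smooth_on_snd.
- by apply: smooth_on_ddir => //; exact: (@hausdorff_model R E G).
Qed.

(** Here local exponentiality pays off: every differentiable curve is, up to left translation, an
    exponential with convergent direction [s t = t^-1 log (g(z)^-1 g(y t))]. *)
Lemma left_log_velocity (y : R -> E) z w : O z -> (fun t => t^-1 *: (y t - z)) @ 0^' --> w ->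
  exists s : R -> E, s @ 0^' --> left_log_deriv (z, w) /\
    \forall t \near 0^', uinv G (y t) = (uinv G z * e (t *: s t))%g.
Proof.
move=> Oz yw; have Dz := D2diag Oz.
have cv := velocity_pair (velocity_cst z) yw.
have Mzz : M (z, z) = 0.
  by rewrite /M /= quotE ?mulVg ?(log1 he U0 eK)//; case: Dz.
exists (fun t => t^-1 *: M (z, y t)); split.
  have := smooth_on_cvg_curve (@hausdorff_model R E G) D2o M_smooth Dz cv.
  by apply: near_eq_lim; near=> t; rewrite Mzz subr0.
have yz : (fun t => (z, y t)) @ 0^' --> (z, z).
  apply: cvg_pair_nbhs; first exact: cvg_cst.
  have : (fun t => z + t *: (t^-1 *: (y t - z))) @ 0^' --> z + 0 *: w.
    by apply: tvs_cvgD; [exact: cvg_cst|apply: tvs_cvgZ => //; exact: dnbhs0_id].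
  rewrite scale0r addr0; apply: near_eq_lim; near=> t.
  have t0 : t != 0 by near: t; exact: nbhs_dnbhs_neq.
  by rewrite scalerA divff// scale1r addrC subrK.
have yD : \forall t \near 0^', D2 (z, y t) := yz D2 (open_nbhs_nbhs (conj D2o Dz)).
near=> t.
have t0 : t != 0 by near: t; exact: nbhs_dnbhs_neq.
have [Dt [_ Wt]] : D2 (z, y t) by near: t.
rewrite scalerA divff// scale1r /M /= lK ?inE// quotE//=.
by rewrite mulVKg.
Unshelve. all: by end_near. Qed.

End LeftLogarithmicDerivative.

Lemma denseT (T : topologicalType) : dense [set: T].
Proof. by move=> O [x Ox] _; exists x. Qed.

Section OrbitSmoothness.
Context (R : realType) (E : tvsType R) (G : lieGroupType E) (V : hilbertType R)
  (pi : G -> {linear V -> V}) (hpi : unitary_representation pi)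
  (e : lie_algebra G -> G) (he : is_exponential e)
  (U : set (lie_algebra G)) (W : set G) (l : G -> lie_algebra G).
Hypotheses (U0 : U 0) (Wo : open W) (UW : set_fun U W e)
  (eK : {in U, cancel e l}) (lK : {in W, cancel l e})
  (ls : mfd_smooth_on atlas (@model_atlas R (lie_algebra G)) W l).
Local Notation VR := (realification V).
Local Notation O := (ucod_inv G).
Local Notation delta := (left_log_deriv l).

(** Product rule for the action. The change of the group element contributes the quotient [gquot] of
    [a0] along the moving direction [s t], so the limit must be joint in direction and step. *)
Lemma orbit_product_velocity (B : E -> V) (a : R -> V) (y : R -> E) (a0 a1 : V) (z w : E) :
  continuous B -> (forall x, gquot pi e x a0 @ 0^' --> B x) -> O z ->
  (fun t => t^-1 *: (y t - z)) @ 0^' --> w ->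
  (fun t : R => (t^-1)%:C%C *: (a t - a0)) @ 0^' --> a1 ->
  (fun t : R => (t^-1)%:C%C *: (pi (uinv G (y t)) (a t) - pi (uinv G z) a0)) @ 0^' -->
  pi (uinv G z) (B (delta (z, w))) + pi (uinv G z) a1.
Proof.
move=> Bc Ba Oz yw aa.
have [s [s0 sE]] := left_log_velocity he U0 Wo UW eK lK ls Oz yw.
have zc : ucod G z by case: Oz.
have yz : y @ 0^' --> z.
  have : (fun t => z + t *: (t^-1 *: (y t - z))) @ 0^' --> z + 0 *: w.
    by apply: tvs_cvgD; [exact: cvg_cst|apply: tvs_cvgZ => //; exact: dnbhs0_id].
  rewrite scale0r addr0; apply: near_eq_lim; near=> t.
  have t0 : t != 0 by near: t; exact: nbhs_dnbhs_neq.
  by rewrite scalerA divff// scale1r addrC subrK.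
have uy : (fun t => uinv G (y t)) @ 0^' --> uinv G z := cvg_comp _ _ yz (uinv_cont zc).
have part1 : (fun t => pi (uinv G (y t)) ((t^-1)%:C%C *: (a t - a0))) @ 0^' -->
    pi (uinv G z) a1 by exact: urep_cvg.
have idc : continuous (fun x : E => x) by move=> x; exact: cvg_id.
have cc : continuous (fun _ : E => a0) by move=> x; exact: cvg_cst.
have joint := gquot_cvg_dense (q0 := delta (z, w)) hpi he idc cc Bc (@denseT _)
  (fun x _ => Ba x).
have st : (fun t => (s t, t)) @ 0^' --> filter_prod (nbhs (delta (z, w))) 0^'.
  exact: (cvg_pair s0 (@cvg_id _ _)).
have part2 := urep_cont hpi (g := uinv G z) (x := B (delta (z, w))).
have part3 := cvg_comp _ _ (cvg_comp _ _ st joint) part2.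
apply: (near_eq_lim (p := fun t => pi (uinv G z) (gquot pi e (s t) a0 t) +
  pi (uinv G (y t)) ((t^-1)%:C%C *: (a t - a0)))); last exact: (cvgD part3 part1).
near=> t.
have E1 : uinv G (y t) = (uinv G z * e (t *: s t))%g by near: t.
rewrite /= /gquot !linearZ -scalerDr; congr (_ *: _).
rewrite !linearB /= -(urepM hpi) -E1.
by rewrite [LHS]addrC subrKA.
Unshelve. all: by end_near. Qed.

Lemma multilinear_gquot n (A : tpow E n -> V) (B : tpow E n -> V) x :
  (forall p, gquot pi e x (A p) @ 0^' --> B p) -> multilinear A -> multilinear B.
Proof.
elim: n A B => [|n IH] A B AB.
  by move=> A0 p q; apply: (gquot_unique (AB p)); rewrite (A0 p q); exact: AB.
move=> [Al A1]; split.
  move=> p a y z; apply: (gquot_unique (AB (a *: y + z, p))).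
  by rewrite Al; apply: gquot_linear; exact: AB.
by move=> y; apply: (IH _ _ _ (A1 y)) => p; exact: AB.
Qed.

Lemma tpow_hausdorff n : hausdorff_space (tpow E n).
Proof.
elim: n => [|n IH]; first exact: (@hausdorff_model R E G).
by apply: hausdorff_prod => //; exact: (@hausdorff_model R E G).
Qed.

Lemma multilinear_velocity n (A : tpow E n -> V) (c : R -> tpow E n) p q :
  continuous A -> multilinear A -> (fun t => t^-1 *: (c t - p)) @ 0^' --> q ->
  (fun t : R => (t^-1)%:C%C *: (A (c t) - A p)) @ 0^' -->
  \sum_(i < n) A (replace_factor i (p, q)).
Proof.
move=> Ac Am cq.
have dc : {in [set: tpow E n] `*` [set: tpow E n],
    continuous (fun z : tpow E n * tpow E n => \sum_(i < n) A (replace_factor i z) : VR)}.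
  move=> z _.
  (* [Ck_on 0] is plain continuity; in this form [Ck_on_sum] handles the finite sum. *)
  have : Ck_on 0 [set: tpow E n * tpow E n]
      (fun z => \sum_(i < n) A (replace_factor i z) : VR).
    apply: (@Ck_on_sum R 0 (tpow E n * tpow E n)%type VR setT _ _
      (fun (i : 'I_n) z => A (replace_factor i z))); first exact: openT.
    move=> i; split=> // z' _; apply: (@continuous_comp _ _ _ (replace_factor i) A).
      have := smooth_on_continuous (@replace_factor_smooth R E n i setT).
      by apply; rewrite inE.
    exact: Ac.
  by move=> [+ _]; apply; rewrite inE.
have der p' q' : [set: tpow E n] p' -> dir_quotient (A : tpow E n -> VR) p' q' @ 0^' -->
    (\sum_(i < n) A (replace_factor i (p', q')) : VR).
  by move=> _; exact: multilinear_derivative.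
apply: (near_eq_lim (p := fun t : R =>
  t^-1 *: ((A (p + t *: (t^-1 *: (c t - p))) : VR) - A p) : VR)).
  near=> t; have t0 : t != 0 by near: t; exact: nbhs_dnbhs_neq.
  by rewrite scalerA divff// scale1r [p + _]addrC subrK.
by apply: (strong_diff_cvg openT der dc) => //; exact: cvg_cst.
Unshelve. all: by end_near. Qed.

(* Everything produced by differentiating [z |-> pi (uinv (pr z)) (A (phi z))] is a
   sum of maps of the same shape, with [A] replaced by its derivative along
   one-parameter groups, or with [phi] replaced. *)
Lemma orbit_family_Ck k n (A : tpow E n -> V) (Z : tvsType R) (D : set Z)
    (phi : Z -> tpow E n) (pr : Z -> E) :
  Kdiff pi e (fun x : E => x) k A -> multilinear A -> open D ->
  smooth_on D phi -> smooth_on D pr -> set_fun D O pr ->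
  Ck_on k D (fun z => pi (uinv G (pr z)) (A (phi z)) : VR).
Proof.
elim: k n A Z D phi pr => [|k IH] n A Z D phi pr AK Am Do phis prs prO.
  split=> // z zD; apply: (urep_cvg hpi).
    have Oz := prO z (set_mem zD).
    apply: (@continuous_comp _ _ _ pr (uinv G)); first exact: smooth_on_continuous prs _ zD.
    by apply: uinv_cont; case: Oz.
  apply: (@continuous_comp _ _ _ phi A); first exact: smooth_on_continuous phis _ zD.
  by case: AK => Ac _; exact: Ac.
have [_ [B [BA Bl BK]]] := AK.
have Ac : continuous A by case: AK.
have hE := @hausdorff_model R E G.
have hP := @tpow_hausdorff n.
have D'o : open (D `*` [set: Z]) by exact: open_setXT.
have prs' : smooth_on (D `*` [set: Z]) (fun z => pr z.1) by exact: smooth_on_compfst.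
have phis' : smooth_on (D `*` [set: Z]) (fun z => phi z.1) by exact: smooth_on_compfst.
have prO' : set_fun (D `*` [set: Z]) O (fun z => pr z.1).
  by move=> z [/= Dz _]; exact: prO.
have base := IH _ _ _ _ _ _ (KdiffS AK) Am Do phis prs prO.
split; first exact: Ck_on_continuous base.
(* The first term differentiates the group element: [B] has one factor more than [A], filled by
   [delta]. The sum differentiates [phi], with [A] kept and its order lowered by [KdiffS]. *)
exists (fun z => (pi (uinv G (pr z.1)) (B (delta (pr z.1, ddir pr z), phi z.1)) : VR) +
   \sum_(i < n) (pi (uinv G (pr z.1)) (A (replace_factor i (phi z.1, ddir phi z))) : VR)).
  move=> z w Dz /=.
  have prw := smooth_on_cvg_ddir (v := w) hE prs Dz.
  have phiw := smooth_on_cvg_ddir (v := w) hP phis Dz.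
  have Bz : continuous (fun x => B (x, phi z)).
    by apply: cvg_slice2; exact: Kdiff_continuous BK.
  have BAz x : gquot pi e x (A (phi z)) @ 0^' --> B (x, phi z) by exact: BA.
  have h := orbit_product_velocity Bz BAz (prO z Dz) prw (multilinear_velocity Ac Am phiw).
  rewrite linear_sum in h; exact: h.
apply: Ck_on_add => //; last first.
  apply: (@Ck_on_sum R k (Z * Z)%type VR (D `*` setT) _ _ (fun (i : 'I_n) z =>
    pi (uinv G (pr z.1)) (A (replace_factor i (phi z.1, ddir phi z))))) => // i.
  apply: (IH n A _ _ (fun z => replace_factor i (phi z.1, ddir phi z)) (fun z => pr z.1)) => //.
    exact: KdiffS.
  apply: (@smooth_on_comp _ _ _ _ _ setT (fun z => (phi z.1, ddir phi z))) => //.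
  - exact: openT.
  - by apply: smooth_on_pair => //; exact: smooth_on_ddir.
  - exact: replace_factor_smooth.
apply: (IH n.+1 B _ _ (fun z => (delta (pr z.1, ddir pr z), phi z.1)) (fun z => pr z.1)) => //.
  split; first by move=> p a x y; exact: Bl.
  by move=> x; apply: (multilinear_gquot _ Am) => p; exact: BA.
apply: smooth_on_pair => //.
apply: (@smooth_on_comp _ _ _ _ _ (O `*` [set: E]) (fun z => (pr z.1, ddir pr z))) => //.
- by apply: open_setXT; exact: ucod_inv_open.
- by move=> z Dz; split=> //; exact: prO'.
- by apply: smooth_on_pair => //; exact: smooth_on_ddir.
- exact: (left_log_deriv_smooth he U0 Wo UW ls).
Qed.

Lemma Kdiff_smooth_vector v :
  (forall k, Kdiff pi e (fun x : E => x) k (fun _ : E => v)) -> smooth_vectors pi v.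
Proof.
move=> vK; apply: (smooth_vector_local hpi (U := O)).
- exact: ucod_inv_open.
- by move=> x [].
- exact: ucod_inv1.
(* A vector is a multilinear map in 0 variables; [phi] only fills the dummy factor
   [tpow E 0 = E]. *)
move=> k; apply: (@orbit_family_Ck k 0 (fun=> v) E O (fun z => z) (fun z => z)) => //.
- exact: ucod_inv_open.
- exact: smooth_on_id.
- exact: smooth_on_id.
Qed.

End OrbitSmoothness.

Lemma Kdiff_conj (R : realType) (E X : tvsType R) (G : lieGroupType E) (H : lieGroupType X)
    (V : hilbertType R) (pi : G -> {linear V -> V}) (f : H -> G)
    (e : lie_algebra G -> G) (d : lie_algebra H -> H) (L : X -> E) k
    (P : topologicalType) (A : P -> V) :
  (forall (x : X) (t : R), f (d (t *: x)) = e (t *: L x)) ->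
  Kdiff (pi \o f) d (fun x : X => x) k A -> Kdiff pi e L k A.
Proof.
move=> fd; elim: k P A => [|k IH] P A; first by move=> [Ac _]; split.
move=> [Ac [B [BA Bl BK]]]; split=> //; exists B; split=> //; last exact: IH.
move=> x p; apply: near_eq_lim (BA x p); near=> t.
by rewrite /gquot /= fd.
Unshelve. all: by end_near. Qed.

Lemma exp_naturality (R : realType) (E F : tvsType R) (G : lieGroupType E)
    (H : lieGroupType F) (f : H -> G) (e : lie_algebra G -> G) (d : lie_algebra H -> H)
    (U : set (lie_algebra G)) (W : set G) (l : G -> lie_algebra G) (y : lie_algebra H) :
  is_exponential e -> is_exponential d -> lie_morphism f ->
  open U -> U 0 -> open W -> set_fun U W e -> {in U, cancel e l} -> {in W, cancel l e} ->
  mfd_smooth_on atlas (@model_atlas R (lie_algebra G)) W l ->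
  f (d y) = e (derived f y).
Proof.
move=> he hd hf Uo U0 Wo UW eK lK ls; rewrite -[y in LHS]scale1r.
apply: (one_parameter_exp he Uo U0 Wo UW eK lK ls (g := fun t => f (d (t *: y)))).
  by move=> s t; rewrite (expD hd); case: hf.
exact: (morphism_velocity hf (exp_velocity y hd)).
Qed.

Theorem theorem4p12 (R : realType) (EG EH : tvsType R)
    (G : lieGroupType EG) (H : lieGroupType EH)
    (expG : lie_algebra G -> G) (expH : lie_algebra H -> H)
    (hexpG : is_exponential expG) (hexpH : is_exponential expH)
    (f : H -> G) (hf : lie_morphism f)
    (V : hilbertType R) (pi : G -> {linear V -> V})
    (hpi : unitary_representation pi)
    (hLf : topological_embedding (derived f))
    (hLf_dense : dense (range (derived f))) :
  (locally_exponential expG -> smooth_representation (pi \o f) ->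
     smooth_representation pi /\
     smooth_vectors pi = smooth_vectors (pi \o f)) /\
  (smooth_representation pi -> semibounded expH (pi \o f) ->
     semibounded expG pi).
Proof.
split=> [|hs hsb]; last exact: semibounded_of_dense hexpG hexpH hf hpi hLf hLf_dense hs hsb.
move=> [U [W [l [[Uo U0] Wo [UW _] [eK lK] ls]]]] hsf.
suff vectors : smooth_vectors pi = smooth_vectors (pi \o f).
  by split=> //; rewrite /smooth_representation vectors.
apply/seteqP; split=> [v|v vs]; first exact: smooth_vectors_comp.
apply: (Kdiff_smooth_vector hpi hexpG U0 Wo UW eK lK ls) => k.
apply: (Kdiff_dense hpi hexpG (derivedD hf) (derivedZ hf) hLf hLf_dense).
(* The constant family is parametrised by [EG] to match the dummy factor expected on the side of
   [G]. *)
apply: Kdiff_conj (smooth_vector_Kdiff (unitary_representation_comp hf hpi) hexpH k EG vs).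
move=> y t; rewrite -(derivedZ hf).
exact: (exp_naturality (t *: y) hexpG hexpH hf Uo U0 Wo UW eK lK ls).
Qed.
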